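(* Let $d\ge1$, $\kappa>0$, $\boldsymbol{\mu}\in\mathbb{S}^d$, and denote $\rho_d(\kappa)=\rho_d(f_{\rm vMF}(\cdot;\boldsymbol{\mu},\kappa))$ for the von Mises--Fisher density. Then $$\rho_d(\kappa)=\mathcal{I}_{(d-1)/2}(2\kappa)\Big\{4\pi^{2(1+1/d)}\,d\,\big(\mathcal{I}_{(d-1)/2}(\kappa)\big)^{8/d}\,\kappa^{2/d-1}\big[2d\,\mathcal{I}_{(d+1)/2}(2\kappa)+(d+2)\kappa\,\mathcal{I}_{(d+3)/2}(2\kappa)\big]\Big\}^{-d/(d+4)}$$ and (i) for fixed $d$, $\rho_d(\kappa)\sim\{4\pi^2d(d+2)\}^{-d/(d+4)}$ as $\kappa\to\infty$; (ii) for fixed $\kappa$, $\rho_d(\kappa)\sim d\,\{4\pi^2e^2\kappa^2\}^{-1}$ as $d\to\infty$.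
   Context: $\mathbb{S}^d$ is the unit sphere of $\mathbb{R}^{d+1}$ and $\sigma_d$ its surface area measure. The von Mises--Fisher density with respect to $\sigma_d$ is $f_{\rm vMF}(\boldsymbol{x};\boldsymbol{\mu},\kappa)=c_d^{\rm vMF}(\kappa)e^{\kappa\boldsymbol{x}^\top\boldsymbol{\mu}}$, with $c_d^{\rm vMF}(\kappa)=\kappa^{(d-1)/2}/\{(2\pi)^{(d+1)/2}\mathcal{I}_{(d-1)/2}(\kappa)\}$ and $\mathcal{I}_\nu$ the modified Bessel function of the first kind of order $\nu$. For a density $f$ on $\mathbb{S}^d$ with radial extension $\bar f(\boldsymbol{x})=f(\boldsymbol{x}/\|\boldsymbol{x}\|)$ on $\mathbb{R}^{d+1}\setminus\{\mathbf{0}\}$, $$\rho_d(f)=\frac{R(f)}{R(\nabla^2\bar f)^{d/(d+4)}},\qquad R(f)=\int_{\mathbb{S}^d}f^2\,d\sigma_d,\qquad R(\nabla^2\bar f)=\int_{\mathbb{S}^d}\{\nabla^2\bar f\}^2\,d\sigma_d,$$ where $\nabla^2$ is the Laplacian on $\mathbb{R}^{d+1}$. $a\sim b$ means $a/b\to1$. *)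

(* Defs.v *)
From HB Require Import structures.
From mathcomp Require Import all_boot all_order all_algebra.
From mathcomp Require Import all_classical all_reals all_analysis.
From mathcomp Require Import measurable_realfun.

Set Implicit Arguments.
Unset Strict Implicit.
Unset Printing Implicit Defensive.

Import Order.TTheory GRing.Theory Num.Theory.
Import numFieldNormedType.Exports.

Local Open Scope classical_set_scope.
Local Open Scope ring_scope.

Definition rV_display : measure_display.
Proof. exact: default_measure_display. Qed.

Section measurable_rV.
Context {R : realType} {n : nat}.

Let coord (i : 'I_n) (x : 'rV[R]_n) := x ord0 i.

Let rV_set0 : g_sigma_preimage coord set0.
Proof. exact: sigma_algebra0. Qed.

Let rV_setC A : g_sigma_preimage coord A -> g_sigma_preimage coord (~` A).
Proof. exact: sigma_algebraC. Qed.

Let rV_bigcup (F : _^nat) : (forall i, g_sigma_preimage coord (F i)) ->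
  g_sigma_preimage coord (\bigcup_i (F i)).
Proof. exact: sigma_algebra_bigcup. Qed.

(* The sigma-algebra of R^n generated by the coordinate projections, as for
   [n.-tuple] in the library; it is the Borel one. *)
HB.instance Definition _ := @isMeasurable.Build rV_display 'rV[R]_n
  (g_sigma_preimage coord) rV_set0 rV_setC rV_bigcup.

End measurable_rV.

Section measurable_rV_lemmas.
Context {R : realType}.

Lemma measurable_coord n (i : 'I_n) :
  measurable_fun [set: 'rV[R]_n] (fun x => x ord0 i).
Proof.
move=> _ Y mY; rewrite setTI; apply: sub_sigma_algebra => /=.
rewrite -bigcup_seq/=; exists i => /=; first by rewrite mem_index_enum.
by exists Y => //; rewrite setTI.
Qed.

Lemma measurable_fun_rVP d (T : measurableType d) n (f : T -> 'rV[R]_n) :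
  measurable_fun [set: T] f <->
  forall i, measurable_fun [set: T] (fun t => f t ord0 i).
Proof.
split=> [mf i|mf].
  exact: (measurableT_comp (measurable_coord i) mf).
move=> _; apply: smallest_sub => /=.
  split => //=.
  - by rewrite preimage_set0 setI0.
  - move=> A mA; rewrite setTI in mA; rewrite setTD setTI preimage_setC.
    exact: measurableC.
  - move=> F mF; rewrite setTI preimage_bigcup; apply: bigcup_measurable.
    by move=> k _; have := mF k; rewrite setTI.
rewrite -bigcup_seq => A [i _ [B mB <-]].
rewrite !setTI.
by have := mf i measurableT B mB; rewrite setTI.
Qed.

End measurable_rV_lemmas.

Section lebesgue_rV.
Context {R : realType}.

Definition rV_cons n (p : measurableTypeR R * 'rV[R]_n) : 'rV[R]_n.+1 :=
  row_mx (p.1%:M : 'M[R]_1) p.2.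

Definition rV_uncons n (x : 'rV[R]_n.+1) : measurableTypeR R * 'rV[R]_n :=
  (x ord0 ord0, \row_i x ord0 (lift ord0 i)).

Lemma rV_cons0 n (p : measurableTypeR R * 'rV[R]_n) :
  rV_cons p ord0 ord0 = p.1.
Proof.
have := row_mxEl (p.1%:M : 'M[R]_1) p.2 ord0 ord0.
rewrite [in RHS]mxE eqxx mulr1n => <-; congr (fun_of_matrix _ _ _); exact/val_inj.
Qed.

Lemma rV_cons_lift n (p : measurableTypeR R * 'rV[R]_n) i :
  rV_cons p ord0 (lift ord0 i) = p.2 ord0 i.
Proof.
rewrite -(row_mxEr (p.1%:M : 'M[R]_1) p.2 ord0 i).
by congr (fun_of_matrix _ _ _); exact/val_inj.
Qed.

Lemma rV_consK n : cancel (@rV_cons n) (@rV_uncons n).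
Proof.
move=> p; rewrite /rV_uncons rV_cons0 [RHS]surjective_pairing.
by congr pair; apply/rowP => i; rewrite mxE rV_cons_lift.
Qed.

Lemma rV_unconsK n : cancel (@rV_uncons n) (@rV_cons n).
Proof.
move=> x; apply/rowP => i.
by case: (unliftP ord0 i) => [j|] ->; rewrite ?rV_cons0 ?rV_cons_lift ?mxE.
Qed.

Lemma measurable_rV_cons n : measurable_fun setT (@rV_cons n).
Proof.
apply/measurable_fun_rVP => i; case: (unliftP ord0 i) => [j|] -> /=.
  under eq_fun do rewrite rV_cons_lift.
  exact: (measurableT_comp (measurable_coord j) measurable_snd).
by under eq_fun do rewrite rV_cons0; exact: measurable_fst.
Qed.

Lemma measurable_rV_uncons n : measurable_fun setT (@rV_uncons n).
Proof.
apply/measurable_fun_pair => /=; first exact: measurable_coord.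
apply/measurable_fun_rVP => i.
by under eq_fun do rewrite mxE; exact: measurable_coord.
Qed.

Section rV_prod.
Context {n : nat} (mu : {sigma_finite_measure set 'rV[R]_n -> \bar R}).

Definition lebesgue_rVS : set 'rV[R]_n.+1 -> \bar R :=
  pushforward (@lebesgue_measure R \x mu)%E (@rV_cons n).

Let mcons := @measurable_rV_cons n.

Let lebesgue_rVS0 : lebesgue_rVS set0 = 0%E.
Proof. by rewrite /lebesgue_rVS /pushforward preimage_set0 measure0. Qed.

Let lebesgue_rVS_ge0 A : (0 <= lebesgue_rVS A)%E.
Proof. exact: measure_ge0. Qed.

Let lebesgue_rVS_sigma_additive : semi_sigma_additive lebesgue_rVS.
Proof.
exact: measure_semi_sigma_additive.
Qed.

HB.instance Definition _ := isMeasure.Build _ _ _ lebesgue_rVS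
  lebesgue_rVS0 lebesgue_rVS_ge0 lebesgue_rVS_sigma_additive.

Let lebesgue_rVS_sigma_finite : sigma_finite setT lebesgue_rVS.
Proof.
have /sigma_finiteP[F [TF ndF Foo]] := sigma_finiteT (@lebesgue_measure R).
have /sigma_finiteP[G [TG ndG Goo]] := sigma_finiteT mu.
exists (fun k => @rV_uncons n @^-1` (F k `*` G k)).
  rewrite -preimage_bigcup; apply/esym; rewrite -[RHS](preimage_setT (@rV_uncons n)).
  congr (_ @^-1` _); apply/seteqP; split => // -[x y] _.
  have [k _ Fkx] : (\bigcup_k F k) x by rewrite -TF.
  have [l _ Gly] : (\bigcup_k G k) y by rewrite -TG.
  exists (maxn k l) => //; split => /=.
  - by move: x Fkx; exact/subsetPset/ndF/leq_maxl.
  - by move: y Gly; exact/subsetPset/ndG/leq_maxr.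
move=> k; have [mF Fk] := Foo k; have [mG Gk] := Goo k; split.
  rewrite -[X in measurable X]setTI; apply: measurable_rV_uncons => //.
  exact: measurableX.
rewrite /lebesgue_rVS /pushforward -comp_preimage.
rewrite (_ : _ \o _ = id) ?preimage_id.
  by rewrite product_measure1E// lte_mul_pinfty// ge0_fin_numE.
by apply/funext => p /=; rewrite rV_consK.
Qed.

HB.instance Definition _ := Measure_isSigmaFinite.Build _ _ _ lebesgue_rVS
  lebesgue_rVS_sigma_finite.

End rV_prod.

Fixpoint lebesgue_rV n : {sigma_finite_measure set 'rV[R]_n -> \bar R} :=
  if n is n'.+1 then lebesgue_rVS (lebesgue_rV n') else \d_(0 : 'rV[R]_0).

End lebesgue_rV.

Section sphere.
Context {R : realType}.

Definition dot {n} (x y : 'rV[R]_n) : R := (x *m y^T) ord0 ord0.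

(* The canonical norm [`|x|] of a matrix is the supremum norm. *)
Definition enorm {n} (x : 'rV[R]_n) : R := Num.sqrt (dot x x).

Definition normalize {n} (x : 'rV[R]_n) : 'rV[R]_n := (enorm x)^-1 *: x.

Definition sphere d : set 'rV[R]_d.+1 := [set x | enorm x = 1].

Definition cone n (A : set 'rV[R]_n) : set 'rV[R]_n :=
  [set x | 0 < enorm x <= 1] `&` normalize @^-1` A.

Lemma dotE n (x y : 'rV[R]_n) : dot x y = \sum_i x ord0 i * y ord0 i.
Proof. by rewrite /dot mxE; apply: eq_bigr => i _; rewrite mxE. Qed.

Lemma dot_ge0 n (x : 'rV[R]_n) : 0 <= dot x x.
Proof. by rewrite dotE; apply: sumr_ge0 => i _; rewrite -expr2 sqr_ge0. Qed.

Lemma measurable_enorm n : measurable_fun setT (@enorm n).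
Proof.
have -> : @enorm n = (fun r => r `^ 2^-1) \o (fun x => dot x x).
  by apply/funext => x /=; rewrite powR12_sqrt// dot_ge0.
apply: measurableT_comp; first exact: measurable_powR.
under eq_fun do rewrite dotE.
by apply: measurable_sum => i; apply: measurable_funM; exact: measurable_coord.
Qed.

Lemma measurable_normalize n : measurable_fun setT (@normalize n).
Proof.
apply/measurable_fun_rVP => i; under eq_fun do rewrite mxE.
apply: measurable_funM; last exact: measurable_coord.
under eq_fun do rewrite -powR_inv1 ?sqrtr_ge0//.
exact: (measurableT_comp (measurable_powR _) (@measurable_enorm n)).
Qed.

Lemma measurable_cone n (A : set 'rV[R]_n) :
  measurable A -> measurable (cone A).
Proof.
move=> mA; apply: measurableI.
  have -> : [set x | 0 < enorm x <= 1] = @enorm n @^-1` `]0, 1].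
    by apply/seteqP; split => x /=; rewrite in_itv.
  by rewrite -[X in measurable X]setTI; exact: measurable_enorm.
by rewrite -[X in measurable X]setTI; exact: measurable_normalize.
Qed.

(* The surface area measure, carried by [sphere d]: it assigns to A the measure
   of the solid cone over A in the unit ball, times the dimension d + 1. *)
Definition sphere_measure d (A : set 'rV[R]_d.+1) : \bar R :=
  (d.+1%:R%:E * lebesgue_rV d.+1 (cone A))%E.

Section sphere_measure.
Variable d : nat.
Local Notation sigma := (@sphere_measure d).

Let sigma0 : sigma set0 = 0%E.
Proof.
by rewrite /sphere_measure /cone preimage_set0 setI0 measure0 mule0.
Qed.

Let sigma_ge0 A : (0 <= sigma A)%E.
Proof. by rewrite mule_ge0// lee_fin. Qed.

Let sigma_sigma_additive : semi_sigma_additive sigma.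
Proof.
move=> F mF tF mUF; rewrite /sphere_measure.
have -> : (fun n => \sum_(0 <= i < n) d.+1%:R%:E * lebesgue_rV d.+1 (cone (F i)))%E =
    (fun n => d.+1%:R%:E * \sum_(0 <= i < n) lebesgue_rV d.+1 (cone (F i)))%E.
  by apply/funext => n; rewrite ge0_sume_distrr.
apply: cvgeZl => //.
rewrite /cone preimage_bigcup setI_bigcupr.
apply: measure_sigma_additive => [i|]; first exact: measurable_cone.
apply: trivIset_setIl; apply/trivIsetP => i j _ _ ij.
by rewrite -preimage_setI; move/trivIsetP : tF => ->//; rewrite preimage_set0.
Qed.

HB.instance Definition _ := isMeasure.Build _ _ _ sigma
  sigma0 sigma_ge0 sigma_sigma_additive.

End sphere_measure.
End sphere.

Arguments sphere {R} d _.

Section special_functions.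
Context {R : realType}.

Definition Gamma (s : R) : R :=
  \int[lebesgue_measure]_(t in `]0, +oo[) (t `^ (s - 1) * expR (- t)).

(* The power series at a positive argument z; the order nu has to exceed -1,
   since the integral in [Gamma] does not give the analytic continuation. *)
Definition besselI (nu z : R) : R :=
  limn (series (fun k : nat =>
    (z / 2) `^ (2 * k%:R + nu) / (k`!%:R * Gamma (nu + k%:R + 1)))).

End special_functions.

Section smoothing.
Context {R : realType}.

Definition radial_ext n (f : 'rV[R]_n -> R) : 'rV[R]_n -> R :=
  fun x => f (normalize x).

Definition laplacian n (f : 'rV[R]_n -> R) : 'rV[R]_n -> R :=
  fun x => \sum_(i < n) 'D_(delta_mx ord0 i) ('D_(delta_mx ord0 i) f) x.

Definition sphere_sqint d (f : 'rV[R]_d.+1 -> R) : R :=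
  \int[@sphere_measure R d]_(x in sphere d) (f x ^+ 2).

Definition rho d (f : 'rV[R]_d.+1 -> R) : R :=
  sphere_sqint f /
  sphere_sqint (laplacian (radial_ext f)) `^ (d%:R / (d%:R + 4)).

End smoothing.

Section von_Mises_Fisher.
Context {R : realType}.

Definition vMF_const (d : nat) (kappa : R) : R :=
  kappa `^ ((d%:R - 1) / 2) /
  ((2 * pi) `^ ((d%:R + 1) / 2) * besselI ((d%:R - 1) / 2) kappa).

Definition vMF d (mu : 'rV[R]_d.+1) (kappa : R) : 'rV[R]_d.+1 -> R :=
  fun x => vMF_const d kappa * expR (kappa * dot x mu).

End von_Mises_Fisher.

(* Main.v *)
Require Import Defs.
From mathcomp Require Import all_boot all_order all_algebra.
From mathcomp Require Import all_classical all_reals all_analysis.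
From mathcomp Require Import measurable_realfun ring lra.

Set Implicit Arguments.
Unset Strict Implicit.
Unset Printing Implicit Defensive.

Import Order.TTheory GRing.Theory Num.Theory.
Import numFieldNormedType.Exports.

Local Open Scope classical_set_scope.
Local Open Scope ring_scope.

(** Write t = <x, mu> and T_p(a) for the integral of t^p e^{at} over the sphere.

    The moments of t are obtained without polar coordinates: for a homogeneous
    F, layer-cake integration reduces the integral of F(x) e^{-|x|^2/2} over
    R^{d+1} to an integral over the unit ball, hence to one over the sphere,
    while the Gaussian moment generating function e^{s^2/2} gives the Gaussian
    moments as power series coefficients.  Summing the moments,
    T_0(a) = (2 pi)^{(d+1)/2} a^{-(d-1)/2} I_{(d-1)/2}(a).  On the sphere the
    Laplacian of the radial extension of e^{kappa t} is
    e^{kappa t} (kappa^2 (1 - t^2) - d kappa t), so R of it is a combination of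
    T_0(2 kappa), ..., T_4(2 kappa), which integration by parts reduces to
    T_0 and T_1.

    As a -> oo, the central projection of the half sphere t > 0 onto its tangent
    space at mu and dominated convergence (Laplace's method) give
    I_{(d-1)/2}(a) ~ e^a / sqrt(2 pi a).  As d -> oo, the Bessel series is
    equivalent to its first term, and the Stirling estimate
    ln Gamma((d+1)/2) = (d/2) ln(d/(2e)) + O(ln d) suffices because
    Gamma enters rho with the exponent 4/(d+4). *)

(** * Lebesgue measure on R^n and the cone measure on the sphere *)
Section lebesgue_rV_theory.
Context {R : realType}.
Local Notation leb := (@lebesgue_measure R).

(** The surface measure is a cone measure, so an integral over the sphere is [d.+1] times an
    integral over the punctured unit ball of a function of x/|x|. For F homogeneous of degree m two
    comparisons are therefore needed: the Gaussian integral of F with the ball integral of F(x), and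
    the latter with the ball integral of F(x/|x|). Both rest on Tonelli, hence on nonnegative
    integrands: even powers of t are treated in the extended reals, and odd moments vanish by the
    antipodal map. [Gamma] is a bare integral; its finiteness and positivity at n/2, n >= 2, are
    read off the Gaussian moment of order 0, and its functional equation is used from argument 1 on,
    which is where d >= 1 enters. Raising a Bessel order by one amounts to raising d by two, so
    every Bessel function met has a natural index and its identities are identities between terms of
    moment series. The closed formula and the constants of the limits are identities between
    monomials in positive quantities with exponents rational in d, checked through logarithms. For
    large d, Gamma^(4/(d+4)) behaves like (d/(2e))^2, the origin of e^2. *)

Lemma ge0_integral_rVS n (f : 'rV[R]_n.+1 -> \bar R) :
  measurable_fun setT f -> (forall x, 0 <= f x)%E ->
  (\int[lebesgue_rV n.+1]_x f x =
   \int[lebesgue_rV n]_y \int[leb]_t f (rV_cons (t, y)))%E.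
Proof.
move=> mf f0.
rewrite -(fubini_tonelli2 (m1 := leb) (m2 := lebesgue_rV n)
  (fun z => f (rV_cons z))) //; last first.
  exact: (measurableT_comp mf (@measurable_rV_cons R n)).
rewrite -[RHS]/(\int[leb \x lebesgue_rV n]_(x in rV_cons (n:=n) @^-1` setT) (f \o (@rV_cons R n)) x)%E.
by rewrite -ge0_integral_pushforward//; exact: measurable_rV_cons.
Qed.

Lemma ge0_integral_rVS' n (f : 'rV[R]_n.+1 -> \bar R) :
  measurable_fun setT f -> (forall x, 0 <= f x)%E ->
  (\int[lebesgue_rV n.+1]_x f x =
   \int[leb]_t \int[lebesgue_rV n]_y f (rV_cons (t, y)))%E.
Proof.
move=> mf f0; rewrite ge0_integral_rVS//.
rewrite -(fubini_tonelli (m1 := leb) (m2 := lebesgue_rV n)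
  (fun z => f (rV_cons z))) //.
exact: (measurableT_comp mf (@measurable_rV_cons R n)).
Qed.

(** Both sides are measures in [A] that agree on half-open intervals. Negative [r] is included for
    the antipodal map and for slices t < 0. *)
Lemma lebesgue_measure_scale (r : R) (A : set (measurableTypeR R)) : r != 0 -> measurable A ->
  leb A = (`|r|%:E * leb (( *%R r) @^-1` A))%E.
Proof.
move=> r0; move: A.
have mr : measurable_fun setT ( *%R r : measurableTypeR R -> measurableTypeR R).
  exact: mulrl_measurable.
apply: (@lebesgue_measure_unique R
  (mscale (NngNum (normr_ge0 r))
    (pushforward leb ( *%R r : measurableTypeR R -> measurableTypeR R)))).
move=> _ [[a b]] _ <- /=.
rewrite /mscale/= /pushforward lebesgue_measure_itv/= lte_fin.
have [rp|rn|] := ltgtP r 0; last by move=> re; rewrite re eqxx in r0.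
  have -> : *%R r @^-1` `]a, b] = `[b / r, a / r[%classic :> set R.
    by apply/seteqP; split => x /=; rewrite !in_itv/= => /andP[];
    rewrite ler_ndivrMr// ltr_ndivlMr// mulrC => -> ; rewrite mulrC => ->.
  rewrite lebesgue_measure_itv/= lte_fin ltr_nM2r ?invr_lt0//.
  case: ifPn => // ab; last by rewrite mule0.
  by rewrite -!EFinB -EFinM -mulrBl ltr0_norm// mulrC mulrN mulfVK// opprB.
have -> : *%R r @^-1` `]a, b] = `]a / r, b / r]%classic :> set R.
  by apply/seteqP; split => x /=; rewrite !in_itv/= => /andP[];
  rewrite ler_pdivlMr// ltr_pdivrMr// mulrC => -> ; rewrite mulrC => ->.
rewrite lebesgue_measure_itv/= lte_fin ltr_pM2r ?invr_gt0//.
case: ifPn => // ab; last by rewrite mule0.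
by rewrite -!EFinB -EFinM -mulrBl gtr0_norm// mulrC mulfVK.
Qed.

Lemma ge0_integral_scale (r : R) (f : measurableTypeR R -> \bar R) : r != 0 ->
  measurable_fun setT f -> (forall t, 0 <= f t)%E ->
  (\int[leb]_t f t = `|r|%:E * \int[leb]_t f (r * t)%R)%E.
Proof.
move=> r0 mf f0.
have mr : measurable_fun setT ( *%R r : measurableTypeR R -> measurableTypeR R).
  exact: mulrl_measurable.
pose mu : {measure set (measurableTypeR R) -> \bar R} :=
  measure_function_pushforward__canonical__measure_function_Measure leb mr.
transitivity (\int[mscale (NngNum (normr_ge0 r)) mu]_t f t)%E.
  by apply: eq_measure_integral => A mA _; exact: lebesgue_measure_scale.
rewrite ge0_integral_mscale//=; congr (_ * _)%E.
by rewrite ge0_integral_pushforward.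
Qed.

Lemma ge0_integral_mrestr d (T : measurableType d) (m : {measure set T -> \bar R})
    (D E : set T) (mD : measurable D) (f : T -> \bar R) :
  measurable E -> measurable_fun E f -> (forall x, E x -> 0 <= f x)%E ->
  (\int[mrestr m mD]_(x in E) f x = \int[m]_(x in E `&` D) f x)%E.
Proof.
move=> mE mf f0.
rewrite (@ge0_negligible_integral _ _ _ (mrestr m mD) E (~` D))//; last 2 first.
- exact: measurableC.
- by rewrite /= /mrestr setICl measure0.
rewrite setDE setCK.
apply: eq_measure_integral => A mA AD; rewrite /= /mrestr setIidl//.
by apply: subset_trans AD _; exact: subIsetr.
Qed.

Lemma rV_consZ n r (t : R) (y : 'rV[R]_n) :
  r *: rV_cons (t, y) = rV_cons (r * t, r *: y).
Proof.
apply/rowP => i; rewrite mxE.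
by case: (unliftP ord0 i) => [j|] ->; rewrite ?rV_cons0 ?rV_cons_lift ?mxE.
Qed.

Lemma measurable_scale_rV n (r : R) :
  measurable_fun setT (fun x : 'rV[R]_n => r *: x).
Proof.
apply/measurable_fun_rVP => i; under eq_fun do rewrite mxE.
by apply: measurable_funM => //; exact: measurable_coord.
Qed.

Lemma measurable_rV_section n (f : 'rV[R]_n.+1 -> \bar R) :
  measurable_fun setT f -> (forall x, 0 <= f x)%E ->
  measurable_fun setT (fun y => \int[leb]_t f (rV_cons (t, y)))%E.
Proof.
move=> mf f0.
apply: (@measurable_fun_fubini_tonelli_G _ _ _ _ R leb (fun z => f (rV_cons z))) => //.
exact: (measurableT_comp mf (@measurable_rV_cons R n)).
Qed.

(** Induction on the dimension, since [lebesgue_rV] is an iterated product: the induction hypothesis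
    rescales the tail, the one-dimensional case the head. *)
Lemma ge0_integral_rV_scale n (r : R) (f : 'rV[R]_n -> \bar R) : r != 0 ->
  measurable_fun setT f -> (forall x, 0 <= f x)%E ->
  (\int[lebesgue_rV n]_x f x = (`|r| ^+ n)%:E * \int[lebesgue_rV n]_x f (r *: x)%R)%E.
Proof.
move=> r0; elim: n f => [|n IH] f mf f0.
  rewrite expr0 mul1e/= !integral_dirac// ?scaler0//.
  exact: (measurableT_comp mf (measurable_scale_rV r)).
have mfc : measurable_fun setT (f \o (@rV_cons R n)).
  exact: (measurableT_comp mf (@measurable_rV_cons R n)).
rewrite !ge0_integral_rVS//; last exact: (measurableT_comp mf (measurable_scale_rV r)).
rewrite (IH (fun y => \int[leb]_t f (rV_cons (t, y)))%E); first last.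
- by move=> y; exact: integral_ge0.
- exact: measurable_rV_section.
rewrite exprSr EFinM -muleA; congr (_ * _)%E.
rewrite -ge0_integralZl//.
- apply: eq_integral => y _.
  under [in RHS]eq_integral do rewrite rV_consZ.
  apply: (ge0_integral_scale (f := fun t => f (rV_cons (t, r *: y)))) => //.
  by apply: (measurableT_comp mfc); exact: measurable_pair2.
- apply: (measurable_rV_section (f := fun x => f (r *: x))) => //.
  exact: (measurableT_comp mf (measurable_scale_rV r)).
- by move=> y _; exact: integral_ge0.
Qed.

Lemma integral_gauss_shift (m : R) :
  (\int[leb]_t (expR (- (t - m) ^+ 2 / 2))%:E = (Num.sqrt (2 * pi))%:E)%E.
Proof.
have := @integral_normal_pdf R m 1.
under eq_integral do rewrite normal_pdfE ?oner_neq0// /normal_fun expr1n EFinM.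
have s0 : (0 : R) < Num.sqrt (2 * pi) by rewrite sqrtr_gt0 mulr_gt0// pi_gt0.
rewrite ge0_integralZl//=; last 2 first.
- apply/measurable_EFinP; apply: measurableT_comp => //.
  apply: measurable_funM => //; apply: measurableT_comp => //.
  by apply: measurable_funX; apply: measurable_funB.
- by rewrite lee_fin normal_peak_ge0.
rewrite /normal_peak expr1n mul1r -mulr_natl.
move=> /(congr1 (fun y => (Num.sqrt (2 * pi))%:E * y)%E).
rewrite mule1 muleA -EFinM divff ?gt_eqF// mul1e => <-.
by apply: eq_integral => t _.
Qed.

Lemma dot_cons n (t u : R) (x y : 'rV[R]_n) :
  dot (rV_cons (t, x)) (rV_cons (u, y)) = t * u + dot x y.
Proof.
rewrite !dotE big_ord_recl !rV_cons0; congr (_ + _).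
by apply: eq_bigr => i _; rewrite !rV_cons_lift.
Qed.

Lemma dot_consl n (t : R) (x : 'rV[R]_n) (mu : 'rV[R]_n.+1) :
  dot (rV_cons (t, x)) mu = t * mu ord0 ord0 + dot x (rV_uncons mu).2.
Proof. by rewrite -[mu in LHS]rV_unconsK dot_cons. Qed.

Lemma measurable_dot n (mu : 'rV[R]_n) : measurable_fun setT (fun x => dot x mu).
Proof.
under eq_fun do rewrite dotE.
by apply: measurable_sum => i; apply: measurable_funM => //; exact: measurable_coord.
Qed.

Lemma measurable_dotxx n : measurable_fun setT (fun x : 'rV[R]_n => dot x x).
Proof.
under eq_fun do rewrite dotE.
by apply: measurable_sum => i; apply: measurable_funM => //; exact: measurable_coord.
Qed.

(** Gaussian moment generating function. Each coordinate is handled by completing the square, -t^2/2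
    + a t = -(t - a)^2/2 + a^2/2. *)
Lemma integral_gauss_rV n (mu : 'rV[R]_n) :
  (\int[lebesgue_rV n]_x (expR (- dot x x / 2 + dot x mu))%:E =
   (Num.sqrt (2 * pi) ^+ n * expR (dot mu mu / 2))%:E)%E.
Proof.
have mg m (nu : 'rV[R]_m) : measurable_fun setT (fun x => (expR (- dot x x / 2 + dot x nu))%:E).
  apply/measurable_EFinP; apply: measurableT_comp => //.
  apply: measurable_funD; last exact: measurable_dot.
  apply: measurable_funM => //; apply: measurableT_comp => //.
  exact: measurable_dotxx.
elim: n mu => [|n IH] mu.
  rewrite /= integral_dirac//; last exact: mg.
  rewrite diracT mul1e expr0 mul1r; congr (expR _)%:E.
  by rewrite !dotE !big_ord0 oppr0 !mul0r addr0.
rewrite ge0_integral_rVS//.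
pose a := mu ord0 ord0; pose nu := (rV_uncons mu).2.
transitivity (\int[lebesgue_rV n]_y ((Num.sqrt (2 * pi) * expR (a ^+ 2 / 2))%:E * (expR (- dot y y / 2 + dot y nu))%:E))%E.
  apply: eq_integral => y _.
  transitivity (\int[leb]_t ((expR (a ^+ 2 / 2) * expR (- dot y y / 2 + dot y nu))%:E * (expR (- (t - a) ^+ 2 / 2))%:E))%E.
    apply: eq_integral => t _; rewrite -!EFinM -!expRD dot_cons dot_consl.
    congr (expR _)%:E; rewrite -/a -/nu; by field.
  rewrite ge0_integralZl//.
  - by rewrite integral_gauss_shift -!EFinM; congr (_)%:E; ring.
  - apply/measurable_EFinP; apply: measurableT_comp => //.
    apply: measurable_funM => //; apply: measurableT_comp => //.
    by apply: measurable_funX; apply: measurable_funB.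
rewrite ge0_integralZl//; last exact: mg.
rewrite IH -EFinM; congr (_)%:E.
have -> : dot mu mu = a ^+ 2 + dot nu nu by rewrite -[mu in LHS]rV_unconsK dot_cons.
by rewrite [(_ + _) / 2]mulrDl expRD [_ ^+ n.+1]exprS mulrACA.
Qed.

(** The origin is left out because [normalize] sends it to 0, off the sphere. At radius 1 this is
    the domain on which [cone] is cut out. *)
Definition punctured_ball n (s : R) : set 'rV[R]_n := [set x | 0 < enorm x <= s].

Local Notation pball n s := (@punctured_ball n s).

Lemma measurable_punctured_ball n s : measurable (pball n s).
Proof.
have -> : pball n s = @enorm R n @^-1` `]0, s].
  by apply/seteqP; split => x /=; rewrite in_itv.
by rewrite -[X in measurable X]setTI; exact: measurable_enorm.
Qed.

Lemma enorm_ge0 n (x : 'rV[R]_n) : 0 <= enorm x.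
Proof. exact: sqrtr_ge0. Qed.

Lemma enormZ n r (x : 'rV[R]_n) : enorm (r *: x) = `|r| * enorm x.
Proof.
rewrite /enorm -sqrtr_sqr -sqrtrM ?sqr_ge0//; congr Num.sqrt.
by rewrite !dotE mulr_sumr; apply: eq_bigr => i _; rewrite !mxE; ring.
Qed.

Lemma dotZl n r (x y : 'rV[R]_n) : dot (r *: x) y = r * dot x y.
Proof. by rewrite !dotE mulr_sumr; apply: eq_bigr => i _; rewrite !mxE mulrA. Qed.

Lemma enorm_normalize n (x : 'rV[R]_n) : 0 < enorm x -> enorm (normalize x) = 1.
Proof.
by move=> x0; rewrite /normalize enormZ ger0_norm ?invr_ge0 ?ltW// mulVf ?gt_eqF.
Qed.

Lemma normalizeZ n r (x : 'rV[R]_n) : 0 < r -> normalize (r *: x) = normalize x.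
Proof.
move=> r0; rewrite /normalize enormZ scalerA gtr0_norm// invfM mulrAC mulVf ?mul1r//.
by rewrite gt_eqF.
Qed.

Lemma measurable_sphere d : measurable (@sphere R d).
Proof.
have -> : @sphere R d = @enorm R d.+1 @^-1` [set 1] by [].
by rewrite -[X in measurable X]setTI; exact: measurable_enorm.
Qed.

(** Change of variables for a measure that is [c] times the image under [g] of [lam] restricted to
    [U]. The surface measure has this shape, with [normalize] for [g] and the punctured unit ball
    for [U]. *)
Lemma ge0_integral_mscale_pushforward_mrestr d1 d2 (T1 : measurableType d1)
    (T2 : measurableType d2) (lam : {measure set T1 -> \bar R})
    (sig : {measure set T2 -> \bar R}) (c : R) (U : set T1) (S : set T2)
    (g : T1 -> T2) (f : T2 -> \bar R) : 0 <= c -> measurable U -> measurable S ->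
  measurable_fun setT g -> U `<=` g @^-1` S ->
  (forall A, measurable A -> sig A = c%:E * lam (U `&` g @^-1` A))%E ->
  measurable_fun setT f -> (forall x, 0 <= f x)%E ->
  (\int[sig]_(x in S) f x = c%:E * \int[lam]_(x in U) f (g x))%E.
Proof.
move=> c0 mU mS mg US sigE mf f0.
have mS' : measurable (g @^-1` S).
  by rewrite -[X in measurable X]setTI; exact: mg.
pose mu : {measure set T2 -> \bar R} :=
  measure_function_pushforward__canonical__measure_function_Measure (mrestr lam mU) mg.
have -> : (\int[sig]_(x in S) f x = \int[mscale (NngNum c0) mu]_(x in S) f x)%E.
  apply: eq_measure_integral => A mA _.
  by rewrite sigE// /mscale/= /pushforward/= /mrestr setIC.
rewrite ge0_integral_mscale//; last exact: measurable_funS mf.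
congr (_ * _)%E.
rewrite ge0_integral_pushforward//; last exact: measurable_funS mf.
rewrite ge0_integral_mrestr//; last 2 first.
- by apply: measurable_funTS; exact: (measurableT_comp mf mg).
- by move=> x _; exact: f0.
by rewrite setIidr.
Qed.

Lemma ge0_integral_sphere d (f : 'rV[R]_d.+1 -> \bar R) :
  measurable_fun setT f -> (forall x, 0 <= f x)%E ->
  (\int[@sphere_measure R d]_(x in sphere d) f x =
   d.+1%:R%:E * \int[lebesgue_rV d.+1]_(x in pball d.+1 1) f (normalize x))%E.
Proof.
move=> mf f0; apply: ge0_integral_mscale_pushforward_mrestr => //.
- exact: measurable_punctured_ball.
- exact: measurable_sphere.
- exact: measurable_normalize.
- by move=> x /= /andP[x0 _]; rewrite /sphere /=; exact: enorm_normalize.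
Qed.

Lemma ge0_integral_pball_scale n (s r : R) (f : 'rV[R]_n -> \bar R) : 0 < r ->
  measurable_fun setT f -> (forall x, 0 <= f x)%E ->
  (\int[lebesgue_rV n]_(x in pball n (r * s)) f x =
   (r ^+ n)%:E * \int[lebesgue_rV n]_(x in pball n s) f (r *: x)%R)%E.
Proof.
move=> r0 mf f0.
have mb := @measurable_punctured_ball n.
rewrite integral_mkcond (@ge0_integral_rV_scale _ r) ?gt_eqF//; last 2 first.
- apply/(measurable_restrictT _ _).1 => //; exact: measurable_funTS.
- by move=> x; apply: erestrict_ge0.
rewrite gtr0_norm// [in RHS]integral_mkcond; congr (_ * _)%E.
apply: eq_integral => x _; rewrite !patchE /=.
congr (if _ then _ else _); apply/idP/idP; rewrite !inE /punctured_ball /= enormZ gtr0_norm//.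
  by move=> /andP[]; rewrite pmulr_rgt0// => -> /=; rewrite ler_pM2l.
by move=> /andP[]; rewrite pmulr_rgt0// => -> /=; rewrite ler_pM2l.
Qed.

(** The origin lies in the hyperplane x_0 = 0, a product with a null factor. Dimension 0 is
    excluded: there the measure is the Dirac mass at the origin. *)
Lemma lebesgue_rV_null n : (lebesgue_rV n.+1 [set x : 'rV[R]_n.+1 | (enorm x = 0)%R] = 0)%E.
Proof.
have ms : measurable ([set 0%R] : set (measurableTypeR R)) by exact: measurable_set1.
have mE : measurable [set x : 'rV[R]_n.+1 | enorm x = 0].
  rewrite (_ : mkset _ = @enorm R n.+1 @^-1` [set 0])//.
  by rewrite -[X in measurable X]setTI; exact: measurable_enorm.
have mH : measurable [set x : 'rV[R]_n.+1 | x ord0 ord0 = 0].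
  rewrite (_ : mkset _ = (fun x : 'rV[R]_n.+1 => x ord0 ord0) @^-1` [set 0])//.
  by rewrite -[X in measurable X]setTI; exact: measurable_coord.
apply: (@subset_measure0 _ _ _ _ _ [set x : 'rV[R]_n.+1 | x ord0 ord0 = 0]) => //.
  move=> x /= /eqP; rewrite /enorm sqrtr_eq0 => x0; apply/eqP.
  have : dot x x = 0 by apply/eqP; rewrite eq_le x0 dot_ge0.
  rewrite dotE => /eqP; rewrite psumr_eq0; last by move=> i _; rewrite -expr2 sqr_ge0.
  by move=> /allP /(_ ord0 (mem_index_enum _)) /=; rewrite mulf_eq0 orbb.
rewrite /= /lebesgue_rVS /pushforward.
rewrite (_ : _ @^-1` _ = [set 0] `*` setT); last first.
  by apply/seteqP; split => -[t y] /=; rewrite rV_cons0//= => -[].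
rewrite product_measure1E//.
by rewrite -[X in (X * _)%E]/(leb [set 0]) lebesgue_measure_set1 mul0e.
Qed.

Lemma ge0_integral_punctured n (f : 'rV[R]_n.+1 -> \bar R) :
  measurable_fun setT f -> (forall x, 0 <= f x)%E ->
  (\int[lebesgue_rV n.+1]_x f x =
   \int[lebesgue_rV n.+1]_(x in [set x | (0 < enorm x)%R]) f x)%E.
Proof.
move=> mf f0.
have mE : measurable [set x : 'rV[R]_n.+1 | enorm x = 0].
  rewrite (_ : mkset _ = @enorm R n.+1 @^-1` [set 0])//.
  by rewrite -[X in measurable X]setTI; exact: measurable_enorm.
rewrite (@ge0_negligible_integral _ _ _ _ _ [set x | enorm x = 0])//; last exact: lebesgue_rV_null.
congr integral; apply/seteqP; split => x /=; rewrite ?setTD /=.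
  by move=> [_ /eqP x0]; rewrite lt_neqAle eq_sym x0 enorm_ge0.
by move=> x0; split => // x1; rewrite x1 ltxx in x0.
Qed.

End lebesgue_rV_theory.

(** * Integrals of homogeneous functions *)
Section layer_cake.
Context {R : realType}.
Local Notation leb := (@lebesgue_measure R).
Local Notation pball n s := (@punctured_ball R n s).

(** The integral of [Gamma] kept in the extended reals: identities obtained by Tonelli then hold
    before finiteness is known. *)
Definition GammaE (s : R) : \bar R :=
  (\int[leb]_(t in `]0%R, +oo[) (t `^ (s - 1) * expR (- t))%:E)%E.

Lemma is_derive_continuous (F : R -> R) (x df : R) :
  is_derive x (1 : R) F df -> {for x, continuous F}.
Proof.
move=> dF; apply: (@differentiable_continuous _ R R^o).
by apply/derivable1_diffP; exact: ex_derive.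
Qed.

Lemma integral_expRN (a : R) :
  (\int[leb]_(u in `[a, +oo[) (expR (- u))%:E = (expR (- a))%:E)%E.
Proof.
have d1 (x : R) : is_derive x (1 : R) (fun u : R => - expR (- u)) (expR (- x)).
  by apply: is_derive_eq; rewrite /GRing.scale/= mulrN1 opprK.
rewrite (@ge0_continuous_FTC2y R (fun u => expR (- u)) (fun u => - expR (- u)) a 0).
- by rewrite sub0e EFinN oppeK.
- by move=> x _; exact: expR_ge0.
- apply: continuous_subspaceT => x.
  by apply: continuous_comp; [exact: continuousN|exact: continuous_expR].
- by rewrite -oppr0; apply: cvgN; exact: cvgr_expR.
- by move=> x _; exact: ex_derive.
- by apply: cvg_at_right_filter; exact: is_derive_continuous (d1 a).
- by move=> x _; rewrite derive1E; exact: derive_val.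
Qed.

Lemma measurable_mem_pball n d (T : measurableType d) (g : T -> 'rV[R]_n) (s : T -> R) :
  measurable_fun setT g -> measurable_fun setT s ->
  measurable [set z | pball n (s z) (g z)].
Proof.
move=> mg ms.
have me : measurable_fun setT (fun z => enorm (g z)).
  exact: (measurableT_comp (@measurable_enorm R n) mg).
have -> : [set z | pball n (s z) (g z)] =
   (fun z => (0 < enorm (g z)) && (enorm (g z) <= s z)) @^-1` [set true].
  by apply/seteqP; split => z.
rewrite -[X in measurable X]setTI.
by apply: measurable_and => //; [exact: measurable_fun_ltr|exact: measurable_fun_ler].
Qed.

Lemma measurable_gaussrV n : measurable_fun setT (fun x : 'rV[R]_n => expR (- (dot x x / 2))).
Proof.
apply: measurableT_comp => //; apply: measurableT_comp => //.
by apply: measurable_funM => //; exact: measurable_dotxx.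
Qed.

Lemma continuous_derive_FTC2 (f F : R -> R) a b : a <= b ->
  (forall x : R, is_derive x (1 : R) F (f x)) -> continuous f ->
  (\int[leb]_(x in `[a, b]) (f x)%:E = (F b - F a)%:E)%E.
Proof.
rewrite le_eqVlt => /predU1P[->|ab] dF cf.
  by rewrite set_itv1 integral_set1 subrr.
have cF : continuous F.
  move=> x; apply: (@differentiable_continuous _ R R^o).
  by apply/derivable1_diffP; exact: ex_derive.
rewrite EFinB; apply: continuous_FTC2 => //.
- exact: continuous_subspaceT.
- split; first by move=> x _; exact: ex_derive.
  + by apply: cvg_at_right_filter; exact: cF.
  + by apply: cvg_at_left_filter; exact: cF.
- by move=> x _; rewrite derive1E; exact: derive_val.
Qed.

Lemma integral_exprn k (a b : R) : a <= b ->
  (\int[leb]_(s in `[a, b]) (k.+1%:R * s ^+ k)%:E = (b ^+ k.+1 - a ^+ k.+1)%:E)%E.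
Proof.
move=> ab; apply: (@continuous_derive_FTC2 _ (fun s => s ^+ k.+1)) => // x.
  rewrite (_ : (fun s => s ^+ k.+1) = (id : R -> R) ^+ k.+1); last by apply/funext => s; rewrite exprfctE.
  by apply: is_derive_eq; rewrite /GRing.scale/= mulr1 mulr_natl.
by apply: (@continuousM R R^o (cst k.+1%:R) (fun s => s ^+ k)); [exact: cvg_cst|exact: exprn_continuous].
Qed.

Lemma measurable_erestrict d (T : measurableType d) (D : set T) (f : T -> R) :
  measurable D -> measurable_fun setT f ->
  measurable_fun setT ((fun x => (f x)%:E) \_ D).
Proof.
move=> mD mf; apply/(measurable_restrictT _ _).1 => //; apply: measurable_funTS.
exact/measurable_EFinP.
Qed.

(** * Gaussian, ball and cone integrals of one nonnegative homogeneous function *)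

Section homogeneous.
Variables (n m : nat) (F : 'rV[R]_n.+1 -> R).
Hypotheses (mF : measurable_fun setT F) (F0 : forall x, 0 <= F x)
  (FZ : forall r x, 0 < r -> F (r *: x) = r ^+ m * F x).
Let N := n.+1.
Local Notation B := (\int[lebesgue_rV N]_(x in pball N 1) (F x)%:E)%E.
Local Notation W := (\int[lebesgue_rV N]_(x in pball N 1) (F (normalize x))%:E)%E.

Lemma pball_homogeneous (s : R) : 0 < s ->
  (\int[lebesgue_rV N]_(x in pball N s) (F x)%:E = (s ^+ (N + m))%:E * B)%E.
Proof.
move=> s0; rewrite -{1}[s]mulr1 ge0_integral_pball_scale//; last exact/measurable_EFinP.
under eq_integral do rewrite FZ// EFinM.
rewrite ge0_integralZl//; last first.
- by rewrite lee_fin exprn_ge0 ?ltW.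
- by move=> x _; rewrite lee_fin.
- by apply/measurable_EFinP; exact: measurable_funTS.
- exact: measurable_punctured_ball.
by rewrite muleA -EFinM exprD.
Qed.

Lemma pball_neg (s : R) : s <= 0 -> pball N s = set0.
Proof.
by move=> s0; apply/seteqP; split => // x /= /andP[x0 xs]; have := lt_le_trans x0 (le_trans xs s0); rewrite ltxx.
Qed.

(* Layer cake: e^{-q} is the integral of e^{-u} over u >= q, with q = |x|^2/2. *)
Lemma gauss_homogeneous :
  (\int[lebesgue_rV N]_x (F x * expR (- (dot x x / 2)))%:E =
   (2 `^ ((N + m)%:R / 2))%:E * GammaE ((N + m)%:R / 2 + 1) * B)%E.
Proof.
have B0 : (0 <= B)%E by apply: integral_ge0 => x _; rewrite lee_fin.
rewrite ge0_integral_punctured; last 2 first.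
- by apply/measurable_EFinP; apply: measurable_funM => //; exact: measurable_gaussrV.
- by move=> x; rewrite lee_fin mulr_ge0 ?expR_ge0.
pose A := [set z : 'rV[R]_N * measurableTypeR R | pball N (Num.sqrt (2 * z.2)) z.1].
have mA : measurable A.
  apply: measurable_mem_pball => //.
  apply: measurableT_comp; first by apply: continuous_measurable_fun; exact: sqrt_continuous.
  by apply: measurable_funM => //; exact: measurable_snd.
pose h z := (F z.1 * expR (- z.2) * \1_A z)%:E.
have mh : measurable_fun setT h.
  apply/measurable_EFinP; apply: measurable_funM => //.
  apply: measurable_funM; first exact: (measurableT_comp mF measurable_fst).
  by apply: measurableT_comp => //; apply: measurableT_comp => //; exact: measurable_snd.
have h0 z : (0 <= h z)%E by rewrite lee_fin !mulr_ge0// expR_ge0.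
transitivity (\int[lebesgue_rV N]_x \int[leb]_u h (x, u))%E.
  rewrite integral_mkcond; apply: eq_integral => x _; rewrite patchE.
  case: ifPn => [|/negP]; rewrite inE /= => x0; last first.
    rewrite integral0_eq// => u _; rewrite /h indicE memNset ?mulr0//.
    by rewrite /A /= /punctured_ball /= => /andP[].
  rewrite EFinM -integral_expRN integral_mkcond/= -ge0_integralZl//; last first.
  - by rewrite lee_fin.
  - by move=> u _; apply: erestrict_ge0 => v _; rewrite lee_fin expR_ge0.
  - apply/(measurable_restrictT _ _).1 => //; apply: measurable_funTS.
    by apply/measurable_EFinP; apply: measurableT_comp.
  apply: eq_integral => u _; rewrite /h patchE indicE.
  have -> : ((x, u) \in A) = (u \in `[dot x x / 2, +oo[%classic).
    apply/idP/idP; rewrite !inE /A /= /punctured_ball /= in_itv/= andbT x0 /=.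
      rewrite /enorm => le; rewrite ler_pdivrMr// mulrC.
      have u0 : 0 < 2 * u.
        by rewrite -sqrtr_gt0; exact: lt_le_trans le.
      by rewrite -ler_sqrt// ltW.
    by move=> le; rewrite ler_wsqrtr// mulrC -ler_pdivrMr.
  by case: ifPn; rewrite ?mulr1 ?mulr0 ?mule0.
rewrite (fubini_tonelli (m1 := lebesgue_rV N) (m2 := leb) h)//.
rewrite -muleA muleCA /GammaE.
rewrite -ge0_integralZr//; last first.
- by rewrite mule_ge0// lee_fin powR_ge0.
- by move=> t _; rewrite lee_fin mulr_ge0 ?powR_ge0 ?expR_ge0.
- apply/measurable_EFinP; apply: measurable_funTS; apply: measurable_funM.
    exact: measurable_powR.
  by apply: measurableT_comp.
rewrite [RHS]integral_mkcond; apply: eq_integral => u _; rewrite patchE.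
transitivity ((expR (- u))%:E * \int[lebesgue_rV N]_(x in pball N (Num.sqrt (2 * u))) (F x)%:E)%E.
  rewrite [in RHS]integral_mkcond -ge0_integralZl//; last first.
  - by move=> x _; apply: erestrict_ge0 => v _; rewrite lee_fin.
  - apply/(measurable_restrictT _ _).1 => //; first exact: measurable_punctured_ball.
    by apply: measurable_funTS; apply/measurable_EFinP.
  apply: eq_integral => x _; rewrite /h patchE indicE /=.
  have -> : ((x, u) \in A) = (x \in pball N (Num.sqrt (2 * u))).
    by apply/idP/idP; rewrite !inE.
  by case: ifPn => _; rewrite ?mulr1 ?mulr0 ?mule0// EFinM muleC.
case: ifPn => [|/negP]; rewrite inE /= in_itv/= andbT => u0; last first.
  (* For u <= 0 the square root takes its default value 0, so the punctured ball is empty. *)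
  have -> : Num.sqrt (2 * u) = 0.
    by apply/eqP; rewrite sqrtr_eq0 pmulr_rle0// leNgt; exact/negP.
  by rewrite pball_neg// integral_set0 mule0.
rewrite pball_homogeneous ?sqrtr_gt0 ?mulr_gt0//.
rewrite !muleA -!EFinM; congr (_%:E * _)%E.
(* sqrt(2u)^(N+m) = 2^((N+m)/2) u^((N+m)/2), and (N+m)/2 is the exponent s - 1 of [GammaE] at s =
   (N+m)/2 + 1. *)
rewrite -powR12_sqrt ?mulr_ge0 ?(ltW u0)// -powR_mulrn ?powR_ge0// -powRrM.
rewrite addrK [2^-1 * _]mulrC powRM ?(ltW u0)//; ring.
Qed.

(** Layer cake for the weight: F(x) = |x|^m F(x/|x|), where 1 - |x|^m is the integral of m s^(m-1)
    over |x| <= s <= 1, and the ball of radius s contributes s^N W; integrating m s^(m-1+N) gives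
    m/(m+N). The form W = B + c W, left unsolved, avoids a subtraction in the extended reals. *)
Lemma ball_homogeneous : (0 < m)%N ->
  (W = B + (m%:R / (m + N)%:R)%:E * W)%E.
Proof.
move=> m0.
have mFn : measurable_fun setT (fun x => F (normalize x)).
  exact: (measurableT_comp mF (@measurable_normalize R N)).
have W0 : (0 <= W)%E by apply: integral_ge0 => x _; rewrite lee_fin.
have mb := @measurable_punctured_ball R N.
pose A := [set z : 'rV[R]_N * measurableTypeR R | pball N z.2 z.1].
have mA : measurable A by apply: measurable_mem_pball.
pose I := `]0, 1]%classic : set (measurableTypeR R).
pose w (s : R) := m%:R * s ^+ m.-1.
have mw : measurable_fun [set: measurableTypeR R] w.
  by apply: measurable_funM => //; exact: measurable_funX.
have w0 s : 0 <= s -> 0 <= w s by move=> s0; rewrite mulr_ge0// exprn_ge0.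
pose h z := (F (normalize z.1) * w z.2 * \1_A z * \1_I z.2)%:E.
have mh : measurable_fun setT h.
  apply/measurable_EFinP; apply: measurable_funM; last first.
    apply: (measurableT_comp _ measurable_snd); apply: measurable_indic.
    exact: measurable_itv.
  apply: measurable_funM => //.
  apply: measurable_funM; first exact: (measurableT_comp mFn measurable_fst).
  exact: (measurableT_comp mw measurable_snd).
have h0 z : (0 <= h z)%E.
  rewrite lee_fin /h indicE [\1_I _]indicE; case: (boolP (_ \in I)); last by rewrite mulr0.
  rewrite inE /I /= in_itv/= => /andP[/ltW z0 _].
  by rewrite mulr1 mulr_ge0// mulr_ge0// w0.
have hx x : (\int[leb]_s h (x, s) = (fun x => (F (normalize x) * (1 - enorm x ^+ m))%:E) \_ (pball N 1) x)%E.
  rewrite patchE; case: ifPn => [|/negP]; rewrite inE /punctured_ball /= => xb; last first.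
    rewrite integral0_eq// => s _; rewrite /h !indicE.
    have [|] := boolP (_ \in A); rewrite ?(mulr0,mul0r)//.
    have [|] := boolP (_ \in I); rewrite ?(mulr0,mul0r)//.
    rewrite !inE /A /I /punctured_ball /= in_itv/= => /andP[s0 s1] /andP[x0 xs].
    by exfalso; apply: xb; rewrite x0 (le_trans xs).
  have /andP[x0 x1] := xb.
  transitivity ((F (normalize x))%:E * \int[leb]_(s in `[enorm x, 1%R]) (w s)%:E)%E; last first.
    rewrite EFinM; congr (_ * _)%E; rewrite /w -{1}(prednK m0) integral_exprn// prednK//.
    by rewrite expr1n.
  rewrite [in RHS]integral_mkcond/= -ge0_integralZl//; last first.
  - by rewrite lee_fin.
  - move=> s _; apply: erestrict_ge0 => t /=; rewrite in_itv/= lee_fin => /andP[xt _].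
    by rewrite w0// (le_trans _ xt)// ltW.
  - by apply: measurable_erestrict.
  apply: eq_integral => s _; rewrite /h patchE !indicE.
  have -> : (s \in `[enorm x, 1%R]%classic) = ((x, s) \in A) && (s \in I).
    apply/idP/andP => [|[]]; rewrite !inE /A /I /punctured_ball /= !in_itv/=.
      by move=> /andP[xs s1]; rewrite x0 xs s1 (lt_le_trans x0).
    by move=> /andP[_ ->] /andP[_ ->].
  by case: ((x, s) \in A); case: (s \in I); rewrite /= ?(mulr0,mulr1,mule0)// EFinM.
have W1 : W = (B + \int[lebesgue_rV N]_(x in pball N 1) (F (normalize x) * (1 - enorm x ^+ m))%:E)%E.
  rewrite -ge0_integralD//; last first.
  - apply/measurable_EFinP; apply: measurable_funTS; apply: measurable_funM => //.
    apply: measurable_funB => //; apply: measurable_funX; exact: measurable_enorm.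
  - move=> x /andP[x0 x1]; rewrite lee_fin mulr_ge0// subr_ge0.
    by rewrite exprn_ile1// ltW.
  - by apply/measurable_EFinP; exact: measurable_funTS.
  - by move=> x _; rewrite lee_fin.
  apply: eq_integral => x; rewrite inE => /andP[x0 x1]; rewrite -EFinD; congr (_%:E).
  have {2}-> : x = enorm x *: normalize x.
    by rewrite /normalize scalerA divff ?scale1r// gt_eqF.
  by rewrite (@FZ (enorm x) (normalize x) x0); ring.
rewrite {1}W1; congr (_ + _)%E.
rewrite integral_mkcond; under eq_integral do rewrite -hx.
rewrite (fubini_tonelli (m1 := lebesgue_rV N) (m2 := leb) h)//.
transitivity (\int[leb]_(s in `]0%R, 1%R]) ((w s * s ^+ N)%:E * W))%E.
  rewrite [RHS]integral_mkcond; apply: eq_integral => s _; rewrite patchE.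
  case: ifPn => [|/negP] sI; last first.
    by rewrite integral0_eq// => x _; rewrite /h [\1_I _]indicE (negbTE (introN idP sI)) mulr0.
  have := sI; rewrite inE /= in_itv/= => /andP[s0 s1].
  transitivity ((w s)%:E * \int[lebesgue_rV N]_(x in pball N s) (F (normalize x))%:E)%E; last first.
    have mFnE : measurable_fun setT (fun x => (F (normalize x))%:E).
      exact/measurable_EFinP.
    have FnE0 x : (0 <= (F (normalize x))%:E)%E by rewrite lee_fin.
    have := @ge0_integral_pball_scale R N 1 s _ s0 mFnE FnE0; rewrite mulr1 => ->.
    under eq_integral do rewrite normalizeZ//.
    by rewrite muleA.
  rewrite [in RHS]integral_mkcond -ge0_integralZl//; last first.
  - by rewrite lee_fin w0// ltW.
  - by move=> x _; apply: erestrict_ge0 => v _; rewrite lee_fin.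
  - exact: measurable_erestrict.
  apply: eq_integral => x _; rewrite /h patchE !indicE /= sI mulr1.
  have -> : ((x, s) \in A) = (x \in pball N s) by apply/idP/idP; rewrite !inE.
  by case: ifPn => _; rewrite ?mulr1 ?mulr0 ?mule0// EFinM muleC.
have mwN : measurable_fun [set: measurableTypeR R] (fun s => w s * s ^+ N).
  by apply: measurable_funM => //; exact: measurable_funX.
rewrite ge0_integralZr//; last first.
- by move=> s /=; rewrite in_itv/= => /andP[s0 _]; rewrite lee_fin mulr_ge0 ?w0 ?exprn_ge0// ltW.
- by apply/measurable_EFinP; apply: measurable_funTS.
congr (_ * _)%E.
rewrite integral_itv_obnd_cbnd; last first.
  by apply/measurable_EFinP; apply: measurable_funTS.
transitivity (\int[leb]_(s in `[0%R, 1%R]) ((m%:R / (m + N)%:R)%:E * ((m + n).+1%:R * s ^+ (m + n))%:E))%E.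
  apply: eq_integral => s _; rewrite -EFinM /w; congr (_%:E).
  rewrite -[(m + n).+1]addnS -/N mulrA divfK ?pnatr_eq0 ?addnS//.
  by rewrite -mulrA -exprD; congr (_ * _ ^+ _); rewrite /N addnS -addSn prednK.
rewrite ge0_integralZl//; last first.
- by move=> s /=; rewrite in_itv/= => /andP[s0 _]; rewrite lee_fin mulr_ge0 ?exprn_ge0.
- apply/measurable_EFinP; apply: measurable_funTS; exact: measurable_funM.
by rewrite integral_exprn// expr1n expr0n subr0 mule1.
Qed.

End homogeneous.

(** Tonelli on the triangle 0 < t <= u, applied to x t^(x-1) e^(-u), in place of an integration by
    parts on a half-line. For x >= 1 the power t^(x-1) is continuous up to 0, as the fundamental
    theorem of calculus requires. *)
Lemma GammaE_rec (x : R) : 1 <= x -> (GammaE (x + 1) = x%:E * GammaE x)%E.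
Proof.
move=> x1.
have x0 : 0 < x by exact: lt_le_trans x1.
pose A := [set z : measurableTypeR R * measurableTypeR R | z.1 <= z.2].
have mA : measurable A.
  have -> : A = (fun z => z.1 <= z.2) @^-1` [set true] by [].
  rewrite -[X in measurable X]setTI.
  apply: measurable_fun_ler => //.
pose I := `]0, +oo[%classic : set (measurableTypeR R).
pose w (t : R) := x * t `^ (x - 1).
have mw : measurable_fun [set: measurableTypeR R] w.
  by apply: measurable_funM => //; exact: measurable_powR.
have w0 t : 0 <= w t by rewrite mulr_ge0 ?powR_ge0// ltW.
pose h z := (w z.1 * expR (- z.2) * \1_A z * \1_I z.1)%:E.
have me : measurable_fun [set: measurableTypeR R] (fun u : R => expR (- u)).
  exact: measurableT_comp.
have mI : measurable I by exact: measurable_itv.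
have mh : measurable_fun setT h.
  apply/measurable_EFinP; apply: measurable_funM; last first.
    apply: (measurableT_comp _ measurable_fst); exact: measurable_indic.
  apply: measurable_funM => //.
  apply: measurable_funM; first exact: (measurableT_comp mw measurable_fst).
  exact: (measurableT_comp me measurable_snd).
have h0 z : (0 <= h z)%E by rewrite lee_fin mulr_ge0// mulr_ge0// mulr_ge0// expR_ge0.
rewrite /GammaE -ge0_integralZl//; last first.
- by rewrite lee_fin ltW.
- by move=> t _; rewrite lee_fin mulr_ge0 ?powR_ge0 ?expR_ge0.
- apply/measurable_EFinP; exact: measurable_funTS (measurable_funM (measurable_powR _) me).
transitivity (\int[leb]_t \int[leb]_u h (t, u))%E; last first.
  rewrite [RHS]integral_mkcond; apply: eq_integral => t _; rewrite patchE.
  case: ifPn => [|/negP] tI; last first.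
    by rewrite integral0_eq// => u _; rewrite /h [\1_I _]indicE (negbTE (introN idP tI)) mulr0.
  rewrite -EFinM mulrA -/(w t) EFinM -integral_expRN [in RHS]integral_mkcond/=.
  rewrite -ge0_integralZl//; last first.
  - by rewrite lee_fin.
  - by move=> u _; apply: erestrict_ge0 => v _; rewrite lee_fin expR_ge0.
  - exact: measurable_erestrict.
  apply: eq_integral => u _; rewrite /h patchE !indicE tI mulr1.
  have -> : ((t, u) \in A) = (u \in `[t, +oo[%classic).
    by apply/idP/idP; rewrite !inE /A /= in_itv/= andbT.
  by case: ifPn; rewrite ?mulr1 ?mulr0 ?mule0.
rewrite (fubini_tonelli (m1 := leb) (m2 := leb) h)//.
rewrite integral_mkcond; apply: eq_integral => u _; rewrite patchE addrK.
case: ifPn => [|/negP]; rewrite inE /= in_itv/= andbT => u0; last first.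
  rewrite integral0_eq// => t _; rewrite /h !indicE.
  have [|] := boolP (_ \in A); rewrite ?(mulr0,mul0r)//.
  have [|] := boolP (_ \in I); rewrite ?(mulr0,mul0r)//.
  rewrite !inE /A /I /= in_itv/= andbT => t0 tu.
  by exfalso; apply: u0; exact: lt_le_trans tu.
transitivity (\int[leb]_(t in `]0%R, u]) ((expR (- u))%:E * (w t)%:E))%E; last first.
  rewrite [LHS]integral_mkcond; apply: eq_integral => t _; rewrite /h patchE !indicE.
  have -> : (t \in `]0%R, u]%classic) = ((t, u) \in A) && (t \in I).
    apply/idP/andP => [|[]]; rewrite !inE /A /I /= !in_itv/= andbT.
      by move=> /andP[-> ->].
    by move=> -> ->.
  by case: (_ \in A); case: (_ \in I); rewrite /= ?(mulr0,mulr1)// mulrC EFinM.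
rewrite ge0_integralZl//; last first.
- by move=> t _; rewrite lee_fin.
- by apply/measurable_EFinP; exact: measurable_funTS.
rewrite integral_itv_obnd_cbnd; last by apply/measurable_EFinP; exact: measurable_funTS.
have dF (t : R) : 0 < t -> is_derive t (1 : R) (fun s => s `^ x) (w t).
  move=> t0; apply: DeriveDef; first by apply: derivable_powR; rewrite in_itv/= t0.
  by rewrite -derive1E powR_derive1// in_itv/= t0.
have cpow (p t : R) : 0 < t -> {for t, continuous (fun s => s `^ p)}.
  move=> t0; apply: (@differentiable_continuous _ R R^o).
  by apply/derivable1_diffP; apply: derivable_powR; rewrite in_itv/= t0.
rewrite (@continuous_FTC2 R w (fun s => s `^ x) 0 u u0).
- by rewrite powR0 ?gt_eqF// sube0 -EFinM mulrC.
- apply/(continuous_within_itvP _ u0); split.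
  + move=> t; rewrite in_itv/= => /andP[t0 _].
    by apply: (@continuousM R R^o (cst x) (fun s => s `^ (x - 1))); [exact: cvg_cst|exact: cpow].
  + apply: cvgM; first exact: cvg_cst.
    (* For x = 1 the power t^(x-1) is constantly 1, also at t = 0; for x > 1 both its value and its
       limit at 0 are 0. *)
    move: x1; rewrite le_eqVlt => /predU1P[<-|x1].
      by rewrite subrr; under eq_fun do rewrite powRr0; rewrite powRr0; exact: cvg_cst.
    by rewrite powR0 ?subr_eq0 ?gt_eqF//; apply: powR_cvg0; rewrite subr_gt0.
  + apply: cvg_at_left_filter; apply: cvgM; first exact: cvg_cst.
    exact: cpow.
- split.
  + by move=> t; rewrite in_itv/= => /andP[t0 _]; have dFt := dF _ t0; exact: ex_derive.
  + by rewrite powR0 ?gt_eqF//; exact: powR_cvg0.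
  + by apply: cvg_at_left_filter; exact: cpow.
- move=> t; rewrite in_itv/= => /andP[t0 _]; have := dF _ t0 => dft.
  by rewrite derive1E; exact: derive_val.
Qed.

(** On the ball 1 <= e^(1/2) e^(-|x|^2/2), so the Gaussian integral bounds the volume. *)
Lemma lebesgue_pball_fin n : (lebesgue_rV n (pball n 1) < +oo)%E.
Proof.
have mb := @measurable_punctured_ball R n 1.
have mg := @measurable_gaussrV n.
have := integral_gauss_rV (0 : 'rV[R]_n).
have -> : (\int[@lebesgue_rV R n]_x (expR (- dot x x / 2 + dot x 0))%:E =
   \int[@lebesgue_rV R n]_x (expR (- (dot x x / 2)))%:E)%E.
  apply: eq_integral => x _; rewrite mulNr.
  by rewrite [dot x 0]dotE big1 ?addr0// => i _; rewrite mxE mulr0.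
move=> I; rewrite -[X in (X < _)%E]mul1e -integral_cst//.
apply: (@le_lt_trans _ _ (\int[lebesgue_rV n]_(x in pball n 1) ((expR 2^-1)%:E * (expR (- (dot x x / 2)))%:E))%E).
  apply: ge0_le_integral => //.
  - by apply: emeasurable_funM => //; apply/measurable_EFinP; exact: measurable_funTS.
  - move=> x /andP[x0 x1] /=; rewrite -EFinM lee_fin -expRD -[leLHS]expR0 ler_expR.
    rewrite subr_ge0 ler_pdivrMr// mulVf// -[leRHS](expr1n _ 2) -[leLHS]sqr_sqrtr ?dot_ge0//.
    by rewrite lerXn2r ?nnegrE ?enorm_ge0//.
rewrite ge0_integralZl//; last first.
- by apply/measurable_EFinP; exact: measurable_funTS.
apply: lte_mul_pinfty => //.
apply: (@le_lt_trans _ _ (\int[lebesgue_rV n]_x (expR (- (dot x x / 2)))%:E)%E).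
  apply: ge0_subset_integral => //; exact/measurable_EFinP.
by rewrite I ltry.
Qed.

End layer_cake.

(** * Uniqueness of power series coefficients *)
Section power_series.
Context {R : realType}.

Lemma cvg_double_infty : (fun n => n.*2) @ \oo --> \oo.
Proof.
apply/cvgnyPge => A; exists A => // n /= An.
by rewrite (leq_trans An)// -addnn leq_addr.
Qed.

Lemma series_double (u : R^nat) n :
  series u n.*2 = \sum_(0 <= j < n) (u j.*2 + u j.*2.+1).
Proof.
elim: n => [|n IH]; first by rewrite /series/= !big_geq.
rewrite big_nat_recr//= -IH /series/= doubleS.
by rewrite big_nat_recr//= big_nat_recr//= addrA.
Qed.

Lemma cvg_series_even (u : R^nat) (l : R) : (forall j, u j.*2.+1 = 0) ->
  series u @ \oo --> l -> series (fun j => u j.*2) @ \oo --> l.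
Proof.
move=> u0 ul.
have -> : series (fun j => u j.*2) = series u \o (fun n => n.*2).
  by apply/funext => n /=; rewrite series_double; apply: eq_bigr => j _; rewrite u0 addr0.
exact: (cvg_comp _ _ cvg_double_infty).
Qed.

Lemma cvg_series_odd (u : R^nat) (l : R) : (forall j, u j.*2 = 0) ->
  series u @ \oo --> l -> series (fun j => u j.*2.+1) @ \oo --> l.
Proof.
move=> u0 ul.
have -> : series (fun j => u j.*2.+1) = series u \o (fun n => n.*2).
  by apply/funext => n /=; rewrite series_double; apply: eq_bigr => j _; rewrite u0 add0r.
exact: (cvg_comp _ _ cvg_double_infty).
Qed.

Lemma cvg_exp_series (x : R) : series (exp_coeff x) @ \oo --> expR x.
Proof. exact: is_cvg_series_exp_coeff. Qed.

Lemma cvg_cosh_series (x : R) :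
  series (fun j => x ^+ j.*2 / (j.*2)`!%:R) @ \oo --> (expR x + expR (- x)) / 2.
Proof.
pose u k : R := (exp_coeff x k + exp_coeff (- x) k) / 2.
have uE k : u k = (x ^+ k + (- x) ^+ k) / k`!%:R / 2 by rewrite /u /exp_coeff -mulrDl.
have H (c f : R) : (c + c) / f / 2 = c / f.
  by rewrite [_ / f / 2]mulrAC -mulr2n -[c *+ 2]mulr_natr mulfK ?pnatr_eq0.
have -> : (fun j => x ^+ j.*2 / (j.*2)`!%:R) = (fun j => u j.*2).
  by apply/funext => j; rewrite uE -[j.*2]mul2n !exprM sqrrN H.
apply: (@cvg_series_even u).
  by move=> j; rewrite uE !exprS -[j.*2]mul2n !exprM sqrrN mulNr subrr !mul0r.
have -> : series u = (fun n => (series (exp_coeff x) n + series (exp_coeff (- x)) n) / 2).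
  by apply/funext => n; rewrite /series/= -big_split/= mulr_suml.
by apply: cvgMl; apply: cvgD; exact: cvg_exp_series.
Qed.

Lemma geometric_sum_le (u : R) n : 0 <= u <= 2^-1 -> \sum_(0 <= i < n) u ^+ i <= 2.
Proof.
move=> /andP[u0 u1].
have u2 : 0 < 1 - u by lra.
have -> : \sum_(0 <= i < n) u ^+ i = (1 - u ^+ n) / (1 - u).
  apply: (canRL (mulfK _)); first by rewrite gt_eqF.
  by rewrite big_mkord mulrC -[1 - u]opprB mulNr -subrX1 opprB.
rewrite ler_pdivrMr//; have := exprn_ge0 n u0; lra.
Qed.

(** Strong induction on the index. Convergence at u = 1 bounds all coefficients by some C; once
    those below k vanish, the terms after the k-th add up to at most 2 C u u^k for u <= 1/2, and u
    may be taken arbitrarily small. *)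
Lemma power_series_eq0 (a : R^nat) :
  (forall u : R, 0 <= u <= 1 -> series (fun j => a j * u ^+ j) @ \oo --> (0 : R)) ->
  forall j, a j = 0.
Proof.
move=> a0.
have [C aC] : exists C : R, forall j, `|a j| <= C.
  have := a0 1; rewrite ler01 lexx => /(_ isT).
  under [X in series X]eq_fun do rewrite expr1n mulr1.
  move=> /cvgP /cvg_series_cvg_0 /cvgP /cvg_seq_bounded [C [_ /(_ (C + 1))]].
  rewrite ltrDl ltr01 => /(_ isT) h; exists (C + 1) => j; exact: h.
have C0 : 0 <= C by exact: le_trans (aC 0).
elim/ltn_ind => k IH; apply/eqP; rewrite -normr_eq0; apply/eqP/le_anti.
rewrite normr_ge0 andbT; apply/ler_addgt0Pl => e e0; rewrite addr0.
suff H u : 0 < u <= 2^-1 -> `|a k| <= 2 * C * u.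
  (* The 1 added to 2 C keeps [u] positive when C = 0. *)
  pose u := Num.min 2^-1 (e / (2 * C + 1)).
  have D0 : 0 < 2 * C + 1 by lra.
  have u0 : 0 < u by rewrite lt_min invr_gt0 ltr0n divr_gt0.
  apply: (le_trans (H u _)); first by rewrite u0 ge_min lexx.
  apply: (@le_trans _ _ ((2 * C + 1) * u)); first by rewrite ler_pM2r//; lra.
  by rewrite mulrC -ler_pdivlMr// ge_min lexx orbT.
move=> /andP[u0 u1].
have uk0 : 0 < u ^+ k by rewrite exprn_gt0.
rewrite -(ler_pM2r uk0).
suff : `|a k| * u ^+ k - 2 * C * u * u ^+ k <= `|0 : R|.
  by rewrite normr0 subr_le0.
have cv : (`|series (fun j => a j * u ^+ j) n|) @[n --> \oo] --> `|0 : R|.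
  by apply: cvg_norm; apply: a0; rewrite ltW//=; lra.
apply: (cvgr_to_ge cv); exists k.+1 => // n /= kn.
rewrite /series/= (big_cat_nat (n := k))//=; last exact: ltnW.
rewrite big_nat_cond big1 ?add0r; last by move=> i /andP[/andP[_ ik] _]; rewrite IH ?mul0r.
rewrite big_ltn//.
have H : `|\sum_(k.+1 <= i < n) a i * u ^+ i| <= 2 * C * u * u ^+ k.
  apply: (le_trans (ler_norm_sum _ _ _)).
  apply: (@le_trans _ _ (\sum_(k.+1 <= i < n) C * u ^+ i)).
    apply: ler_sum => i _; rewrite normrM normrX (gtr0_norm u0).
    by rewrite ler_wpM2r// exprn_ge0// ltW.
  rewrite -mulr_sumr -[k.+1]add0n big_addn.
  under eq_bigr do rewrite exprD.
  rewrite -mulr_suml exprS.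
  have -> : 2 * C * u * u ^+ k = C * (2 * (u * u ^+ k)) by ring.
  apply: ler_wpM2l => //; apply: ler_wpM2r; first by rewrite mulr_ge0 ?exprn_ge0 ?ltW.
  by apply: geometric_sum_le; rewrite (ltW u0).
have := lerB_dist (a k * u ^+ k) (- \sum_(k.+1 <= i < n) a i * u ^+ i).
rewrite opprK normrN normrM normrX (gtr0_norm u0); lra.
Qed.

Lemma power_series_eq (a b : R^nat) (f : R -> R) :
  (forall u : R, 0 <= u <= 1 -> series (fun j => a j * u ^+ j) @ \oo --> f u) ->
  (forall u : R, 0 <= u <= 1 -> series (fun j => b j * u ^+ j) @ \oo --> f u) ->
  forall j, a j = b j.
Proof.
move=> af bf j; apply/eqP; rewrite -subr_eq0; apply/eqP.
apply: (@power_series_eq0 (fun j => a j - b j)) => u u01.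
rewrite -(subrr (f u)).
have -> : series (fun j => (a j - b j) * u ^+ j) =
    (fun n => series (fun j => a j * u ^+ j) n - series (fun j => b j * u ^+ j) n).
  by apply/funext => n; rewrite /series/= -sumrB; apply: eq_bigr => i _; rewrite mulrBl.
by apply: cvgB; [exact: af|exact: bf].
Qed.

Lemma nneseries_cvg_fin (g : (\bar R)^nat) (l : R) :
  (forall j, 0 <= g j)%E -> (\sum_(0 <= j <oo) g j = l%:E)%E ->
  (forall j, g j \is a fin_num) /\ series (fun j => fine (g j)) @ \oo --> l.
Proof.
move=> g0 gl.
have gfin j : g j \is a fin_num.
  rewrite ge0_fin_numE//; apply: (@le_lt_trans _ _ l%:E); last exact: ltry.
  rewrite -gl; apply: (le_trans _ (nneseries_lim_ge j.+1 _)) => //.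
  by rewrite big_nat_recr//= leeDr// sume_ge0.
split=> //.
have cv : (fun n => \sum_(0 <= j < n) g j)%E @ \oo --> l%:E.
  by rewrite -gl; apply: is_cvg_nneseries => n _ _.
have -> : series (fun j => fine (g j)) = fine \o (fun n => \sum_(0 <= j < n) g j)%E.
  by apply/funext => n; rewrite /series/= sum_fine.
exact: (fine_cvg cv).
Qed.

Lemma cvg_nneseries_fin (g : R^nat) (l : R) :
  (forall j, 0 <= g j) -> series g @ \oo --> l ->
  (\sum_(0 <= j <oo) (g j)%:E = l%:E)%E.
Proof.
move=> g0 gl; apply/cvg_lim => //.
have -> : (fun n => \sum_(0 <= j < n) (g j)%:E)%E = EFin \o series g.
  by apply/funext => n; rewrite /series/= sumEFin.
by apply/fine_cvgP; split; [exact: nearW|exact: gl].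
Qed.

End power_series.

(** * Moments of the linear form on the sphere *)
Section sphere_moments.
Context {R : realType}.
Local Notation pball n s := (@punctured_ball R n s).

Lemma GammaEE (s : R) : Gamma s = fine (GammaE s).
Proof. by []. Qed.

Lemma dotC n (x y : 'rV[R]_n) : dot x y = dot y x.
Proof. by rewrite !dotE; apply: eq_bigr => i _; rewrite mulrC. Qed.

Lemma sphere_dot d (mu : 'rV[R]_d.+1) : sphere d mu -> dot mu mu = 1.
Proof.
by rewrite /sphere/= /enorm => h; rewrite -[LHS]sqr_sqrtr ?dot_ge0// h expr1n.
Qed.

(** Cauchy-Schwarz for unit vectors, from <x + e mu, x + e mu> >= 0 with e = 1 and e = -1. *)
Lemma dot_sphere_le1 d (mu x : 'rV[R]_d.+1) : sphere d mu -> sphere d x ->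
  `|dot x mu| <= 1.
Proof.
move=> /sphere_dot m1 /sphere_dot x1.
have H (e : R) : e ^+ 2 = 1 -> 0 <= 2 + 2 * e * dot x mu.
  move=> e1; have := dot_ge0 (x + e *: mu).
  have -> : dot (x + e *: mu) (x + e *: mu) = dot x x + 2 * e * dot x mu + e ^+ 2 * dot mu mu.
    rewrite !dotE !mulr_sumr -!big_split/=; apply: eq_bigr => i _.
    by rewrite !mxE; ring.
  rewrite x1 m1 e1; lra.
have := H 1 (expr1n _ _); have := H (-1) (etrans (sqrrN _) (expr1n _ _)); rewrite ler_norml; lra.
Qed.

Lemma normalizeE n (x : 'rV[R]_n) (mu : 'rV[R]_n) : dot (normalize x) mu = (enorm x)^-1 * dot x mu.
Proof. exact: dotZl. Qed.

(** * Gaussian moments and even moments on the sphere *)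

Section fixed_pole.
Variables (d : nat) (mu : 'rV[R]_d.+1).
Hypothesis mu1 : sphere d mu.
Let N := d.+1.
Local Notation sig := (@sphere_measure R d).

Definition moment k : R := \int[sig]_(x in sphere d) (dot x mu ^+ k).

(** Even powers only: their nonnegativity makes Tonelli available. *)
Let F j (x : 'rV[R]_N) := dot x mu ^+ j.*2.

Let F0 j x : 0 <= F j x.
Proof. by rewrite /F -mul2n exprM exprn_ge0 ?sqr_ge0. Qed.

Let mF j : measurable_fun setT (F j).
Proof. by apply: measurable_funX; exact: measurable_dot. Qed.

Let FZ j r x : 0 < r -> F j (r *: x) = r ^+ j.*2 * F j x.
Proof. by move=> _; rewrite /F dotZl exprMn. Qed.

Definition emoment j : \bar R := (\int[sig]_(x in sphere d) (F j x)%:E)%E.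

Definition gauss_moment j : \bar R :=
  (\int[lebesgue_rV N]_x (F j x * expR (- (dot x x / 2)))%:E)%E.

Lemma emoment_cone j :
  (emoment j = N%:R%:E * \int[lebesgue_rV N]_(x in pball N 1) (F j (normalize x))%:E)%E.
Proof.
rewrite /emoment ge0_integral_sphere//; first exact/measurable_EFinP.
by move=> x; rewrite lee_fin.
Qed.

Lemma emoment_fin j : emoment j \is a fin_num.
Proof.
have mU := @measurable_punctured_ball R N 1.
rewrite emoment_cone fin_numM// ge0_fin_numE; last first.
  by apply: integral_ge0 => x _; rewrite lee_fin.
apply: (@le_lt_trans _ _ (\int[lebesgue_rV N]_(x in pball N 1) 1)%E); last first.
  by rewrite integral_cst// mul1e; exact: lebesgue_pball_fin.
apply: ge0_le_integral => //.
- by move=> x _; rewrite lee_fin.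
- apply/measurable_EFinP; apply: measurable_funTS.
  exact: (measurableT_comp (mF j) (@measurable_normalize R N)).
- move=> x /andP[x0 _]; rewrite lee_fin /F -[leLHS]ger0_norm ?F0// normrX.
  rewrite exprn_ile1//; apply: dot_sphere_le1 => //.
  exact: enorm_normalize.
Qed.

(** With degree m = 2j, the comparison of the two ball integrals amounts to B = W N/(N+m), and N W
    is the moment on the sphere; hence the factor 1/(N+m). *)
Lemma gauss_moment_emoment j : (gauss_moment j =
  (2 `^ ((N + j.*2)%:R / 2))%:E * GammaE ((N + j.*2)%:R / 2 + 1) *
   ((N + j.*2)%:R^-1 * fine (emoment j))%:E)%E.
Proof.
rewrite /gauss_moment (@gauss_homogeneous _ _ j.*2)//; last by move=> r x; exact: FZ.
congr (_ * _)%E.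
have := emoment_cone j; have := emoment_fin j.
set W := (\int[_]_(_ in _) _)%E => eF eW.
have Wf : W \is a fin_num.
  move: eF; rewrite eW fin_numElt => /andP[_].
  have W0 : (0 <= W)%E by apply: integral_ge0 => x _; rewrite lee_fin.
  move=> WN; rewrite ge0_fin_numE// ltey; apply/eqP => We.
  by move: WN; rewrite We gt0_muley ?lte_fin ?ltr0n.
have WB : (W = \int[lebesgue_rV N]_(x in pball N 1) (F j x)%:E + (j.*2%:R / (j.*2 + N)%:R)%:E * W)%E.
  (* Degree 0 is treated apart: there F = 1 and both ball integrals coincide. *)
  have [j0|j0] := posnP j.
    rewrite j0 mul0r mul0e adde0 /W; apply: eq_integral => x _.
    by rewrite /F j0 !expr0.
  rewrite {1}/W (@ball_homogeneous _ _ j.*2)//; first by move=> r x; exact: FZ.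
  by rewrite double_gt0.
move: WB; rewrite eW -(fineK Wf); set B := (\int[_]_(_ in _) _)%E; move=> WB.
have Bf : B \is a fin_num.
  rewrite fin_numElt; apply/andP; split.
    rewrite (@lt_le_trans _ _ 0%E)//; apply: integral_ge0 => x _; rewrite lee_fin//.
  rewrite ltey; apply/eqP => Be; move: WB; rewrite Be addye// -EFinM.
move: WB; rewrite -(fineK Bf) -!EFinM -EFinD => -[]; set b := fine B; set w := fine W => wb.
congr (_%:E); rewrite /=.
have Nj : (N + j.*2)%:R != 0 :> R by rewrite pnatr_eq0.
have Nj' : N%:R + j.*2%:R != 0 :> R by rewrite -natrD.
apply: (mulfI Nj); rewrite mulrA divff// mul1r.
move: wb; rewrite !natrD => wb.
have : w * (N%:R + j.*2%:R) = b * (N%:R + j.*2%:R) + j.*2%:R * w.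
  by rewrite {1}wb mulrDl addrC [j.*2%:R + N%:R]addrC; field.
lra.
Qed.

(** The average of e^(st) and e^(-st) contains only even powers of t, so its expansion has
    nonnegative terms and may be integrated term by term. *)
Lemma cvg_gauss_moment (s : R) : (\sum_(0 <= j <oo) ((s ^+ j.*2 / (j.*2)`!%:R)%:E * gauss_moment j) =
  (Num.sqrt (2 * pi) ^+ N * expR (s ^+ 2 / 2))%:E)%E.
Proof.
have s0 i : 0 <= s ^+ i.*2 / (i.*2)`!%:R.
  by rewrite divr_ge0// -mul2n exprM exprn_ge0 ?sqr_ge0.
pose E a (x : 'rV[R]_N) := (expR (- dot x x / 2 + dot x (a *: mu))).
have dZr a x : dot x (a *: mu) = a * dot x mu by rewrite dotC dotZl dotC.
have mE a : measurable_fun setT (fun x => (E a x)%:E).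
  apply/measurable_EFinP; apply: measurableT_comp => //.
  apply: measurable_funD; last exact: measurable_dot.
  apply: measurable_funM => //; apply: measurableT_comp => //.
  exact: measurable_dotxx.
have IE a : (\int[lebesgue_rV N]_x (E a x)%:E = (Num.sqrt (2 * pi) ^+ N * expR (a ^+ 2 / 2))%:E)%E.
  by rewrite integral_gauss_rV dZr dotZl sphere_dot// mulr1.
have : (\int[lebesgue_rV N]_x ((2^-1)%:E * ((E s x)%:E + (E (- s) x)%:E)) = (Num.sqrt (2 * pi) ^+ N * expR (s ^+ 2 / 2))%:E)%E.
  rewrite ge0_integralZl//; last first.
  - by move=> x _; rewrite adde_ge0// lee_fin expR_ge0.
  - exact: emeasurable_funD.
  rewrite ge0_integralD//; last first.
  - by move=> x _; rewrite lee_fin expR_ge0.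
  - by move=> x _; rewrite lee_fin expR_ge0.
  rewrite !IE sqrrN -EFinD -EFinM; congr (_%:E).
  set c := _ * _ : R; lra.
move=> <-.
under eq_eseriesr => j _.
  rewrite -ge0_integralZl//; last first.
  - by rewrite lee_fin divr_ge0// -mul2n exprM exprn_ge0 ?sqr_ge0.
  - by move=> x _; rewrite lee_fin mulr_ge0 ?expR_ge0.
  - apply/measurable_EFinP; apply: measurable_funM => //; exact: measurable_gaussrV.
  over.
rewrite /= -integral_nneseries//; last first.
- by move=> j x _; rewrite -EFinM lee_fin !(s0, mulr_ge0, F0, expR_ge0).
- move=> j; apply: emeasurable_funM => //; apply/measurable_EFinP.
  by apply: measurable_funM => //; exact: measurable_gaussrV.
apply: eq_integral => x _.
under eq_eseriesr do rewrite -EFinM.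
rewrite -EFinD -EFinM; apply: cvg_nneseries_fin.
  by move=> j; rewrite !(s0, mulr_ge0, F0, expR_ge0).
rewrite /E !dZr mulNr !expRD -mulrDr mulrCA mulNr.
have -> : series (fun j => s ^+ j.*2 / (j.*2)`!%:R * (F j x * expR (- (dot x x / 2)))) =
   (fun n => expR (- (dot x x / 2)) * series (fun j => (s * dot x mu) ^+ j.*2 / (j.*2)`!%:R) n).
  apply/funext => n; rewrite /series/= mulr_sumr; apply: eq_bigr => j _.
  by rewrite exprMn /F; ring.
apply: cvgMr; rewrite [2^-1 * _]mulrC; exact: cvg_cosh_series.
Qed.

(** In the variable u = s^2 the generating function is a multiple of e^(u/2); coefficients are
    compared by uniqueness of power series on [0, 1]. *)
Lemma gauss_momentE j : gauss_moment j =
  (Num.sqrt (2 * pi) ^+ N * (j.*2)`!%:R / (2 ^+ j * j`!%:R))%:E.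
Proof.
have G0 i : (0 <= gauss_moment i)%E.
  by apply: integral_ge0 => x _; rewrite lee_fin mulr_ge0 ?expR_ge0.
have f0 i : (i`!%:R : R) != 0 by rewrite pnatr_eq0 -lt0n fact_gt0.
have c0 s i : (0 <= (s ^+ i.*2 / (i.*2)`!%:R : R)%:E * gauss_moment i)%E.
  by rewrite mule_ge0// lee_fin divr_ge0// -mul2n exprM exprn_ge0 ?sqr_ge0.
have Gf i : gauss_moment i \is a fin_num.
  have [/(_ i)] := nneseries_cvg_fin (c0 1) (cvg_gauss_moment 1).
  rewrite expr1n mul1r; move: (G0 i); case: (gauss_moment i) => //= _.
  by rewrite gt0_muley// lte_fin invr_gt0 ltr0n fact_gt0.
pose C : R := Num.sqrt (2 * pi) ^+ N.
have H := @power_series_eq R (fun i => fine (gauss_moment i) / (i.*2)`!%:R)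
  (fun i => C / (2 ^+ i * i`!%:R)) (fun u => C * expR (u / 2)).
rewrite -[LHS]fineK//; congr (_%:E).
rewrite -/C; have : fine (gauss_moment j) / (j.*2)`!%:R = C / (2 ^+ j * j`!%:R).
apply: H.
- move=> u /andP[u0 _].
  have [_] := nneseries_cvg_fin (c0 (Num.sqrt u)) (cvg_gauss_moment (Num.sqrt u)).
  rewrite sqr_sqrtr//.
  have -> // : (fun i => fine ((Num.sqrt u ^+ i.*2 / (i.*2)`!%:R)%:E * gauss_moment i)) =
    (fun i => fine (gauss_moment i) / (i.*2)`!%:R * u ^+ i).
  apply/funext => i; rewrite -{1}(fineK (Gf i)) -EFinM /= -{1}mul2n exprM sqr_sqrtr//; ring.
- move=> u _.
  have -> : series (fun i => C / (2 ^+ i * i`!%:R) * u ^+ i) = (fun n => C * series (exp_coeff (u / 2)) n).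
    apply/funext => n; rewrite /series/= mulr_sumr; apply: eq_bigr => i _.
    by rewrite /exp_coeff /= exprMn exprVn invfM; ring.
  by apply: cvgMr; exact: cvg_exp_series.
by move=> /(canRL (mulfVK (f0 _))) ->; rewrite mulrAC.
Qed.

(** The Gaussian moment of order 0 is positive and finite, and it is a positive number times this
    Gamma value times a nonnegative number; so the Gamma value is neither 0 nor infinite. *)
Lemma GammaE_half_succ : GammaE (N%:R / 2 + 1 : R) \is a fin_num /\ 0 < fine (GammaE (N%:R / 2 + 1 : R)).
Proof.
have := gauss_moment_emoment 0; rewrite gauss_momentE addn0.
set G := GammaE _.
have G0 : (0 <= G)%E by apply: integral_ge0 => x _; rewrite lee_fin mulr_ge0 ?powR_ge0 ?expR_ge0.
set a := 2 `^ _; set b := _ * fine _; set c := (_ / _).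
have c0 : 0 < c.
  by rewrite divr_gt0// ?mulr_gt0// ?exprn_gt0// ?sqrtr_gt0 ?mulr_gt0 ?pi_gt0// ltr0n fact_gt0.
have a0 : 0 < a by rewrite powR_gt0.
have b0 : 0 <= b.
  by rewrite mulr_ge0// fine_ge0// integral_ge0// => x _; rewrite lee_fin.
move: G0; case: G => [r| |]//.
- rewrite lee_fin /= => r0 [] e; split=> //.
  rewrite lt_neqAle r0 andbT; apply/eqP => re.
  by move: c0; rewrite e -re mulr0 mul0r ltxx.
- move=> _; rewrite gt0_muley ?lte_fin//.
  move: b0; rewrite le_eqVlt => /predU1P[<-|b0].
    by rewrite mule0 => -[] e; move: c0; rewrite e ltxx.
  by rewrite gt0_mulye ?lte_fin.
Qed.

End fixed_pole.

Lemma sphere_delta d : sphere d (delta_mx ord0 ord0 : 'rV[R]_d.+1).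
Proof.
rewrite /sphere/= /enorm dotE (bigD1 ord0)//= big1 ?addr0.
  by rewrite mxE !eqxx mulr1 sqrtr1.
by move=> i i0; rewrite mxE eqxx (negbTE i0) mulr0.
Qed.

(** Descent from n/2 + 1 to n/2 by the functional equation, available because n/2 >= 1. *)
Lemma GammaE_half n : (1 < n)%N -> GammaE (n%:R / 2 : R) \is a fin_num /\ 0 < fine (GammaE (n%:R / 2 : R)).
Proof.
case: n => // n n1; have [] := GammaE_half_succ (@sphere_delta n).
have n2 : (1 : R) <= n.+1%:R / 2 by rewrite ler_pdivlMr// mul1r ler_nat.
have n0 : (0 : R) < n.+1%:R / 2 by exact: lt_le_trans n2.
rewrite GammaE_rec//.
have G0 : (0 <= GammaE (n.+1%:R / 2 : R))%E.
  by apply: integral_ge0 => x _; rewrite lee_fin mulr_ge0 ?powR_ge0 ?expR_ge0.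
move: G0; case: (GammaE _) => [r| |]//=; last by rewrite gt0_muley ?lte_fin.
by rewrite lee_fin => r0 _; rewrite pmulr_rgt0.
Qed.

Lemma Gamma_half_gt0 n : (1 < n)%N -> 0 < Gamma (n%:R / 2 : R).
Proof. by move=> /GammaE_half[]. Qed.

Lemma Gamma_half_rec n : (1 < n)%N -> Gamma (n%:R / 2 + 1 : R) = n%:R / 2 * Gamma (n%:R / 2 : R).
Proof.
move=> n1; rewrite !GammaEE GammaE_rec; last first.
  by rewrite ler_pdivlMr// mul1r ler_nat.
by rewrite fineM//; have [] := GammaE_half n1.
Qed.

(** * All moments for d >= 1, their recurrence, and exponential moments *)

Section moments.
Variables (d : nat) (mu : 'rV[R]_d.+1).
Hypothesis mu1 : sphere d mu.
Hypothesis d0 : (0 < d)%N.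
Let N := d.+1.
Local Notation sig := (@sphere_measure R d).
Local Notation m := (moment mu).

(** The factor 1/(N+2j) left by the cone cancels in Gamma((N+2j)/2 + 1) = (N+2j)/2 Gamma((N+2j)/2),
    which produces the leading 2. *)
Lemma moment_even j : m j.*2 =
  2 * (Num.sqrt (2 * pi) ^+ N * (j.*2)`!%:R / (2 ^+ j * j`!%:R)) /
    (2 `^ ((N + j.*2)%:R / 2) * Gamma ((N + j.*2)%:R / 2)).
Proof.
have N2 : (1 < N + j.*2)%N by rewrite addSn ltnS addn_gt0 d0.
have [Gf G0] := GammaE_half N2.
have := gauss_moment_emoment mu1 j; rewrite gauss_momentE//.
rewrite GammaE_rec; last by rewrite ler_pdivlMr// mul1r ler_nat.
rewrite -/N -(fineK Gf) -!EFinM => -[]; rewrite -GammaEE -/(moment mu j.*2).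
have -> : fine (emoment mu j) = m j.*2 by [].
rewrite -GammaEE in G0.
have a0 : (2 : R) `^ ((N + j.*2)%:R / 2) != 0 by rewrite gt_eqF// powR_gt0.
have N0 : ((N + j.*2)%:R : R) != 0 by rewrite pnatr_eq0.
have aux (a g mj n K : R) : a != 0 -> g != 0 -> n != 0 ->
    K = a * (n / 2 * g) * (n^-1 * mj) -> mj = 2 * K / (a * g).
  by move=> a1 g1 n1 ->; field; rewrite a1 g1 n1.
by apply: aux; rewrite // gt_eqF.
Qed.

Lemma ge0_integral_sphere_opp (f : 'rV[R]_N -> \bar R) :
  measurable_fun setT f -> (forall x, 0 <= f x)%E ->
  (\int[sig]_(x in sphere d) f x = \int[sig]_(x in sphere d) f (- x)%R)%E.
Proof.
move=> mf f0.
have mfN : measurable_fun setT (fun x : 'rV[R]_N => f (- x)).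
  rewrite (_ : (fun x => _) = f \o (fun x => -1 *: x)).
    exact: (measurableT_comp mf (measurable_scale_rV _)).
  by apply/funext => x /=; rewrite scaleN1r.
have eN (x : 'rV[R]_N) : enorm (- x) = enorm x.
  by rewrite -scaleN1r enormZ normrN1 mul1r.
rewrite !ge0_integral_sphere//; congr (_ * _)%E.
rewrite integral_mkcond (@ge0_integral_rV_scale _ _ (-1))//; last first.
- by move=> x; apply: erestrict_ge0.
- apply/(measurable_restrictT _ _).1; first exact: measurable_punctured_ball.
  apply: measurable_funTS; apply: (measurableT_comp mf); exact: measurable_normalize.
rewrite normrN1 expr1n mul1e [in RHS]integral_mkcond; apply: eq_integral => x _.
rewrite scaleN1r !patchE /normalize eN scalerN.
by congr (if _ then _ else _); apply/idP/idP; rewrite !inE /punctured_ball/= eN.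
Qed.

Lemma sphere_fin : (sig (sphere d) < +oo)%E.
Proof.
rewrite -[X in (X < _)%E]mul1e -integral_cst; last exact: measurable_sphere.
have := emoment_fin mu1 0; rewrite ge0_fin_numE; last by apply: integral_ge0 => x _; rewrite lee_fin.
by congr (_ < _)%E; apply: eq_integral => x _; rewrite /= expr0.
Qed.

Lemma sphere_integrable (f : 'rV[R]_N -> R) M : measurable_fun setT f ->
  (forall x, sphere d x -> `|f x| <= M) -> sig.-integrable (sphere d) (EFin \o f).
Proof.
move=> mf fM; apply: measurable_bounded_integrable.
- exact: measurable_sphere.
- exact: sphere_fin.
- exact: measurable_funTS.
- by exists M; split; [exact: num_real|move=> y /ltW My x xs; exact: le_trans (fM _ xs) My].
Qed.

Lemma dot_exp_le1 p x : sphere d x -> `|dot x mu ^+ p| <= 1.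
Proof. by move=> xs; rewrite normrX exprn_ile1// dot_sphere_le1. Qed.

Lemma integrable_dot_exp p : sig.-integrable (sphere d) (EFin \o (fun x => dot x mu ^+ p)).
Proof.
apply: (@sphere_integrable _ 1); last by move=> x; exact: dot_exp_le1.
by apply: measurable_funX; exact: measurable_dot.
Qed.

(** The antipodal map exchanges the positive and negative parts of the integrand, whose integrals
    are finite. *)
Lemma moment_odd j : m j.*2.+1 = 0.
Proof.
rewrite /moment /Rintegral integralE.
have mg : measurable_fun setT (fun x : 'rV[R]_N => (dot x mu ^+ j.*2.+1)%:E).
  by apply/measurable_EFinP; apply: measurable_funX; exact: measurable_dot.
have -> : (\int[sig]_(x in sphere d) ((fun x : 'rV[R]_N => (dot x mu ^+ j.*2.+1)%:E)^\- x) =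
  \int[sig]_(x in sphere d) ((fun x : 'rV[R]_N => (dot x mu ^+ j.*2.+1)%:E)^\+ x))%E.
  rewrite [RHS]ge0_integral_sphere_opp//; last exact: measurable_funepos.
  apply: eq_integral => x _; rewrite funenegE funeposE.
  congr (Order.max _ _); rewrite -EFinN; congr (_%:E).
  have -> : dot (- x) mu = - dot x mu by rewrite -[- x]scaleN1r dotZl mulN1r.
  by rewrite exprNn -signr_odd /= odd_double /= expr1 mulN1r.
have H := integrable_pos_fin_num (@measurable_sphere R d) (integrable_dot_exp j.*2.+1).
by rewrite subee.
Qed.

(** Integration by parts for powers of t, read off the closed form of the even moments; for even q
    both sides vanish. *)
Lemma moment_rec q : q%:R * m q.-1 = (q + d)%:R * m q.+1.
Proof.
have := odd_double_half q; case: (odd q) => /= <-; last first.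
  (* At q = 0 the index [q.-1] is 0 again, hence even; there the coefficient q is what annihilates
     the left side. *)
  rewrite add0n moment_odd mulr0; case: (q./2) => [|k]; first by rewrite mul0r.
  by rewrite doubleS /= moment_odd mulr0.
rewrite add1n /= -doubleS; set j := q./2.
have Nj : (1 < N + j.*2)%N by rewrite addSn ltnS addn_gt0 d0.
rewrite !moment_even.
have -> : (N + j.+1.*2)%:R / 2 = (N + j.*2)%:R / 2 + 1 :> R.
  by rewrite doubleS !addnS -addn2 natrD mulrDl divff.
rewrite Gamma_half_rec// powRD; last by apply/implyP => _.
rewrite powRr1// doubleS !factS exprS !natrM.
have a0 : (2 : R) `^ ((N + j.*2)%:R / 2) != 0 by rewrite gt_eqF// powR_gt0.
have g0 := Gamma_half_gt0 Nj.
have f0 i : (i`!%:R : R) != 0 by rewrite pnatr_eq0 -lt0n fact_gt0.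
have e0 : (2 : R) ^+ j != 0 by rewrite expf_neq0.
have -> : (j.*2.+1 + d)%:R = (N + j.*2)%:R :> R by rewrite /N addnC addSn addnS.
have -> : j.*2.+2%:R = 2 * j.+1%:R :> R by rewrite -natrM mul2n doubleS.
have N0 : (N + j.*2)%:R != 0 :> R by rewrite pnatr_eq0.
have j0 : j.+1%:R != 0 :> R by rewrite pnatr_eq0.
move: (Gamma _) g0 => g /lt0r_neq0 g0.
move: (_ `^ _) a0 => a a0; move: (2 ^+ j) e0 => e e0.
move: (j`!%:R) (f0 j) => f fn0; move: ((N + j.*2)%:R) N0 => n n0.
move: (j.+1%:R) j0 => j1 j10.
field.
by rewrite ?a0 ?g0 ?e0 ?fn0 ?n0 ?j10.
Qed.

Definition tmoment p (a : R) : R := \int[sig]_(x in sphere d) (dot x mu ^+ p * expR (a * dot x mu)).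

(** Dominated convergence: |t| <= 1 on the sphere, so the partial sums are bounded by the constant
    e^|a|, integrable because the area is finite. *)
Lemma cvg_tmoment p a :
  series (fun k => a ^+ k / k`!%:R * m (p + k)) @ \oo --> tmoment p a.
Proof.
pose f n (x : 'rV[R]_N) := dot x mu ^+ p * series (exp_coeff (a * dot x mu)) n.
have mD := @measurable_dot R N mu.
have mE n : measurable_fun setT (fun x : 'rV[R]_N => series (exp_coeff (a * dot x mu)) n).
  apply: measurable_sum => i; apply: measurable_funM => //.
  by apply: measurable_funX; exact: measurable_funM.
have mf n : measurable_fun setT (f n) by apply: measurable_funM => //; exact: measurable_funX.
have ms := @measurable_sphere R d.
have bnd n x : sphere d x -> `|f n x| <= expR `|a|.
  move=> xs; rewrite normrM -[leRHS]mul1r ler_pM// ?dot_exp_le1//.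
  apply: (@le_trans _ _ (series (exp_coeff `|a|) n)).
    apply: (le_trans (ler_norm_sum _ _ _)); apply: ler_sum => i _.
    rewrite /exp_coeff normrM normrX [`|_^-1|]ger0_norm ?invr_ge0//.
    rewrite ler_wpM2r ?invr_ge0// lerXn2r ?nnegrE//.
    by rewrite normrM ler_piMr// dot_sphere_le1.
  apply: nondecreasing_cvgn_le; last exact: is_cvg_series_exp_coeff.
  by apply: nondecreasing_series => i _ _; exact: exp_coeff_ge0.
have mft : measurable_fun setT (fun x : 'rV[R]_N => dot x mu ^+ p * expR (a * dot x mu)).
  apply: measurable_funM; first exact: measurable_funX.
  by apply: measurableT_comp => //; exact: measurable_funM.
have mf_ n : measurable_fun (sphere d) (fun x => (f n x)%:E).
  by apply/measurable_EFinP; exact: measurable_funTS.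
have mfl : measurable_fun (sphere d) (fun x => (dot x mu ^+ p * expR (a * dot x mu))%:E).
  by apply/measurable_EFinP; exact: measurable_funTS.
have f_f : {ae sig, forall x, sphere d x -> (fun n => (f n x)%:E) @ \oo --> (dot x mu ^+ p * expR (a * dot x mu))%:E}.
  apply: aeW => x xs; apply/fine_cvgP; split; first exact: nearW.
  by apply: cvgMr; exact: cvg_exp_series.
have ig : sig.-integrable (sphere d) (fun=> (expR `|a|)%:E).
  by apply: (@sphere_integrable (fun=> expR `|a|) (expR `|a|)) => // x _; rewrite ger0_norm ?expR_ge0.
have f_g : {ae sig, forall x n, sphere d x -> (`|(f n x)%:E| <= (expR `|a|)%:E)%E}.
  by apply: aeW => x n xs; rewrite lee_fin bnd.
have [il _ H] := dominated_convergence ms mf_ mfl f_f ig f_g.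
have If := integrable_fin_num ms il.
have := H; rewrite -(fineK If) => /fine_cvg.
have -> // : fine \o (fun n => \int[sig]_(x in sphere d) (f n x)%:E)%E =
   series (fun k => a ^+ k / k`!%:R * m (p + k)).
apply/funext => n /=.
rewrite (_ : (fun x => (f n x)%:E) = (fun x => \sum_(0 <= k < n) (a ^+ k / k`!%:R)%:E * (dot x mu ^+ (p + k))%:E)%E); last first.
  apply/funext => x; under eq_bigr do rewrite -EFinM.
  rewrite sumEFin /f /series/= mulr_sumr; congr (_%:E); apply: eq_bigr => k _.
  by rewrite /exp_coeff /= exprMn exprD; ring.
rewrite integral_sum//; last first.
- by move=> k; apply: integrableZl => //; exact: integrable_dot_exp.
rewrite (eq_bigr (fun k => (a ^+ k / k`!%:R * m (p + k))%:E)) ?sumEFin// => k _.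
rewrite integralZl//; last exact: integrable_dot_exp.
rewrite [RHS]EFinM /moment /Rintegral fineK//.
by apply: integrable_fin_num => //; exact: integrable_dot_exp.
Qed.

(* Integration by parts on the sphere for t^p (1 - t^2) e^{at}, proved on the
   power series through [moment_rec]. *)
Lemma tmoment_rec p a : p%:R * tmoment p.-1 a + a * (tmoment p a - tmoment p.+2 a) =
  (p + d)%:R * tmoment p.+1 a.
Proof.
have cv0 := @cvg_tmoment p a; have cv2 := @cvg_tmoment p.+2 a.
have cvm := @cvg_tmoment p.-1 a; have cv1 := @cvg_tmoment p.+1 a.
pose u k := p%:R * (a ^+ k / k`!%:R * m (p.-1 + k)) - (p + d)%:R * (a ^+ k / k`!%:R * m (p.+1 + k)).
pose v k := a * (a ^+ k / k`!%:R * m (p + k)) - a * (a ^+ k / k`!%:R * m (p.+2 + k)).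
have cu : series u @ \oo --> p%:R * tmoment p.-1 a - (p + d)%:R * tmoment p.+1 a.
  have -> : series u = (fun n => p%:R * series (fun k => a ^+ k / k`!%:R * m (p.-1 + k)) n -
     (p + d)%:R * series (fun k => a ^+ k / k`!%:R * m (p.+1 + k)) n).
    by apply/funext => n; rewrite /series/= !mulr_sumr -sumrB.
  by apply: cvgB; apply: cvgMr.
have cw : series v @ \oo --> a * tmoment p a - a * tmoment p.+2 a.
  have -> : series v = (fun n => a * series (fun k => a ^+ k / k`!%:R * m (p + k)) n -
     a * series (fun k => a ^+ k / k`!%:R * m (p.+2 + k)) n).
    by apply/funext => n; rewrite /series/= !mulr_sumr -sumrB.
  by apply: cvgB; apply: cvgMr.
have f0 i : (i`!%:R : R) != 0 by rewrite pnatr_eq0 -lt0n fact_gt0.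
(* The factor [a] raises the degree by one, so the k-th term of [v] cancels the (k+1)-st term of
   [u], while [u 0] vanishes on its own. *)
have uv n : series u n.+1 + series v n = 0.
  elim: n => [|n IH].
    rewrite /series/= big_nat1 big_geq// addr0 /u !addn0 fact0 expr0 divr1 !mul1r.
    by rewrite moment_rec subrr.
  rewrite /series/= big_nat_recr//= [X in _ + X]big_nat_recr//= addrACA.
  rewrite -[X in X + _]/(series u n.+1 + series v n) IH add0r.
  rewrite /u /v.
  have := moment_rec (p + n.+1); rewrite addnS /=.
  (* The two indices agree unless p = 0, and then the coefficient is 0. *)
  have : p%:R * m (p.-1 + n.+1) = p%:R * m (p + n).
    by case: (p) => [|p']; [rewrite !mul0r|rewrite addSn addnS].
  rewrite !(addnS, addSn) factS exprS !natrM -![_.+1%:R]natr1 !natrD.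
  move: (m _) (m _) (m _) (f0 n) => X Y Z fn E0 E1.
  have n0 : n%:R + 1 != 0 :> R by rewrite natr1 pnatr_eq0.
  have -> : a * a ^+ n / ((n%:R + 1) * n`!%:R) = a * (a ^+ n / n`!%:R) / (n%:R + 1).
    by field; rewrite fn n0.
  transitivity (a * (a ^+ n / n`!%:R) / (n%:R + 1) *
      (p%:R * Z - (p%:R + d%:R) * X + (n%:R + 1) * (Y - X))).
    by field; rewrite fn n0.
  have -> : p%:R * Z - (p%:R + d%:R) * X + (n%:R + 1) * (Y - X) =
     (p%:R + n%:R + 1) * Y - (p%:R + n%:R + d%:R + 1) * X by rewrite E0; ring.
  by rewrite E1 subrr mulr0.
have cu1 : (fun n => series u n.+1) @ \oo --> p%:R * tmoment p.-1 a - (p + d)%:R * tmoment p.+1 a.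
  by rewrite (cvg_shiftS (series u)).
have := cvgD cu1 cw.
rewrite (_ : _ + _ = cst 0); last by apply/funext => n; rewrite fctE uv.
move=> h; have := cvg_unique (@norm_hausdorff _ _) (cvg_cst (0 : R)) (h _).
by move=> e; apply/eqP; rewrite -subr_eq0; apply/eqP; rewrite [RHS]e; ring.
Qed.

End moments.
End sphere_moments.

(** * Bessel functions as integrals over the sphere *)
Section half_integer_bessel.
Context {R : realType}.
Implicit Types (d k : nat) (a : R).

Definition bterm d a k : R :=
  (a / 2) `^ (2 * k%:R + (d%:R - 1) / 2) / (k`!%:R * Gamma ((d%:R - 1) / 2 + k%:R + 1)).

(* The Bessel functions of the theorem, [hbessel d] being of order (d-1)/2;
   the order goes up by 1 when d goes up by 2. *)
Definition hbessel d a : R := besselI ((d%:R - 1) / 2) a.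

Lemma hbesselE d a : hbessel d a = limn (series (bterm d a)).
Proof. by []. Qed.

Lemma natr_aux d k : (d + k.*2).+1%:R = d%:R + 2 * k%:R + 1 :> R.
Proof. by rewrite -addnn; ring. Qed.

Lemma half_arg d k : (d%:R - 1) / 2 + k%:R + 1 = (d + k.*2).+1%:R / 2 :> R.
Proof. by rewrite natr_aux; field. Qed.

Lemma Gamma_arg_gt0 d k : (0 < d)%N -> 0 < Gamma ((d%:R - 1) / 2 + k%:R + 1 : R).
Proof. by move=> d0; rewrite half_arg Gamma_half_gt0// ltnS addn_gt0 d0. Qed.

Lemma fact_neq0 k : (k`!%:R : R) != 0.
Proof. by rewrite pnatr_eq0 -lt0n fact_gt0. Qed.

Lemma btermE d a k : 0 < a ->
  bterm d a k = (a / 2) ^+ k.*2 * (a / 2) `^ ((d%:R - 1) / 2) /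
    (k`!%:R * Gamma ((d + k.*2).+1%:R / 2)).
Proof.
move=> a0; rewrite /bterm half_arg; congr (_ / _).
rewrite powRD; last by apply/implyP => _; rewrite gt_eqF// divr_gt0.
by rewrite -natrM mul2n powR_mulrn// divr_ge0// ltW.
Qed.

Lemma bterm_gt0 d a k : (0 < d)%N -> 0 < a -> 0 < bterm d a k.
Proof.
move=> d0 a0; by rewrite /bterm divr_gt0 ?powR_gt0 ?divr_gt0// mulr_gt0 ?Gamma_arg_gt0// ltr0n fact_gt0.
Qed.

Lemma bterm_order d a k : (0 < d)%N -> 0 < a ->
  bterm d.+2 a k = bterm d a k * (a / (d + k.*2).+1%:R).
Proof.
move=> d0 a0; rewrite !btermE//.
have -> : (d.+2%:R - 1) / 2 = (d%:R - 1) / 2 + 1 :> R by field.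
have -> : (d.+2 + k.*2).+1%:R / 2 = (d + k.*2).+1%:R / 2 + 1 :> R.
  by rewrite !natr_aux; field.
have n1 : (1 < (d + k.*2).+1)%N by rewrite ltnS addn_gt0 d0.
have g0 := Gamma_half_gt0 (R := R) n1.
rewrite Gamma_half_rec// powRD; last by apply/implyP => _; rewrite gt_eqF// divr_gt0.
rewrite powRr1 ?divr_ge0 ?(ltW a0)//.
have n0 : (d + k.*2).+1%:R != 0 :> R by rewrite pnatr_eq0.
move: (Gamma _) g0 => g /lt0r_neq0 g0; move: (_ `^ _) => x; move: (_ ^+ _) => y.
move: ((d + k.*2).+1%:R) n0 => n n0.
by field; rewrite g0 n0 fact_neq0.
Qed.

Lemma bterm_succ d a k : (0 < d)%N -> 0 < a ->
  bterm d a k.+1 = bterm d a k * (a ^+ 2 / (2 * k.+1%:R * (d + k.*2).+1%:R)).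
Proof.
move=> d0 a0; rewrite !btermE//.
have -> : (d + k.+1.*2).+1%:R / 2 = (d + k.*2).+1%:R / 2 + 1 :> R.
  by rewrite !natr_aux; field.
have n1 : (1 < (d + k.*2).+1)%N by rewrite ltnS addn_gt0 d0.
have g0 := Gamma_half_gt0 (R := R) n1.
rewrite Gamma_half_rec// doubleS !exprS factS natrM.
have n0 : (d + k.*2).+1%:R != 0 :> R by rewrite pnatr_eq0.
have k0 : k.+1%:R != 0 :> R by rewrite pnatr_eq0.
move: (Gamma _) g0 => g /lt0r_neq0 g0; move: (_ `^ _) => x; move: (_ ^+ _) => y.
move: ((d + k.*2).+1%:R) n0 => n n0; move: (k.+1%:R) k0 => q q0.
by field; rewrite g0 n0 fact_neq0 q0.
Qed.

(** For a > 0, [bfactor d a * hbessel d a] is the inverse of [vMF_const d a]; the formula for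
    [tmoment] of degree 0 below thus amounts to the density having total mass 1. *)
Definition bfactor d a : R := (2 * pi) `^ ((d%:R + 1) / 2) * a `^ (- ((d%:R - 1) / 2)).

Lemma bfactor_gt0 d a : 0 < a -> 0 < bfactor d a.
Proof. by move=> a0; rewrite mulr_gt0 ?powR_gt0// mulr_gt0// pi_gt0. Qed.

Section with_pole.
Opaque bterm hbessel moment tmoment.
Variables (d : nat) (mu : 'rV[R]_d.+1) (a : R).
Hypotheses (mu1 : sphere d mu) (d0 : (0 < d)%N) (a0 : 0 < a).

(** The factorial (2j)! of the exponential series cancels the one of the Gaussian moment, so no
    duplication formula for Gamma is involved. *)
Lemma moment_bterm j : a ^+ j.*2 / (j.*2)`!%:R * moment mu j.*2 = bfactor d a * bterm d a j.
Proof.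
rewrite (moment_even mu1 d0) (btermE _ _ a0) addSn.
have n1 : (1 < (d + j.*2).+1)%N by rewrite ltnS addn_gt0 d0.
have g0 := Gamma_half_gt0 (R := R) n1.
have -> : Num.sqrt (2 * pi) ^+ d.+1 = (2 * pi : R) `^ ((d%:R + 1) / 2).
  rewrite -powR12_sqrt ?mulr_ge0 ?pi_ge0// -powR_mulrn ?powR_ge0// -powRrM natr1.
  by congr (_ `^ _); rewrite mulrC.
have -> : (2 : R) `^ ((d + j.*2).+1%:R / 2) = 2 `^ ((d%:R - 1) / 2) * 2 * 2 ^+ j.
  have -> : (d + j.*2).+1%:R / 2 = (d%:R - 1) / 2 + 1 + j%:R :> R.
    by rewrite natr_aux; field.
  by rewrite !powRD ?powRr1 ?powR_mulrn//; apply/implyP => _; rewrite pnatr_eq0.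
have -> : (a / 2) `^ ((d%:R - 1) / 2) = a `^ ((d%:R - 1) / 2) / 2 `^ ((d%:R - 1) / 2).
  rewrite powRM ?(ltW a0)//; congr (_ * _).
  have x0 : (2 : R) `^ ((d%:R - 1) / 2) != 0 by rewrite gt_eqF// powR_gt0.
  by apply: (mulfI x0); rewrite mulfV// -powRM// mulfV// powR1.
rewrite /bfactor powRN.
have x0 : (2 : R) `^ ((d%:R - 1) / 2) != 0 by rewrite gt_eqF// powR_gt0.
have y0 : a `^ ((d%:R - 1) / 2) != 0 by rewrite gt_eqF// powR_gt0.
have e0 : (2 : R) ^+ j != 0 by rewrite expf_neq0.
have -> : (a / 2) ^+ j.*2 = a ^+ j.*2 / (2 ^+ j * 2 ^+ j) by rewrite expr_div_n -exprD addnn.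
move: (2 ^+ j) e0 => e e0.
move: (2 `^ _) x0 => x x0; move: (a `^ _) y0 => y y0; move: (_ `^ _) => C.
move: (Gamma _) g0 => g /lt0r_neq0 g0; move: (a ^+ _) => z.
by field; rewrite g0 x0 y0 e0 !fact_neq0.
Qed.

Lemma cvg_bterm_tmoment : series (bterm d a) @ \oo --> tmoment mu 0 a / bfactor d a.
Proof.
have P0 := lt0r_neq0 (bfactor_gt0 d a0).
have -> : series (bterm d a) = (fun n => series (fun j => a ^+ j.*2 / (j.*2)`!%:R * moment mu (0 + j.*2)) n * (bfactor d a)^-1).
  apply/funext => n; rewrite /series/= mulr_suml; apply: eq_bigr => j _.
  by rewrite add0n moment_bterm [bfactor d a * _]mulrC mulfK.
apply: cvgMl; apply: (@cvg_series_even R (fun k => a ^+ k / k`!%:R * moment mu (0 + k))).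
  by move=> j; rewrite add0n (moment_odd mu1) mulr0.
exact: (cvg_tmoment mu1).
Qed.

Lemma tmoment0E : tmoment mu 0 a = bfactor d a * hbessel d a.
Proof.
have P0 := lt0r_neq0 (bfactor_gt0 d a0).
rewrite hbesselE (cvg_lim (@norm_hausdorff _ _) cvg_bterm_tmoment).
by rewrite mulrC divfK.
Qed.

End with_pole.

(** Convergence of the Bessel series is inherited from the moment series of one particular pole. *)
Lemma cvg_bterm d a : (0 < d)%N -> 0 < a -> series (bterm d a) @ \oo --> hbessel d a.
Proof.
move=> d0 a0; have P0 := lt0r_neq0 (bfactor_gt0 d a0).
have := cvg_bterm_tmoment (@sphere_delta R d) d0 a0.
by rewrite (tmoment0E (@sphere_delta R d) d0 a0) mulrAC divff// mul1r.
Qed.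

(** Termwise form of d/dz (z^(-nu) I_nu) = z^(-nu) I_(nu+1) with nu = (d-1)/2: only odd powers of
    [a] survive, and [moment_rec] lowers their moments from 2j+2 to 2j. *)
Lemma tmoment1E d (mu : 'rV[R]_d.+1) a : sphere d mu -> (0 < d)%N -> 0 < a ->
  tmoment mu 1 a = bfactor d a * hbessel d.+2 a.
Proof.
move=> mu1 d0 a0; have P0 := lt0r_neq0 (bfactor_gt0 d a0).
have H : series (fun j => bfactor d a * bterm d.+2 a j) @ \oo --> tmoment mu 1 a.
  have -> : (fun j => bfactor d a * bterm d.+2 a j) =
     (fun j => a ^+ j.*2.+1 / (j.*2.+1)`!%:R * moment mu (1 + j.*2.+1)).
    apply/funext => j; rewrite (bterm_order _ d0 a0) mulrA -(moment_bterm mu1 d0 a0) add1n.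
    have := moment_rec mu1 d0 j.*2.+1; rewrite /= addSn addnC => e.
    have n0 : (d + j.*2).+1%:R != 0 :> R by rewrite pnatr_eq0.
    have -> : moment mu j.*2.+2 = j.*2.+1%:R * moment mu j.*2 / (d + j.*2).+1%:R.
      by rewrite e mulrAC divff ?mul1r.
    rewrite factS exprS natrM.
    have k0 : j.*2.+1%:R != 0 :> R by rewrite pnatr_eq0.
    move: (_.+1%:R) n0 => n n0; move: (_.+1%:R) k0 => k k0.
    by field; rewrite n0 k0 fact_neq0.
  apply: (@cvg_series_odd R (fun k => a ^+ k / k`!%:R * moment mu (1 + k))).
    by move=> j; rewrite add1n (moment_odd mu1) mulr0.
  exact: (cvg_tmoment mu1).
have H2 : series (fun j => bfactor d a * bterm d.+2 a j) @ \oo --> bfactor d a * hbessel d.+2 a.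
  have -> : series (fun j => bfactor d a * bterm d.+2 a j) = (fun n => bfactor d a * series (bterm d.+2 a) n).
    by apply/funext => n; rewrite /series/= mulr_sumr.
  by apply: cvgMr; exact: cvg_bterm.
rewrite -(cvg_lim (@norm_hausdorff _ _) H).
exact: (cvg_lim (@norm_hausdorff _ _) H2).
Qed.

(** The recurrence I_(nu-1) - I_(nu+1) = (2 nu/a) I_nu at nu = (d+1)/2. In the series of I_(nu-1) -
    (2 nu/a) I_nu the first term vanishes and term k+1 is term k of I_(nu+1). *)
Lemma hbessel_rec d a : (0 < d)%N -> 0 < a ->
  hbessel d a - hbessel d.+4 a = d.+1%:R / a * hbessel d.+2 a.
Proof.
move=> d0 a0; apply/eqP; rewrite subr_eq addrC -subr_eq; apply/eqP.
have c0 := cvg_bterm d0 a0.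
have c2 : series (bterm d.+2 a) @ \oo --> hbessel d.+2 a by exact: cvg_bterm.
have c4 : series (bterm d.+4 a) @ \oo --> hbessel d.+4 a by exact: cvg_bterm.
have ane : a != 0 by rewrite gt_eqF.
pose u k := bterm d a k - d.+1%:R / a * bterm d.+2 a k.
have cu : series u @ \oo --> hbessel d a - d.+1%:R / a * hbessel d.+2 a.
  have -> : series u = (fun n => series (bterm d a) n - d.+1%:R / a * series (bterm d.+2 a) n).
    by apply/funext => n; rewrite /series/= mulr_sumr -sumrB.
  by apply: cvgB; [exact: c0|apply: cvgMr; exact: c2].
have u0 : u 0%N = 0.
  have k0 : d.+1%:R != 0 :> R by rewrite pnatr_eq0.
  rewrite /u (bterm_order _ d0 a0) addn0.
  by move: (d.+1%:R) k0 => x k0; field; rewrite ane k0.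
have uS k : u k.+1 = bterm d.+4 a k.
  have -> : bterm d.+4 a k = bterm d a k * (a / (d + k.*2).+1%:R) * (a / (d.+2 + k.*2).+1%:R).
    by rewrite (bterm_order _ (ltn0Sn d.+1) a0) (bterm_order _ d0 a0).
  rewrite /u (bterm_order _ d0 a0) (bterm_succ _ d0 a0).
  rewrite !natr_aux.
  have -> : d%:R + 2 * k.+1%:R + 1 = d%:R + 2 * k%:R + 1 + 2 :> R by ring.
  have -> : d.+2%:R + 2 * k%:R + 1 = d%:R + 2 * k%:R + 1 + 2 :> R by ring.
  rewrite -[k.+1%:R]natr1 -[d.+1%:R]natr1.
  have k0 : k%:R + 1 != 0 :> R by rewrite natr1 pnatr_eq0.
  have n0 : d%:R + 2 * k%:R + 1 != 0 :> R by rewrite -natrM -natrD natr1 pnatr_eq0.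
  have n2 : d%:R + 2 * k%:R + 1 + 2 != 0 :> R by rewrite -natrM -natrD natr1 -natrD pnatr_eq0.
  by field; rewrite ?ane ?k0 ?n0 ?n2.
have : (fun n => series u n.+1) @ \oo --> hbessel d a - d.+1%:R / a * hbessel d.+2 a.
  by rewrite (cvg_shiftS (series u)).
have -> : (fun n => series u n.+1) = series (bterm d.+4 a).
  apply/funext => n; rewrite /series/= big_nat_recl//= u0 add0r.
  by apply: eq_bigr => i _; exact: uS.
move=> h; rewrite -(cvg_lim (@norm_hausdorff _ _) h).
exact: (cvg_lim (@norm_hausdorff _ _) c4).
Qed.

Lemma hbessel_gt0 d a : (0 < d)%N -> 0 < a -> 0 < hbessel d a.
Proof.
move=> d0 a0; apply: (@lt_le_trans _ _ (bterm d a 0)); first exact: (bterm_gt0 _ d0 a0).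
have -> : bterm d a 0 = series (bterm d a) 1 by rewrite /series/= big_nat1.
rewrite -(cvg_lim (@norm_hausdorff _ _) (cvg_bterm d0 a0)).
apply: nondecreasing_cvgn_le; last by apply/cvg_ex; eexists; exact: cvg_bterm.
by apply: nondecreasing_series => i _ _; rewrite ltW// bterm_gt0.
Qed.

(* The left-hand side is the integral of e^{2 kappa t} (kappa^2 (1 - t^2) - d kappa t)^2. *)
Lemma tmoment_laplacian d (mu : 'rV[R]_d.+1) kappa : sphere d mu -> (0 < d)%N -> 0 < kappa ->
  let T p := tmoment mu p (2 * kappa) in
  kappa ^+ 4 * (T 0%N - 2 * T 2%N + T 4%N) - 2 * d%:R * kappa ^+ 3 * (T 1%N - T 3%N) +
    d%:R ^+ 2 * kappa ^+ 2 * T 2%N =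
  bfactor d (2 * kappa) * (d%:R * kappa / 4 *
    (2 * d%:R * hbessel d.+2 (2 * kappa) + (d%:R + 2) * kappa * hbessel d.+4 (2 * kappa))).
Proof.
move=> mu1 d0 k0 T; set a := 2 * kappa.
have a0 : 0 < a by rewrite mulr_gt0.
have k1 := lt0r_neq0 k0; have a1 := lt0r_neq0 a0.
have e0 := tmoment_rec mu1 d0 0 a.
have e1 := tmoment_rec mu1 d0 1 a.
have e2 := tmoment_rec mu1 d0 2 a.
have r := hbessel_rec d0 a0.
have h4 : hbessel d.+4 a = hbessel d a - d.+1%:R / a * hbessel d.+2 a by rewrite -r subKr.
rewrite /T -/a (tmoment0E mu1 d0 a0) (tmoment1E mu1 d0 a0) h4.
move: e0 e1 e2; rewrite /= !natrD (tmoment0E mu1 d0 a0) (tmoment1E mu1 d0 a0).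
move: (hbessel d a) (hbessel d.+2 a) (bfactor d a) => I0 I1 P.
move: (tmoment mu 2 a) (tmoment mu 3 a) (tmoment mu 4 a) => T2 T3 T4.
move: (d%:R) => D; rewrite mul0r !add0r => e0 e1 e2.
have aE : a = 2 * kappa by [].
clearbody a.
have E2 : T2 = P * I0 - D * (P * I1) / a.
  by rewrite -e0; field.
have E3 : T3 = P * I1 + (P * I0 - (1 + D) * T2) / a.
  by rewrite -e1; field.
have E4 : T4 = T2 + (2 * (P * I1) - (2 + D) * T3) / a.
  by rewrite -e2; field.
by rewrite E4 E3 E2 aE; field.
Qed.

End half_integer_bessel.

(** * The Laplacian of the radial extension *)
Section line_derivatives.
Context {R : realType}.

(** Directional derivatives become derivatives at 0 of functions of one real variable, so the
    Laplacian needs only calculus along coordinate lines. *)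
Lemma is_derive_line (V : normedModType R) (f : V -> R) (y v : V) (df : R) :
  is_derive (0 : R) (1 : R) (fun h : R => f (h *: v + y)) df -> is_derive y v f df.
Proof.
have E : (fun h : R => h^-1 *: (((fun h : R => f (h *: v + y)) \o shift (0 : R)) (h *: (1 : R)) -
     (fun h : R => f (h *: v + y)) 0)) = (fun h => h^-1 *: ((f \o shift y) (h *: v) - f y)).
  apply/funext => h /=; rewrite scale0r add0r addr0.
  by rewrite [h *: 1]mulr1.
move=> [d1 d2]; apply: DeriveDef.
  by move: d1; rewrite /derivable E.
by move: d2; rewrite /derive E.
Qed.

Lemma is_derive_ext (f g : R -> R) (x df dg : R) :
  is_derive x (1 : R) f df -> f =1 g -> df = dg -> is_derive x (1 : R) g dg.
Proof. by move=> H /funext <- <-. Qed.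

Lemma is_deriveM_fun (f g : R -> R) (x df dg : R) :
  is_derive x (1 : R) f df -> is_derive x (1 : R) g dg ->
  is_derive x (1 : R) (fun h => f h * g h) (df * g x + f x * dg).
Proof.
move=> F G; apply: (is_derive_ext (is_deriveM F G)) => //.
by rewrite /GRing.scale/= addrC; congr (_ + _); rewrite mulrC.
Qed.

Lemma is_deriveB_fun (f g : R -> R) (x df dg : R) :
  is_derive x (1 : R) f df -> is_derive x (1 : R) g dg ->
  is_derive x (1 : R) (fun h => f h - g h) (df - dg).
Proof. by move=> F G; exact: (is_derive_ext (is_deriveB F G)). Qed.

Lemma is_deriveZ_fun (f : R -> R) (x df k : R) :
  is_derive x (1 : R) f df -> is_derive x (1 : R) (fun h => k * f h) (k * df).
Proof. by move=> F; exact: (is_derive_ext (is_deriveZ k F)). Qed.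

Lemma is_derive_comp_fun (f g : R -> R) (x y a b : R) : g x = y ->
  is_derive y (1 : R) f a -> is_derive x (1 : R) g b ->
  is_derive x (1 : R) (fun h => f (g h)) (a * b).
Proof. by move=> <- F G; exact: (is_derive1_comp F G). Qed.

Lemma is_derive_affine (x a b : R) : is_derive x (1 : R) (fun h => h * a + b) a.
Proof.
have H := is_deriveM_fun (is_derive_id x (1 : R)) (is_derive_cst a x (1 : R)).
apply: (is_derive_ext (is_deriveD H (is_derive_cst b x (1 : R)))) => //.
by rewrite mul1r mulr0 !addr0.
Qed.

Lemma is_derive_quad (x p q : R) : is_derive x (1 : R) (fun h => h * h + h * (2 * p) + q) (2 * x + 2 * p).
Proof.
have H1 := is_deriveM_fun (is_derive_id x (1 : R)) (is_derive_id x (1 : R)).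
have H2 := is_derive_affine x (2 * p) q.
by apply: (is_derive_ext (is_deriveD H1 H2)) => [h|]; rewrite ?fctE; ring.
Qed.

(** Along a coordinate line |y|^2 becomes h^2 + 2 p h + q, with p the coordinate and q = |y|^2; this
    covers every power of the norm. *)
Lemma is_derive_quad_powR (p q r : R) : 0 < q ->
  is_derive (0 : R) (1 : R) (fun h => (h * h + h * (2 * p) + q) `^ r) (r * q `^ (r - 1) * (2 * p)).
Proof.
move=> q0.
have E : 0 * 0 + 0 * (2 * p) + q = q by ring.
apply: (is_derive_ext (@is_derive_comp_fun (fun z => z `^ r)
  (fun h => h * h + h * (2 * p) + q) 0 q _ _ E (is_derive1_powR r q0) (is_derive_quad 0 p q))) => //.
by rewrite mulr0 add0r.
Qed.

Lemma dotDl n (x y z : 'rV[R]_n) : dot (x + y) z = dot x z + dot y z.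
Proof. by rewrite !dotE -big_split/=; apply: eq_bigr => i _; rewrite mxE mulrDl. Qed.

Lemma dot_delta n (z : 'rV[R]_n) (i : 'I_n) : dot (delta_mx ord0 i) z = z ord0 i.
Proof.
rewrite dotE (bigD1 i)//= big1 ?addr0; first by rewrite mxE !eqxx mul1r.
by move=> j ji; rewrite mxE (negbTE ji) andbF mul0r.
Qed.

Lemma dot_line n (y z : 'rV[R]_n) (i : 'I_n) (h : R) :
  dot (h *: delta_mx ord0 i + y) z = h * z ord0 i + dot y z.
Proof. by rewrite dotDl dotZl dot_delta. Qed.

Lemma dotxx_line n (y : 'rV[R]_n) (i : 'I_n) (h : R) :
  dot (h *: delta_mx ord0 i + y) (h *: delta_mx ord0 i + y) =
  h * h + h * (2 * y ord0 i) + dot y y.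
Proof.
by rewrite dot_line dotC dot_line !mxE !eqxx /=; ring.
Qed.

Lemma enormV n (y : 'rV[R]_n) : (enorm y)^-1 = dot y y `^ (- 2^-1).
Proof. by rewrite powRN powR12_sqrt// dot_ge0. Qed.

End line_derivatives.

(** * Second derivatives of the radial extension on the sphere *)

Section radial_laplacian.
Context {R : realType}.
Variables (d : nat) (mu : 'rV[R]_d.+1) (c kappa : R).
Hypothesis mu1 : sphere d mu.
Let N := d.+1.
Implicit Types (x y : 'rV[R]_N) (i : 'I_N).

Let f y : R := c * expR (kappa * dot y mu).

(** [u] is the cosine of the angle to [mu] and [grad i] its i-th partial derivative, with norms
    written as powers -1/2 and -3/2 of |y|^2. *)
Let u y : R := dot y y `^ (- 2^-1) * dot y mu.
Let grad i y : R := dot y y `^ (- 2^-1) * mu ord0 i - dot y y `^ (- 2^-1 - 1) * (dot y mu * y ord0 i).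

Lemma radial_extE : radial_ext f = fun y => c * expR (kappa * u y).
Proof. by apply/funext => y; rewrite /radial_ext /f normalizeE enormV. Qed.

Lemma is_derive_u i y : 0 < dot y y ->
  is_derive (0 : R) (1 : R) (fun h : R => u (h *: delta_mx ord0 i + y)) (grad i y).
Proof.
move=> q0; rewrite /u.
under eq_fun do rewrite dotxx_line dot_line.
have H := is_deriveM_fun (is_derive_quad_powR (y ord0 i) (- 2^-1) q0) (is_derive_affine 0 (mu ord0 i) (dot y mu)).
apply: (is_derive_ext H) => //.
rewrite /grad !mul0r !add0r.
by move: (_ `^ _) (_ `^ _) => p1 p2; field.
Qed.

Lemma is_derive_radial i y : 0 < dot y y ->
  is_derive (0 : R) (1 : R) (fun h : R => radial_ext f (h *: delta_mx ord0 i + y))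
    (radial_ext f y * (kappa * grad i y)).
Proof.
move=> q0; rewrite radial_extE.
have u0 : kappa * u (0 *: delta_mx ord0 i + y) = kappa * u y by rewrite scale0r add0r.
have H1 := is_deriveZ_fun kappa (is_derive_u i q0).
have H2 := @is_derive_comp_fun R expR (fun h => kappa * u (h *: delta_mx ord0 i + y)) 0 _ _ _ u0 (is_derive_expR _) H1.
by apply: (is_derive_ext (is_deriveZ_fun c H2)) => //; rewrite mulrA.
Qed.

(** Stated at all nonzero points, because differentiating once more on the sphere uses the first
    derivative in a neighbourhood. *)
Lemma derive_radial i y : 0 < dot y y ->
  'D_(delta_mx ord0 i) (radial_ext f) y = radial_ext f y * (kappa * grad i y).
Proof. by move=> q0; apply: derive_val; exact: is_derive_line (is_derive_radial i q0). Qed.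

Lemma derive2_radial i x : sphere d x ->
  'D_(delta_mx ord0 i) ('D_(delta_mx ord0 i) (radial_ext f)) x =
  f x * (kappa ^+ 2 * (mu ord0 i - x ord0 i * dot x mu) ^+ 2 +
    kappa * (3 * x ord0 i ^+ 2 * dot x mu - 2 * (x ord0 i * mu ord0 i) - dot x mu)).
Proof.
move=> /sphere_dot x1; apply: derive_val; apply: is_derive_line.
have q0 : 0 < dot x x by rewrite x1.
have fx : radial_ext f x = f x by rewrite radial_extE /u x1 powR1 mul1r.
apply: (@near_eq_is_derive _ _ _ (fun h : R => radial_ext f (h *: delta_mx ord0 i + x) *
   (kappa * grad i (h *: delta_mx ord0 i + x)))).
  have cq : {for 0, continuous (fun h : R => h * h + h * (2 * x ord0 i) + dot x x)}.
    exact: is_derive_continuous (is_derive_quad 0 _ _).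
  have : \forall h \near (0 : R), 0 < h * h + h * (2 * x ord0 i) + dot x x.
    by apply: (cvgr_gt _ cq); rewrite !mul0r !add0r.
  apply: filterS => h; rewrite -dotxx_line => q1.
  by rewrite derive_radial.
have H1 := is_derive_radial i q0.
have P1 := is_derive_quad_powR (x ord0 i) (- 2^-1) q0.
have P3 := is_derive_quad_powR (x ord0 i) (- 2^-1 - 1) q0.
have A1 := is_derive_affine 0 (mu ord0 i) (dot x mu).
have A2 := is_derive_affine 0 1 (x ord0 i).
(* Second partial derivative of the cosine at a unit vector, where all powers of the norm are 1. *)
have H2 : is_derive (0 : R) (1 : R) (fun h => grad i (h *: delta_mx ord0 i + x)) 
   (3 * x ord0 i ^+ 2 * dot x mu - 2 * (x ord0 i * mu ord0 i) - dot x mu).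
  rewrite (_ : (fun h => _) = (fun h => (h * h + h * (2 * x ord0 i) + dot x x) `^ (- 2^-1) * mu ord0 i -
    (h * h + h * (2 * x ord0 i) + dot x x) `^ (- 2^-1 - 1) * ((h * mu ord0 i + dot x mu) * (h * 1 + x ord0 i)))); last first.
    by apply/funext => h; rewrite /grad dotxx_line dot_line !mxE !eqxx.
  have H := is_deriveB_fun (is_deriveM_fun P1 (is_derive_cst (mu ord0 i) 0 (1 : R))) (is_deriveM_fun P3 (is_deriveM_fun A1 A2)).
  by apply: (is_derive_ext H) => //; rewrite x1 !mul0r !add0r !powR1 /cst; field.
apply: (is_derive_ext (is_deriveM_fun H1 (is_deriveZ_fun kappa H2))) => //.
rewrite scale0r add0r fx /grad x1 !powR1; ring.
Qed.

(** Summation over i uses that mu_i^2 and x_i^2 sum to 1 and x_i mu_i to t; the coefficient of kappa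
    t is 3 - 2 - (d+1) = -d. *)
Lemma laplacian_radial x : sphere d x ->
  laplacian (radial_ext f) x =
  f x * (kappa ^+ 2 * (1 - dot x mu ^+ 2) - d%:R * kappa * dot x mu).
Proof.
move=> xs; rewrite /laplacian (eq_bigr _ (fun i _ => derive2_radial i xs)).
rewrite -mulr_sumr; congr (_ * _).
have x1 := sphere_dot xs; have m1 := sphere_dot mu1.
rewrite dotE in x1; rewrite dotE in m1.
have b := dotE x mu.
transitivity (\sum_i (kappa ^+ 2 * (mu ord0 i * mu ord0 i) - (2 * kappa ^+ 2 * dot x mu + 2 * kappa) * (x ord0 i * mu ord0 i) +
   (kappa ^+ 2 * dot x mu ^+ 2 + 3 * kappa * dot x mu) * (x ord0 i * x ord0 i) - kappa * dot x mu)).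
  by apply: eq_bigr => i _; ring.
rewrite sumrB big_split/= sumrB -!mulr_sumr x1 m1 -b sumr_const card_ord -mulr_natl; ring.
Qed.

End radial_laplacian.

(** * The closed formula *)

Ltac posR := repeat first [assumption | exact: ltr0Sn | apply: mulr_gt0 | apply: powR_gt0 | apply: exprn_gt0 | rewrite invr_gt0 ].

Section rho_formula.
Context {R : realType}.
Opaque moment tmoment hbessel bterm.

Lemma integrable_tmoment d (mu : 'rV[R]_d.+1) p (a : R) : sphere d mu ->
  (@sphere_measure R d).-integrable (sphere d) (EFin \o (fun x => dot x mu ^+ p * expR (a * dot x mu))).
Proof.
move=> mu1; apply: (@sphere_integrable R d mu mu1 _ (expR `|a|)).
  have mD := @measurable_dot R d.+1 mu.
  apply: measurable_funM; first exact: measurable_funX.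
  by apply: measurableT_comp => //; exact: measurable_funM.
move=> x xs; rewrite normrM -[leRHS]mul1r ler_pM//; first exact: dot_exp_le1.
rewrite ger0_norm ?expR_ge0// ler_expR (le_trans (ler_norm _))// normrM ler_piMr//.
exact: dot_sphere_le1.
Qed.

Lemma Rintegral_tmoment d (mu : 'rV[R]_d.+1) n (co : nat -> R) (a : R) : sphere d mu ->
  \int[@sphere_measure R d]_(x in sphere d) (\sum_(p < n) co p * (dot x mu ^+ p * expR (a * dot x mu))) =
  \sum_(p < n) co p * tmoment mu p a.
Proof.
move=> mu1; have ms := @measurable_sphere R d.
have ic p := integrable_tmoment p a mu1.
rewrite /Rintegral.
rewrite (_ : (fun x => _) = (fun x => \sum_(p < n) (co p)%:E * (dot x mu ^+ p * expR (a * dot x mu))%:E)%E); last first.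
  by apply/funext => x; rewrite -sumEFin; apply: eq_bigr => p _; rewrite EFinM.
rewrite integral_sum//; last by move=> p; apply: integrableZl => //; exact: ic.
rewrite -sum_fine; last first.
  by move=> p _; apply: integrable_fin_num => //; apply: integrableZl => //; exact: ic.
apply: eq_bigr => p _; rewrite integralZl//; last exact: ic.
by rewrite fineM//; apply: integrable_fin_num => //; exact: ic.
Qed.

Lemma sphere_sqint_vMF d (mu : 'rV[R]_d.+1) (kappa : R) : sphere d mu ->
  sphere_sqint (vMF mu kappa) = vMF_const d kappa ^+ 2 * tmoment mu 0 (2 * kappa).
Proof.
move=> mu1; have := @Rintegral_tmoment d mu 1 (fun=> vMF_const d kappa ^+ 2) (2 * kappa) mu1.
rewrite !big_ord1 => <-; apply: eq_Rintegral => x _.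
rewrite big_ord1 /vMF exprMn expr0 mul1r -expRM_natl; congr (_ * expR _); ring.
Qed.

Lemma sphere_sqint_laplacian d (mu : 'rV[R]_d.+1) (kappa : R) : sphere d mu -> (0 < d)%N -> 0 < kappa ->
  sphere_sqint (laplacian (radial_ext (vMF mu kappa))) =
  vMF_const d kappa ^+ 2 * (bfactor d (2 * kappa) * (d%:R * kappa / 4 *
    (2 * d%:R * hbessel d.+2 (2 * kappa) + (d%:R + 2) * kappa * hbessel d.+4 (2 * kappa)))).
Proof.
move=> mu1 d0 k0; rewrite -(tmoment_laplacian mu1 d0 k0).
pose D : R := d%:R.
(* Coefficients of (kappa^2 (1 - t^2) - d kappa t)^2 by degree in t. *)
pose co p : R := vMF_const d kappa ^+ 2 * nth 0 [:: kappa ^+ 4; - (2 * D * kappa ^+ 3);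
   D ^+ 2 * kappa ^+ 2 - 2 * kappa ^+ 4; 2 * D * kappa ^+ 3; kappa ^+ 4] p.
have := @Rintegral_tmoment d mu 5 co (2 * kappa) mu1.
rewrite [RHS]big_ord_recl 4?big_ord_recl big_ord0 /co /= /bump /= => H.
transitivity (\int[@sphere_measure R d]_(x in sphere d) (\sum_(p < 5) co p * (dot x mu ^+ p * expR (2 * kappa * dot x mu)))).
  apply: eq_Rintegral => x; rewrite inE => xs.
  rewrite (laplacian_radial (vMF_const d kappa) kappa mu1 xs).
  rewrite 5?big_ord_recl big_ord0 /co /= /bump /=.
  have -> : expR (2 * kappa * dot x mu) = expR (kappa * dot x mu) ^+ 2.
    by rewrite -expRM_natl; congr expR; ring.
  move: (expR _) => e; rewrite /D; ring.
rewrite H.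
move: (tmoment mu 0 _) (tmoment mu 1 _) (tmoment mu 2 _) (tmoment mu 3 _) (tmoment mu 4 _) => T0 T1 T2 T3 T4.
rewrite /D; ring.
Qed.

Transparent hbessel.

Lemma hbesselS2 d (z : R) : besselI ((d%:R + 1) / 2) z = hbessel d.+2 z.
Proof.
have e : (d%:R + 1) / 2 = (d.+2%:R - 1) / 2 :> R by field.
by rewrite e.
Qed.

Lemma hbesselS4 d (z : R) : besselI ((d%:R + 3) / 2) z = hbessel d.+4 z.
Proof.
have e : (d%:R + 3) / 2 = (d.+4%:R - 1) / 2 :> R by field.
by rewrite e.
Qed.

Lemma hbesselS0 d (z : R) : besselI ((d%:R - 1) / 2) z = hbessel d z.
Proof. by []. Qed.

Opaque hbessel.

(** With c the normalizing constant, c^2 / (c^2)^(d/(d+4)) = c^(8/(d+4)) accounts for the power 8/d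
    inside the braces. Both sides are monomials in positive quantities, the bracket [Z] counting as
    one of them, so logarithms leave a linear identity with coefficients rational in d. *)
Lemma rho_vMF d (mu : 'rV[R]_d.+1) (kappa : R) : (0 < d)%N -> 0 < kappa -> sphere d mu ->
  rho (vMF mu kappa) = hbessel d (2 * kappa) *
        (4 * pi `^ (2 * (1 + d%:R^-1)) * d%:R * hbessel d kappa `^ (8 / d%:R) *
         kappa `^ (2 / d%:R - 1) *
         (2 * d%:R * hbessel d.+2 (2 * kappa) +
          (d%:R + 2) * kappa * hbessel d.+4 (2 * kappa)))
          `^ (- (d%:R / (d%:R + 4))).
Proof.
move=> d0 k0 mu1.
have a0 : 0 < 2 * kappa by rewrite mulr_gt0.
rewrite /rho sphere_sqint_laplacian// sphere_sqint_vMF// tmoment0E//.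
have D0 : (0 : R) < d%:R by rewrite ltr0n.
have D1 := lt0r_neq0 D0.
have D4 : d%:R + 4 != 0 :> R by rewrite gt_eqF// addr_gt0.
have I1 := hbessel_gt0 d0 k0.
have I2 := hbessel_gt0 d0 a0.
have Z0 : 0 < 2 * d%:R * hbessel d.+2 (2 * kappa) + (d%:R + 2) * kappa * hbessel d.+4 (2 * kappa).
  by rewrite addr_gt0// !mulr_gt0 ?hbessel_gt0// addr_gt0.
rewrite /vMF_const hbesselS0 /bfactor.
move: (hbessel d kappa) (hbessel d (2 * kappa)) I1 I2 => I J I0 J0.
move: (2 * d%:R * _ + _) Z0 => Z Z0.
move: (d%:R) D0 D1 D4 => D D0 D1 D4.
have p0 : 0 < pi :> R by exact: pi_gt0.
have pp : 0 < 2 * pi :> R by rewrite mulr_gt0.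
have e4 : (4 : R) = 2 * 2 by ring.
pose P := (pi : R); rewrite -/P in p0 pp *.
have two0 : 0 < 2 :> R by [].
have four0 : 0 < 4 :> R by [].
apply: ln_inj; [by rewrite posrE; posR|by rewrite posrE; posR|].
rewrite ?(lnM, lnV, ln_powR, lnXn, posrE); try by posR.
rewrite ?mulr2n.
have l4 : ln 4 = ln 2 + ln 2 :> R by rewrite e4 lnM ?posrE.
rewrite ?l4.
move: (ln _) (ln _) (ln _) (ln _) (ln _) (ln _) (ln _) => x1 x2 x3 x4 x5 x6 x7.
by move: (D) D1 D4 => D' D1' D4'; field; rewrite D1' D4'.
Qed.

End rho_formula.

(** * Laplace's method on the sphere *)
Section gnomonic.
Context {R : realType}.
Local Notation leb := (@lebesgue_measure R).
Variable (d : nat).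

(* Inverse of the central projection of a half sphere, up to normalization;
   [cosine y] is the first coordinate of the point of the sphere over y. *)
Definition gnomonic (y : 'rV[R]_d) : 'rV[R]_d.+1 := rV_cons (1, y).

Definition cosine (y : 'rV[R]_d) : R := (enorm (gnomonic y))^-1.

Lemma enorm_gnomonic y : enorm (gnomonic y) = Num.sqrt (1 + dot y y).
Proof. by rewrite /enorm dot_cons mulr1. Qed.

Lemma gnomonic_gt0 y : 0 < enorm (gnomonic y).
Proof. by rewrite enorm_gnomonic sqrtr_gt0 ltr_pwDl// dot_ge0. Qed.

Lemma cosine_gt0 y : 0 < cosine y.
Proof. by rewrite invr_gt0 gnomonic_gt0. Qed.

Lemma measurable_gnomonic : measurable_fun setT gnomonic.
Proof.
apply: (measurableT_comp (@measurable_rV_cons R d)).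
by apply/measurable_fun_pair.
Qed.

Lemma measurable_cosine : measurable_fun setT cosine.
Proof.
rewrite /cosine; under eq_fun do rewrite -powR_inv1 ?sqrtr_ge0//.
apply: (measurableT_comp (measurable_powR _)).
exact: (measurableT_comp (@measurable_enorm R d.+1) measurable_gnomonic).
Qed.

Definition half_space : set 'rV[R]_d.+1 := [set x | 0 < x ord0 ord0].
Local Notation half := half_space.

Lemma measurable_half_space : measurable half.
Proof.
rewrite (_ : half = (fun x : 'rV[R]_d.+1 => x ord0 ord0) @^-1` `]0, +oo[%classic); last first.
  by apply/seteqP; split => x /=; rewrite in_itv/= andbT.
by rewrite -[X in measurable X]setTI; exact: measurable_coord.
Qed.

Lemma half_space_normalize (x : 'rV[R]_d.+1) : half (normalize x) = (0 < enorm x) && (0 < x ord0 ord0) :> Prop.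
Proof.
rewrite /half_space/= /normalize mxE; congr is_true.
have := enorm_ge0 x; rewrite le_eqVlt => /predU1P[<-|x0].
  by rewrite invr0 mul0r ltxx.
by rewrite x0/= pmulr_rgt0 ?invr_gt0.
Qed.

Lemma measurable_rV_cons_scale :
  measurable_fun setT (fun z : measurableTypeR R * 'rV[R]_d => rV_cons (z.1, (z.1 : R) *: z.2)).
Proof.
apply: (measurableT_comp (@measurable_rV_cons R d)); apply/measurable_fun_pair => /=; first exact: measurable_fst.
apply/measurable_fun_rVP => i; under eq_fun do rewrite mxE.
apply: measurable_funM; first exact: measurable_fst.
exact: (measurableT_comp (measurable_coord i) measurable_snd).
Qed.

(** In the coordinates x = (t, t y), with Jacobian t^d, the cone over the half sphere is 0 < t <=
    [cosine y], and the integral of (d+1) t^d over that range is the weight. *)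
Lemma ge0_integral_gnomonic (psi : 'rV[R]_d.+1 -> \bar R) :
  measurable_fun setT psi -> (forall x, 0 <= psi x)%E ->
  (\int[@sphere_measure R d]_(x in sphere d `&` half) psi x =
   \int[lebesgue_rV d]_y (psi (normalize (gnomonic y)) * (cosine y ^+ d.+1)%:E))%E.
Proof.
move=> mpsi psi0;
have mhalf := measurable_half_space.
have mb := @measurable_punctured_ball R d.+1 1.
rewrite integral_mkcondr.
pose f := psi \_ half; pose g := (f \o normalize) \_ (@punctured_ball R d.+1 1).
have f0 x : (0 <= f x)%E by exact: erestrict_ge0.
have g0 x : (0 <= g x)%E by rewrite /g patchE; case: ifPn => // _; exact: f0.
have mf : measurable_fun setT f.
  by apply/(measurable_restrictT _ _).1 => //; exact: measurable_funTS.
have mfn : measurable_fun setT (f \o normalize) := measurableT_comp mf (@measurable_normalize R d.+1).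
have mg : measurable_fun setT g.
  by apply/(measurable_restrictT _ _).1 => //; exact: measurable_funTS.
rewrite ge0_integral_sphere// integral_mkcond -/g ge0_integral_rVS'//.
have gE t y : g (rV_cons (t, t *: y)) =
    (psi (normalize (gnomonic y)) * (\1_(`]0%R, cosine y]%classic : set R) t)%:E)%E.
  have gE0 : rV_cons (t, t *: y) = t *: gnomonic y by rewrite rV_consZ mulr1.
  rewrite gE0.
  have [t0|t0] := leP t 0.
    rewrite indicE memNset ?mule0; last by rewrite /= in_itv/= ltNge t0.
    rewrite /g patchE; case: ifPn => // _; rewrite /= /f patchE memNset//.
    by rewrite half_space_normalize -gE0 rV_cons0 => /andP[_]; rewrite ltNge t0.
  rewrite /g /f !patchE /= normalizeZ// !patchE [normalize (gnomonic y) \in half]mem_set; last first.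
    by rewrite half_space_normalize rV_cons0 gnomonic_gt0 ltr01.
  rewrite indicE; have -> : (t *: gnomonic y \in @punctured_ball R d.+1 1) = (t \in (`]0%R, cosine y]%classic : set R)).
    apply/idP/idP; rewrite !inE /punctured_ball /= in_itv/= enormZ gtr0_norm// t0 /=.
      by move=> /andP[_]; rewrite -ler_pdivlMr ?gnomonic_gt0// mul1r.
    rewrite mulr_gt0 ?gnomonic_gt0//=.
    by rewrite -[X in _ <= X -> _]mul1r ler_pdivlMr ?gnomonic_gt0.
  by case: ifPn => _; rewrite ?mule1 ?mule0.
have gneg t y : t <= 0 -> g (rV_cons (t, y)) = 0%E.
  move=> t0; rewrite /g patchE; case: ifPn => // _; rewrite /= /f patchE memNset//.
  by rewrite half_space_normalize rV_cons0 => /andP[_]; rewrite ltNge t0.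
have mgt t : measurable_fun setT (fun y : 'rV[R]_d => g (rV_cons (t, y))).
  apply: (measurableT_comp mg); apply: (measurableT_comp (@measurable_rV_cons R d)).
  by apply/measurable_fun_pair.
pose G (z : measurableTypeR R * 'rV[R]_d) := ((`|z.1 : R| ^+ d)%:E * g (rV_cons (z.1, (z.1 : R) *: z.2)))%E.
have mG : measurable_fun setT G.
  apply: emeasurable_funM; last exact: (measurableT_comp mg measurable_rV_cons_scale).
  apply/measurable_EFinP; apply: measurable_funX; apply: measurableT_comp => //.
have G0 z : (0 <= G z)%E by rewrite mule_ge0// lee_fin exprn_ge0.
transitivity (d.+1%:R%:E * \int[leb]_t \int[lebesgue_rV d]_y G (t, y))%E.
  congr (_ * _)%E; apply: eq_integral => t _.
  (* The substitution degenerates at t = 0, where both integrands vanish. *)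
  have [->|t0] := eqVneq t 0.
    by rewrite !integral0_eq// => y _; rewrite /G /= gneg ?lexx ?mule0.
  rewrite (ge0_integral_rV_scale t0 (mgt t))// /G/= ge0_integralZl//.
  apply: (measurableT_comp mg); apply: (measurableT_comp (@measurable_rV_cons R d)).
  by apply/measurable_fun_pair => //; exact: measurable_scale_rV.
rewrite (fubini_tonelli (m1 := leb) (m2 := lebesgue_rV d) G)//.
rewrite -ge0_integralZl//; last 2 first.
- exact: measurable_fun_fubini_tonelli_G.
- by move=> y _; exact: integral_ge0.
apply: eq_integral => y _.
have cy0 := cosine_gt0 y.
have -> : (\int[leb]_t G (t, y) = psi (normalize (gnomonic y)) * \int[leb]_(t in `[0%R, cosine y]) (t ^+ d)%:E)%E.
  rewrite -integral_itv_obnd_cbnd//; last first.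
    by apply/measurable_EFinP; exact: measurable_funX.
  rewrite -ge0_integralZl//; last 2 first.
  - by apply/measurable_EFinP; exact: measurable_funX.
  - by move=> t /=; rewrite in_itv/= lee_fin => /andP[t0 _]; rewrite exprn_ge0// ltW.
  rewrite [RHS]integral_mkcond; apply: eq_integral => t _.
  rewrite /G/= gE patchE indicE; case: ifPn => [|_]; last by rewrite !mule0.
  by rewrite inE/= in_itv/= => /andP[t0 _]; rewrite mule1 muleC gtr0_norm.
have := @integral_exprn R d 0 (cosine y) (ltW cy0).
under eq_integral do rewrite EFinM.
rewrite ge0_integralZl//; last 2 first.
- by apply/measurable_EFinP; exact: measurable_funX.
- by move=> t /=; rewrite in_itv/= lee_fin => /andP[t0 _]; rewrite exprn_ge0.
by rewrite expr0n subr0 => <-; rewrite muleCA.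
Qed.

End gnomonic.

(** * Rescaling, domination and Gaussian limit on the half sphere *)

Section laplace_method.
Context {R : realType}.
Opaque moment tmoment hbessel bterm.
Local Notation leb := (@lebesgue_measure R).
Variable (d : nat).
Let e0 : 'rV[R]_d.+1 := delta_mx ord0 ord0.
Local Notation sig := (@sphere_measure R d).

Lemma dot_normalize_gnomonic (y : 'rV[R]_d) : dot (normalize (gnomonic y)) e0 = cosine y.
Proof. by rewrite normalizeE dotC dot_delta rV_cons0 mulr1. Qed.

Lemma sqr_cosine (y : 'rV[R]_d) : cosine y ^+ 2 = (1 + dot y y)^-1.
Proof.
by rewrite /cosine enorm_gnomonic exprVn sqr_sqrtr// addr_ge0// dot_ge0.
Qed.

Lemma cosine_le1 (y : 'rV[R]_d) : cosine y <= 1.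
Proof.
by rewrite -(@expr_le1 _ 2)// ?(ltW (cosine_gt0 y))// sqr_cosine invf_le1 ?lerDl ?ltr_pwDl ?dot_ge0.
Qed.

(** For the constant function 1 the gnomonic formula gives the area of the half sphere, which is
    finite. A multiple of this function, (1 + |y|^2)^(-(d+1)/2), later dominates the rescaled
    integrands. *)
Lemma cosine_integrable :
  (lebesgue_rV d).-integrable setT (EFin \o (fun y : 'rV[R]_d => cosine y ^+ d.+1)).
Proof.
have mh := measurable_half_space (R := R) (d := d).
have mc : measurable_fun setT (EFin \o (fun y : 'rV[R]_d => cosine y ^+ d.+1)).
  by apply/measurable_EFinP; apply: measurable_funX; exact: measurable_cosine.
apply/integrableP; split => //.
have := @ge0_integral_gnomonic R d (cst 1%E) (measurable_cst _) (fun=> lee01).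
rewrite integral_cst ?mul1e; last by apply: measurableI => //; exact: measurable_sphere.
move=> H; rewrite (_ : integral _ _ _ = sig (sphere d `&` @half_space R d)); last first.
  rewrite H; apply: eq_integral => y _.
  by rewrite /= mul1e ger0_norm// exprn_ge0// ltW// cosine_gt0.
apply: le_lt_trans (sphere_fin (@sphere_delta R d)).
have ms := @measurable_sphere R d.
by apply: le_measure; rewrite ?inE //; exact: measurableI.
Qed.

(** The integrand e^(a(t - 1)) over the half sphere in gnomonic coordinates dilated by sqrt a, the
    scale at which a Gaussian limit appears. *)
Definition laplace_kernel (a : R) (z : 'rV[R]_d) : R :=
  expR (- (a * (1 - cosine ((Num.sqrt a)^-1 *: z)))) * cosine ((Num.sqrt a)^-1 *: z) ^+ d.+1.

Lemma laplace_kernel_ge0 a z : 0 <= laplace_kernel a z.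
Proof. by rewrite mulr_ge0 ?expR_ge0// exprn_ge0// ltW// cosine_gt0. Qed.

Lemma measurable_laplace_kernel a : measurable_fun setT (laplace_kernel a).
Proof.
have mc : measurable_fun setT (fun z : 'rV[R]_d => cosine ((Num.sqrt a)^-1 *: z)).
  exact: (measurableT_comp (@measurable_cosine R d) (measurable_scale_rV _)).
apply: measurable_funM; last exact: measurable_funX.
apply: measurableT_comp => //; apply: measurableT_comp => //.
by apply: measurable_funM => //; exact: measurable_funB.
Qed.

Lemma integral_half_space_exp (a : R) : 0 < a ->
  (\int[sig]_(x in sphere d `&` @half_space R d) (expR (a * dot x e0))%:E =
   (expR a / Num.sqrt a ^+ d)%:E * \int[lebesgue_rV d]_z (laplace_kernel a z)%:E)%E.
Proof.
move=> a0; have s0 : 0 < Num.sqrt a by rewrite sqrtr_gt0.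
have mD := @measurable_dot R d.+1 e0.
rewrite ge0_integral_gnomonic//; last first.
  by apply/measurable_EFinP; apply: measurableT_comp => //; exact: measurable_funM.
have mk : measurable_fun setT (fun y : 'rV[R]_d => (expR (a * cosine y) * cosine y ^+ d.+1)%:E).
  apply/measurable_EFinP; apply: measurable_funM; last by apply: measurable_funX; exact: measurable_cosine.
  apply: measurableT_comp => //; apply: measurable_funM => //; exact: measurable_cosine.
under eq_integral do rewrite dot_normalize_gnomonic -EFinM.
rewrite (@ge0_integral_rV_scale R d (Num.sqrt a)^-1 (fun y => (expR (a * cosine y) * cosine y ^+ d.+1)%:E))//; last 2 first.
- by rewrite invr_neq0// gt_eqF.
- by move=> y; rewrite lee_fin mulr_ge0 ?expR_ge0// exprn_ge0// ltW// cosine_gt0.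
rewrite ger0_norm ?invr_ge0 ?(ltW s0)// mulrC EFinM -muleA exprVn; congr (_ * _)%E.
rewrite -ge0_integralZl//; last 2 first.
- by apply/measurable_EFinP; exact: measurable_laplace_kernel.
- by move=> z _; rewrite lee_fin laplace_kernel_ge0.
apply: eq_integral => z _; rewrite -EFinM /laplace_kernel mulrA -expRD.
by congr (expR _ * _)%:E; ring.
Qed.

(* With w the cosine at z / sqrt a, the domination uniform in a comes from
   w^2 (1 + |z|^2) = w^2 + a (1 - w^2) <= 1 + 2 a (1 - w). *)
Lemma laplace_kernel_le (a : R) (z : 'rV[R]_d) : 0 < a ->
  laplace_kernel a z <= d.+1%:R ^+ d.+1 * cosine z ^+ d.+1.
Proof.
move=> a0; rewrite /laplace_kernel.
have s0 : 0 < Num.sqrt a by rewrite sqrtr_gt0.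
have w0 := cosine_gt0 ((Num.sqrt a)^-1 *: z).
have w1 := cosine_le1 ((Num.sqrt a)^-1 *: z).
have W := sqr_cosine ((Num.sqrt a)^-1 *: z).
have v0 := cosine_gt0 z.
have V := sqr_cosine z.
move: (cosine _) w0 w1 W => w w0 w1 W; move: (cosine z) v0 V => v v0 V.
have q0 := dot_ge0 z.
rewrite dotZl dotC dotZl mulrA -invfM -expr2 sqr_sqrtr ?(ltW a0)// in W.
move: (dot z z) q0 V W => q q0 V W.
have aq : 0 < 1 + a^-1 * q by rewrite ltr_pwDl// mulr_ge0// invr_ge0 ltW.
have key : w ^+ 2 <= (1 + 2 * (a * (1 - w))) * v ^+ 2.
  rewrite V ler_pdivlMr ?ltr_pwDl//.
  have -> : w ^+ 2 * (1 + q) = w ^+ 2 + a * (1 - w ^+ 2).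
    have : w ^+ 2 * (1 + a^-1 * q) = 1 by rewrite W mulVf// gt_eqF.
    move=> h; rewrite -[in 1 - _]h; have an := lt0r_neq0 a0; by field.
  have : 0 <= a * (1 - w) ^+ 2 by rewrite mulr_ge0 ?(ltW a0)// sqr_ge0.
  have : w ^+ 2 <= 1 by rewrite expr_le1// ltW.
  rewrite !expr2; nra.
have y0 : 0 <= a * (1 - w) by rewrite mulr_ge0 ?(ltW a0)// subr_ge0.
move: (a * (1 - w)) y0 key => y y0 key.
have n0 : (0 : R) < d.+1%:R by rewrite ltr0n.
(* The exponent is divided by d+1 so that the (d+1)-st power below yields e^(2y), which the square
   of e^(-y) cancels exactly. *)
have key2 : (1 + 2 * y) <= d.+1%:R * expR (2 * y / d.+1%:R).
  apply: (@le_trans _ _ (d.+1%:R * (1 + 2 * y / d.+1%:R))).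
    by rewrite mulrDr mulr1 [_ * (_ / _)]mulrC divfK ?gt_eqF// lerD2r ler1n.
  by rewrite ler_pM2l// expR_ge1Dx.
have key3 : (w ^+ d.+1) ^+ 2 <= d.+1%:R ^+ d.+1 * expR (2 * y) * (v ^+ d.+1) ^+ 2.
  rewrite -!exprM !(mulnC d.+1) !exprM.
  apply: (@le_trans _ _ (((1 + 2 * y) * v ^+ 2) ^+ d.+1)).
    rewrite lerXn2r ?nnegrE// ?sqr_ge0//.
    by rewrite mulr_ge0 ?sqr_ge0// addr_ge0// mulr_ge0.
  rewrite exprMn ler_wpM2r//; first by rewrite exprn_ge0// sqr_ge0.
  have -> : expR (2 * y) = expR (2 * y / d.+1%:R) ^+ d.+1.
    by rewrite -expRM_natr divfK// gt_eqF.
  rewrite -exprMn lerXn2r ?nnegrE//; by rewrite addr_ge0// mulr_ge0.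
(* Squares are compared because [key3] bounds a square; the constant (d+1)^(d+1) is enlarged to its
   own square at the end. *)
rewrite -ler_sqr ?nnegrE ?mulr_ge0 ?exprn_ge0 ?expR_ge0 ?(ltW v0) ?(ltW w0)//.
rewrite [leLHS]exprMn [leRHS]exprMn.
apply: (@le_trans _ _ (expR (- y) ^+ 2 * (d.+1%:R ^+ d.+1 * expR (2 * y) * (v ^+ d.+1) ^+ 2))).
  by rewrite ler_wpM2l// sqr_ge0.
have -> : expR (- y) ^+ 2 * (d.+1%:R ^+ d.+1 * expR (2 * y) * (v ^+ d.+1) ^+ 2) =
  (expR (- y) ^+ 2 * expR (2 * y)) * (d.+1%:R ^+ d.+1 * (v ^+ d.+1) ^+ 2) by ring.
rewrite -expRM_natl -expRD mulrN addNr expR0 mul1r ler_wpM2r ?sqr_ge0//.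
by rewrite expr2 ler_pMl ?exprn_gt0// exprn_ege1// ler1n.
Qed.

(** From w^2 (1 + |z|^2/a) = 1 one gets a (1 - w) = |z|^2 w^2 / (1 + w), which tends to |z|^2/2 as w
    tends to 1. *)
Lemma cvg_laplace_kernel (u : R^nat) (z : 'rV[R]_d) : (forall n, 0 < u n) -> u @ \oo --> +oo ->
  laplace_kernel (u n) z @[n --> \oo] --> expR (- dot z z / 2).
Proof.
move=> u0 uoo.
have W n := sqr_cosine ((Num.sqrt (u n))^-1 *: z).
pose w n := cosine ((Num.sqrt (u n))^-1 *: z).
have wE n : w n ^+ 2 = (1 + (u n)^-1 * dot z z)^-1.
  by rewrite W dotZl dotC dotZl mulrA -invfM -expr2 sqr_sqrtr// ltW.
have w0 n : 0 < w n by exact: cosine_gt0.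
have cu : (u n)^-1 @[n --> \oo] --> (0 : R).
  apply/cvgrVy; first by apply: nearW => n; rewrite invr_gt0.
  by rewrite (_ : unstable.inv_fun _ = u)//; apply/funext => n; rewrite /= invrK.
have cw2 : (w n) ^+ 2 @[n --> \oo] --> (1 : R).
  rewrite (_ : (fun n => _) = (fun n => (1 + (u n)^-1 * dot z z)^-1)); last by apply/funext => n.
  rewrite -[X in _ --> X]invr1; apply: cvgV; first exact: oner_neq0.
  rewrite -[X in _ --> X]addr0; apply: cvgD; first exact: cvg_cst.
  by rewrite -[X in _ --> X](mul0r (dot z z)); apply: cvgMl.
have cw : w @ \oo --> (1 : R).
  have -> : w = (fun n => Num.sqrt (w n ^+ 2)).
    by apply/funext => n; rewrite sqrtr_sqr gtr0_norm.
  rewrite -[X in _ --> X]sqrtr1.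
  by apply: continuous_cvg => //; exact: sqrt_continuous.
rewrite /laplace_kernel -[X in _ --> X]mulr1; apply: cvgM; last first.
  rewrite -[X in _ --> X](expr1n _ d.+1).
  by apply: (cvg_comp w (fun x : R => x ^+ d.+1) cw); exact: exprn_continuous.
apply: (@cvg_comp _ _ _ (fun n => - (u n * (1 - w n))) (expR : R -> R)); last exact: continuous_expR.
rewrite mulNr; apply: cvgN.
have -> : (fun n => u n * (1 - cosine ((Num.sqrt (u n))^-1 *: z))) = (fun n => dot z z * (w n ^+ 2 / (1 + w n))).
  apply/funext => n; rewrite -/(w n).
  have : w n ^+ 2 * (1 + (u n)^-1 * dot z z) = 1.
    by rewrite wE mulVf// gt_eqF// ltr_pwDl// mulr_ge0 ?dot_ge0// invr_ge0 ltW.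
  have un := lt0r_neq0 (u0 n).
  have wn : 1 + w n != 0 by rewrite gt_eqF// addr_gt0.
  move: (w n) (u n) (dot z z) un wn => W' a q an Wn h.
  apply: (mulIf Wn).
  rewrite mulrA divfK// -mulrA (_ : (1 - W') * (1 + W') = 1 - W' ^+ 2); last by ring.
  by rewrite -[in 1 - _]h; field.
apply: cvgMr.
have -> : (2^-1 : R) = 1 / (1 + 1) by rewrite mul1r.
apply: cvgM => //; apply: cvgV; first by rewrite gt_eqF// addr_gt0.
by apply: cvgD => //; exact: cvg_cst.
Qed.

Lemma cvg_integral_laplace_kernel (u : R^nat) : (forall n, 0 < u n) -> u @ \oo --> +oo ->
  (\int[lebesgue_rV d]_z (laplace_kernel (u n) z)%:E)%E @[n --> \oo] --> (Num.sqrt (2 * pi) ^+ d)%:E.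
Proof.
move=> u0 uoo.
have := @integral_gauss_rV R d 0.
have d00 (x : 'rV[R]_d) : dot x 0 = 0 by rewrite dotE big1// => i _; rewrite mxE mulr0.
under eq_integral do rewrite d00 addr0.
rewrite d00 mul0r expR0 mulr1 => <-.
have mT : measurable [set: 'rV[R]_d] by exact: measurableT.
have mk n : measurable_fun setT (fun z => (laplace_kernel (u n) z)%:E).
  by apply/measurable_EFinP; exact: measurable_laplace_kernel.
have mg : measurable_fun setT (fun z : 'rV[R]_d => (expR (- dot z z / 2))%:E).
  apply/measurable_EFinP; apply: measurableT_comp => //; apply: measurable_funM => //.
  by apply: measurableT_comp => //; exact: measurable_dotxx.
have ig := integrableZl mT (d.+1%:R ^+ d.+1 : R) cosine_integrable.
have fg : {ae lebesgue_rV d, forall z : 'rV[R]_d, setT z ->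
   (laplace_kernel (u n) z)%:E @[n --> \oo] --> (expR (- dot z z / 2))%:E}.
  apply: aeW => z _; apply: cvg_EFin; first exact: nearW.
  exact: cvg_laplace_kernel.
have fd : {ae lebesgue_rV d, forall z (n : nat), setT z ->
   (`|(laplace_kernel (u n) z)%:E| <= (d.+1%:R ^+ d.+1)%:E * (EFin \o (fun y : 'rV[R]_d => (cosine y ^+ d.+1)%R)) z)%E}.
  apply: aeW => z n _; rewrite /= lee_fin ger0_norm ?laplace_kernel_ge0//.
  exact: laplace_kernel_le.
by have [_ _] := dominated_convergence mT mk mg fg ig fd.
Qed.

(** Once u >= 1, sqrt(u)^k <= u^k, and the Taylor term u^(k+1)/(k+1)! <= e^u bounds the quotient by
    (k+1)!/u. *)
Lemma cvg_expRN_exprn (u : R^nat) k : (forall n, 0 < u n) -> u @ \oo --> +oo ->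
  Num.sqrt (u n) ^+ k / expR (u n) @[n --> \oo] --> (0 : R).
Proof.
move=> u0 uoo.
have cu : (u n)^-1 @[n --> \oo] --> (0 : R).
  apply/cvgrVy; first by apply: nearW => n; rewrite invr_gt0.
  by rewrite (_ : unstable.inv_fun _ = u)//; apply/funext => n; rewrite /= invrK.
have F0 : (0 : R) < (k.+1)`!%:R by rewrite ltr0n fact_gt0.
apply: (@squeeze_cvgr _ _ _ _ (fun=> 0) (fun n => (k.+1)`!%:R * (u n)^-1)); last 2 first.
- exact: cvg_cst.
- by rewrite -[X in _ --> X](mulr0 ((k.+1)`!%:R)); apply: cvgMr.
have : \forall n \near \oo, 1 <= u n by move/cvgryPge: uoo; exact.
apply: filterS => n u1; apply/andP; split.
  by rewrite divr_ge0 ?expR_ge0// exprn_ge0// sqrtr_ge0.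
have h := expR_ge1Dxn k (ltW (u0 n)).
have h2 : u n ^+ k.+1 / (k.+1)`!%:R <= expR (u n) by apply: le_trans h; rewrite lerDr.
have sk : Num.sqrt (u n) ^+ k <= u n ^+ k.
  rewrite lerXn2r ?nnegrE ?sqrtr_ge0 ?(ltW (u0 n))//.
  by rewrite -[leRHS]sqr_sqrtr ?(ltW (u0 n))// ler_eXnr// -sqrtr1 ler_wsqrtr.
rewrite ler_pdivrMr ?expR_gt0//.
apply: (le_trans sk); rewrite mulrAC ler_pdivlMr// mulrC -ler_pdivrMl// mulrC.
by rewrite -exprSr mulrC.
Qed.

Lemma integrable_laplace_kernel a : 0 < a ->
  (lebesgue_rV d).-integrable setT (EFin \o laplace_kernel a).
Proof.
move=> a0; have mT : measurable [set: 'rV[R]_d] by exact: measurableT.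
apply: (le_integrable mT _ _ (integrableZl mT (d.+1%:R ^+ d.+1 : R) cosine_integrable)).
  by apply/measurable_EFinP; exact: measurable_laplace_kernel.
move=> z _; rewrite /= lee_fin !ger0_norm ?laplace_kernel_ge0 ?laplace_kernel_le//.
by rewrite mulr_ge0 ?exprn_ge0// ltW// cosine_gt0.
Qed.

(** Off the half sphere e^(ut) <= 1, so that part is at most a fixed area and is killed by u^(d/2)
    e^(-u). The limit is the same for every [d]: the Gaussian integral brings d factors sqrt(2 pi),
    [bfactor] brings d+1. *)
Lemma cvg_hbessel (u : R^nat) : (0 < d)%N -> (forall n, 0 < u n) -> u @ \oo --> +oo ->
  Num.sqrt (u n) / expR (u n) * hbessel d (u n) @[n --> \oo] --> (Num.sqrt (2 * pi))^-1.
Proof.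
move=> d0 u0 uoo.
have e1 : sphere d e0 := @sphere_delta R d.
pose C := \int[sig]_(x in sphere d `&` ~` @half_space R d) (1 : R).
have mh := measurable_half_space (R := R) (d := d).
have ms := @measurable_sphere R d.
pose L n := fine (\int[lebesgue_rV d]_z (laplace_kernel (u n) z)%:E)%E.
pose M n := \int[sig]_(x in sphere d `&` ~` @half_space R d) expR (u n * dot x e0).
have E n : tmoment e0 0 (u n) = expR (u n) / Num.sqrt (u n) ^+ d * L n + M n.
  have i1 := integrable_tmoment 0 (u n) e1.
  have -> : tmoment e0 0 (u n) = \int[sig]_(x in sphere d) expR (u n * dot x e0).
    by apply: eq_Rintegral => x _; rewrite expr0 mul1r.
  have i2 : sig.-integrable (sphere d) (EFin \o (fun x => expR (u n * dot x e0))).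
    by apply: eq_integrable i1 => // x _ /=; rewrite mul1r.
  rewrite -{1}(setIT (sphere d)) -(setUv (@half_space R d)) setIUr Rintegral_setU; first last.
  - apply/disj_setPS => x [[_ p] [_ q]]; exact: q.
  - by rewrite -setIUr setUv setIT.
  - by apply: measurableI => //; exact: measurableC.
  - exact: measurableI.
  congr (_ + _).
  rewrite /Rintegral integral_half_space_exp// fineM//.
  by apply: integrable_fin_num => //; exact: integrable_laplace_kernel.
have M0 n : 0 <= M n <= C.
  apply/andP; split; first by apply: Rintegral_ge0 => x _; rewrite expR_ge0.
  have mS : measurable (sphere d `&` ~` @half_space R d).
    by apply: measurableI => //; exact: measurableC.
  have sS : sphere d `&` ~` @half_space R d `<=` sphere d by exact: subIsetl.
  apply: le_Rintegral => //.
  - apply: (integrableS ms mS sS).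
    by apply: eq_integrable (integrable_tmoment 0 (u n) e1) => // x _ /=; rewrite mul1r.
  - apply: (integrableS ms mS sS).
    apply: eq_integrable (integrable_tmoment 0 0 e1) => // x _ /=.
    by rewrite mul1r mul0r expR0.
  - move=> x [_ /negP]; rewrite -leNgt => x0.
    by rewrite -expR0 ler_expR dotC dot_delta mulr_ge0_le0// ltW.
have cL : L @ \oo --> Num.sqrt (2 * pi) ^+ d.
  by apply: fine_cvg; exact: cvg_integral_laplace_kernel.
have cM : Num.sqrt (u n) ^+ d / expR (u n) * M n @[n --> \oo] --> (0 : R).
  apply: (@squeeze_cvgr _ _ _ _ (fun=> 0) (fun n => Num.sqrt (u n) ^+ d / expR (u n) * C)); last 2 first.
  - exact: cvg_cst.
  - by rewrite -[X in _ --> X](mul0r C); apply: cvgMl; exact: cvg_expRN_exprn.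
  apply: nearW => n; have /andP[m0 mC] := M0 n.
  rewrite mulr_ge0 ?divr_ge0 ?exprn_ge0 ?sqrtr_ge0 ?expR_ge0//=.
  by rewrite ler_wpM2l// divr_ge0 ?exprn_ge0 ?sqrtr_ge0 ?expR_ge0.
have p0 : 0 < 2 * pi :> R by rewrite mulr_gt0// pi_gt0.
have s0 : 0 < Num.sqrt (2 * pi) :> R by rewrite sqrtr_gt0.
have HE n : Num.sqrt (u n) / expR (u n) * hbessel d (u n) =
   (Num.sqrt (2 * pi) ^+ d.+1)^-1 * (L n + Num.sqrt (u n) ^+ d / expR (u n) * M n).
  have P0 := lt0r_neq0 (bfactor_gt0 d (u0 n)).
  have -> : hbessel d (u n) = tmoment e0 0 (u n) / bfactor d (u n).
    by rewrite (tmoment0E e1 d0 (u0 n)) mulrC mulKf.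
  have B : bfactor d (u n) = Num.sqrt (2 * pi) ^+ d.+1 * Num.sqrt (u n) / Num.sqrt (u n) ^+ d.
    rewrite /bfactor -!powR12_sqrt ?(ltW p0) ?(ltW (u0 n))//.
    rewrite -!powR_mulrn ?powR_ge0// -!powRrM -mulrA -powRN.
    rewrite -powRD; last by apply/implyP => _; rewrite gt_eqF.
    congr (_ `^ _ * _ `^ _); [rewrite -natr1|]; by field.
  rewrite E B.
  have x0 : Num.sqrt (u n) ^+ d != 0 by rewrite expf_neq0// gt_eqF// sqrtr_gt0.
  have y0 : Num.sqrt (u n) != 0 by rewrite gt_eqF// sqrtr_gt0.
  have z0 : expR (u n) != 0 by rewrite gt_eqF// expR_gt0.
  have w0 : Num.sqrt (2 * pi) ^+ d.+1 != 0 :> R by rewrite expf_neq0// gt_eqF.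
  move: (Num.sqrt (u n)) y0 x0 (expR (u n)) z0 (Num.sqrt (2 * pi) ^+ d.+1) w0 (L n) (M n).
  by move=> y y0 x0 z z0 w w0 l m; field; rewrite x0 y0 z0 w0.
rewrite (funext HE : (fun n => Num.sqrt (u n) / expR (u n) * hbessel d (u n)) = _).
have -> : (Num.sqrt (2 * pi))^-1 = (Num.sqrt (2 * pi) ^+ d.+1)^-1 * (Num.sqrt (2 * pi) ^+ d + 0) :> R.
  by rewrite addr0 exprS invfM -mulrA mulVf ?mulr1// expf_neq0// gt_eqF.
by apply: cvgMr; apply: cvgD.
Qed.

End laplace_method.

(** * Large concentration *)
Section large_concentration.
Context {R : realType}.
Opaque moment tmoment hbessel bterm.

Lemma cvg_powR_base (f : R^nat) (l p : R) : 0 < l -> f @ \oo --> l -> f n `^ p @[n --> \oo] --> l `^ p.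
Proof.
move=> l0 fl; apply: (cvg_comp f (fun x : R => x `^ p) fl).
exact: is_derive_continuous (is_derive1_powR p l0).
Qed.

(** Normalized so that the limit at infinity is 1/sqrt(2 pi) for every order. *)
Definition scaled_hbessel d (a : R) : R := Num.sqrt a / expR a * hbessel d a.

Lemma scaled_hbessel_gt0 d a : (0 < d)%N -> 0 < a -> 0 < scaled_hbessel d a.
Proof. by move=> d0 a0; rewrite mulr_gt0 ?hbessel_gt0// divr_gt0 ?expR_gt0// sqrtr_gt0. Qed.

Lemma hbessel_scaled d a : 0 < a -> hbessel d a = scaled_hbessel d a * expR a * a `^ (- 2^-1).
Proof.
move=> a0; rewrite /scaled_hbessel powRN powR12_sqrt ?ltW//.
have s0 : Num.sqrt a != 0 by rewrite gt_eqF// sqrtr_gt0.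
have e0 : expR a != 0 by rewrite gt_eqF// expR_gt0.
move: (Num.sqrt a) s0 (expR a) e0 (hbessel d a) => s s0 e e0 h.
by field; rewrite s0 e0.
Qed.

(** The braces carry e^((2 + 8/d) kappa), whose power d/(d+4) is e^(2 kappa), the exponential in
    front. Powers of kappa cancel likewise, except for the 1/k in the bracket, and 2^(-2/(d+4)) is
    what remains of the factors (2 kappa)^(-1/2). *)
Lemma rho_vMF_scaled d (mu : 'rV[R]_d.+1) (k : R) : (0 < d)%N -> 0 < k -> sphere d mu ->
  rho (vMF mu k) = 2 `^ (- (2 / (d%:R + 4))) * scaled_hbessel d (2 * k) *
   (4 * pi `^ (2 * (1 + d%:R^-1)) * d%:R * scaled_hbessel d k `^ (8 / d%:R) *
    (2 * d%:R * scaled_hbessel d.+2 (2 * k) / k + (d%:R + 2) * scaled_hbessel d.+4 (2 * k)))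
    `^ (- (d%:R / (d%:R + 4))).
Proof.
move=> d0 k0 mu1; rewrite (rho_vMF d0 k0 mu1).
have kk0 : 0 < 2 * k by rewrite mulr_gt0.
rewrite (hbessel_scaled d kk0) (hbessel_scaled d k0) (hbessel_scaled d.+2 kk0) (hbessel_scaled d.+4 kk0).
have D0 : (0 : R) < d%:R by rewrite ltr0n.
have D1 := lt0r_neq0 D0.
have D4 : d%:R + 4 != 0 :> R by rewrite gt_eqF// addr_gt0.
have k1 := lt0r_neq0 k0.
have I0 := scaled_hbessel_gt0 d0 k0.
have J0 := scaled_hbessel_gt0 d0 kk0.
have Y0 := scaled_hbessel_gt0 (ltn0Sn d.+1) kk0.
have Z0 := scaled_hbessel_gt0 (ltn0Sn d.+3) kk0.
move: (scaled_hbessel d k) (scaled_hbessel d (2 * k)) (scaled_hbessel d.+2 (2 * k)) (scaled_hbessel d.+4 (2 * k)) I0 J0 Y0 Z0.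
move=> I J Y Z I0 J0 Y0 Z0.
move: (d%:R) D0 D1 D4 => D D0 D1 D4.
pose W := 2 * D * Y / k + (D + 2) * Z.
have W0 : 0 < W by rewrite addr_gt0 ?divr_gt0 ?mulr_gt0// addr_gt0.
rewrite -/W.
have -> : 2 * D * (Y * expR (2 * k) * (2 * k) `^ (- 2^-1)) + (D + 2) * k * (Z * expR (2 * k) * (2 * k) `^ (- 2^-1)) =
   W * k * expR (2 * k) * (2 * k) `^ (- 2^-1).
  by rewrite /W; move: (expR _) (_ `^ _) => x y; field.
clearbody W.
pose P := (pi : R); have P0 : 0 < P by exact: pi_gt0.
rewrite -/P; clearbody P.
have two0 : 0 < 2 :> R by [].
have four0 : 0 < 4 :> R by [].
have E x : 0 < expR x :> R by exact: expR_gt0.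
have ek := E k; have ekk := E (2 * k).
apply: ln_inj; [by rewrite posrE; posR|by rewrite posrE; posR|].
rewrite ?(lnM, lnV, ln_powR, lnXn, posrE); try by posR.
rewrite !expRK.
have l4 : ln 4 = ln 2 + ln 2 :> R by rewrite -lnM ?posrE//; congr ln; ring.
rewrite l4.
move: (ln _) (ln _) (ln _) (ln _) (ln _) (ln _) (ln _) => x1 x2 x3 x4 x5 x6 x7.
by move: D D0 D1 D4 => D' D0' D1' D4'; field; rewrite D1' D4'.
Qed.

Lemma cvg_rho_concentration d (mu : 'rV[R]_d.+1) : (0 < d)%N -> sphere d mu ->
  rho (vMF mu kappa) /
        (4 * pi ^+ 2 * d%:R * (d%:R + 2)) `^ (- (d%:R / (d%:R + 4)))
          @[kappa --> +oo%R] --> (1 : R).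
Proof.
move=> d0 mu1; apply/cvg_pinftyP => u uoo.
(* The limit at infinity is tested on sequences; the maximum with 1 makes every term positive and
   changes only finitely many. *)
pose v n := Num.max 1 (u n).
have v0 n : 0 < v n by rewrite lt_max ltr01.
have uv : \forall n \near \oo, u n = v n.
  have : \forall n \near \oo, 1 <= u n by move/cvgryPge: uoo; exact.
  by apply: filterS => n u1; rewrite /v max_r.
have voo : v @ \oo --> +oo.
  apply: cvg_trans uoo; apply: near_eq_cvg.
  by apply: filterS uv.
pose e : R := d%:R / (d%:R + 4).
pose c : R := (4 * pi ^+ 2 * d%:R * (d%:R + 2)) `^ (- e).
suff : rho (vMF mu (v n)) / c @[n --> \oo] --> (1 : R).
  apply: cvg_trans; apply: near_eq_cvg; apply: filterS uv => n ->. by [].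
have vvoo : 2 * v n @[n --> \oo] --> +oo.
  apply/cvgryPge => A; move/cvgryPge : voo => /(_ A); apply: filterS => n h.
  by rewrite (le_trans h)// ler_peMl// ?ler1n// ltW.
have vv0 n : 0 < 2 * v n by rewrite mulr_gt0.
have cv : (v n)^-1 @[n --> \oo] --> (0 : R).
  apply/cvgrVy; first by apply: nearW => n; rewrite invr_gt0.
  by rewrite (_ : unstable.inv_fun _ = v)//; apply/funext => n; rewrite /= invrK.
have p0 : 0 < pi :> R by exact: pi_gt0.
have D0 : (0 : R) < d%:R by rewrite ltr0n.
have s0 : 0 < (Num.sqrt (2 * pi))^-1 :> R by rewrite invr_gt0 sqrtr_gt0 mulr_gt0.
pose s : R := (Num.sqrt (2 * pi))^-1.
have B0 : 0 < 4 * pi `^ (2 * (1 + d%:R^-1)) * d%:R * s `^ (8 / d%:R) * (2 * d%:R * s * 0 + (d%:R + 2) * s) :> R.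
  by rewrite mulr0 add0r !mulr_gt0// ?powR_gt0// addr_gt0.
have L1 : rho (vMF mu (v n)) / c @[n --> \oo] --> 2 `^ (- (2 / (d%:R + 4))) * s *
   (4 * pi `^ (2 * (1 + d%:R^-1)) * d%:R * s `^ (8 / d%:R) *
    (2 * d%:R * s * 0 + (d%:R + 2) * s)) `^ (- e) / c.
  apply: cvgMl.
  rewrite (funext (fun n => rho_vMF_scaled d0 (v0 n) mu1) : (fun n => rho (vMF mu (v n))) = _).
  apply: cvgM; first by apply: cvgMr; exact: cvg_hbessel.
  apply: cvg_powR_base => //.
  apply: cvgM.
    by apply: cvgMr; apply: cvg_powR_base => //; exact: cvg_hbessel.
  apply: cvgD; last by apply: cvgMr; exact: cvg_hbessel.
  by apply: cvgM => //; apply: cvgMr; exact: cvg_hbessel.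
rewrite (_ : 1 = 2 `^ (- (2 / (d%:R + 4))) * s *
   (4 * pi `^ (2 * (1 + d%:R^-1)) * d%:R * s `^ (8 / d%:R) *
    (2 * d%:R * s * 0 + (d%:R + 2) * s)) `^ (- e) / c)//.
rewrite mulr0 add0r.
(* In the remaining identity of constants s has total exponent -4/(d+4), so it yields (2
   pi)^(2/(d+4)): this cancels 2^(-2/(d+4)) and turns pi^(-2(d+1)/(d+4)) into pi^(-2d/(d+4)). *)
have sE : s = (2 * pi) `^ (- 2^-1) by rewrite powRN powR12_sqrt// mulr_ge0// ltW.
rewrite sE /c /e.
have D1 := lt0r_neq0 D0.
have D4 : d%:R + 4 != 0 :> R by rewrite gt_eqF// addr_gt0.
have D2 : 0 < d%:R + 2 :> R by rewrite addr_gt0.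
move: (d%:R + 2) D2 => D2 D20; move: (d%:R) D0 D1 D4 => D D0 D1 D4.
pose P := (pi : R); have P0 : 0 < P by exact: pi_gt0.
rewrite -/P; clearbody P.
have two0 : 0 < 2 :> R by [].
have four0 : 0 < 4 :> R by [].
have one0 : 0 < 1 :> R by [].
apply: ln_inj; [by rewrite posrE; posR|by rewrite posrE; posR|].
rewrite ?(lnM, lnV, ln_powR, lnXn, posrE); try by posR.
have l4 : ln 4 = ln 2 + ln 2 :> R by rewrite -lnM ?posrE//; congr ln; ring.
rewrite l4 ln1 mulr2n.
move: (ln _) (ln _) (ln _) (ln _) => x1 x2 x3 x4.
by move: D D0 D1 D4 => D' D0' D1' D4'; field; rewrite D1' D4'.
Qed.

End large_concentration.

(** * Large dimension *)
Section large_dimension.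
Context {R : realType}.
Opaque moment tmoment hbessel bterm.

(** Successive terms have ratio z^2 / (2 (k+1) (d+2k+1)); replacing d+2k+1 by d+1 gives the ratio of
    an exponential series. *)
Lemma bterm_le d (z : R) k : (0 < d)%N -> 0 < z ->
  bterm d z k <= bterm d z 0 * exp_coeff (z ^+ 2 / (2 * d.+1%:R)) k.
Proof.
move=> d0 z0; have b0 := bterm_gt0 0 d0 z0.
elim: k => [|k IH]; first by rewrite /exp_coeff /= fact0 expr0 divr1 mulr1.
rewrite (bterm_succ _ d0 z0).
have -> : exp_coeff (z ^+ 2 / (2 * d.+1%:R)) k.+1 =
  exp_coeff (z ^+ 2 / (2 * d.+1%:R)) k * (z ^+ 2 / (2 * k.+1%:R * d.+1%:R)).
  rewrite /exp_coeff /= exprSr factS natrM.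
  have k0 : k.+1%:R != 0 :> R by rewrite pnatr_eq0.
  have n0 : d.+1%:R != 0 :> R by rewrite pnatr_eq0.
  move: (k.+1%:R) k0 (d.+1%:R) n0 => y y0 D D0'.
  by field; rewrite y0 D0' fact_neq0.
rewrite [leRHS]mulrA; have := ltW (bterm_gt0 k d0 z0).
move: (bterm d z k) (bterm d z 0 * _) IH => b c IH b1; apply: ler_pM => //.
- by rewrite divr_ge0 ?sqr_ge0// mulr_ge0.
- rewrite ler_wpM2l ?sqr_ge0// lef_pV2 ?posrE ?mulr_gt0//.
  by rewrite ler_wpM2l// ler_nat ltnS leq_addr.
Qed.

Definition leading_ratio d (z : R) : R := hbessel d z / bterm d z 0.

Lemma leading_ratio_bounds d (z : R) : (0 < d)%N -> 0 < z ->
  1 <= leading_ratio d z <= expR (z ^+ 2 / (2 * d.+1%:R)).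
Proof.
move=> d0 z0; have b0 := bterm_gt0 0 d0 z0.
have c := cvg_bterm d0 z0.
rewrite /leading_ratio (ler_pdivlMr _ _ b0) mul1r (ler_pdivrMr _ _ b0).
apply/andP; split.
  have -> : bterm d z 0 = series (bterm d z) 1 by rewrite /series/= big_nat1.
  rewrite -(cvg_lim (@norm_hausdorff _ _) c).
  apply: nondecreasing_cvgn_le; last by apply/cvg_ex; eexists; exact: c.
  by apply: nondecreasing_series => i _ _; exact: ltW (bterm_gt0 i d0 z0).
rewrite mulrC.
have ce : bterm d z 0 * series (exp_coeff (z ^+ 2 / (2 * d.+1%:R))) n @[n --> \oo] -->
   bterm d z 0 * expR (z ^+ 2 / (2 * d.+1%:R)).
  by apply: cvgMr; exact: is_cvg_series_exp_coeff.
rewrite -(cvg_lim (@norm_hausdorff _ _) c) -(cvg_lim (@norm_hausdorff _ _) ce).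
apply: ler_lim; [by apply/cvg_ex; eexists; exact: c|by apply/cvg_ex; eexists; exact: ce|].
apply: nearW => n; rewrite /series/= mulr_sumr; apply: ler_sum => i _; exact: bterm_le.
Qed.

Lemma cvg_invS : (n.+1%:R^-1 : R) @[n --> \oo] --> (0 : R).
Proof. exact: cvg_harmonic. Qed.

Lemma cvg_leading_ratio (z : R) k : 0 < z -> leading_ratio (n.+1 + k) z @[n --> \oo] --> (1 : R).
Proof.
move=> z0.
apply: (@squeeze_cvgr _ _ _ _ (fun=> 1) (fun n => expR (z ^+ 2 / 2 * n.+1%:R^-1))); last 2 first.
- exact: cvg_cst.
- have H : z ^+ 2 / 2 * n.+1%:R^-1 @[n --> \oo] --> (0 : R).
    by rewrite -[X in _ --> X](mulr0 (z ^+ 2 / 2)); apply: cvgMr; exact: cvg_invS.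
  rewrite -[X in _ --> X]expR0.
  by apply: (cvg_comp _ (expR : R -> R) H); exact: continuous_expR.
apply: nearW => n; have /andP[-> h] := leading_ratio_bounds (ltn0Sn (n + k)) z0.
apply: (le_trans h); rewrite ler_expR -mulrA ler_wpM2l ?sqr_ge0// -invfM lef_pV2 ?posrE ?mulr_gt0//.
by rewrite ler_wpM2l// ler_nat ltnS leqW// leq_addr.
Qed.

Lemma ln_diff_bounds (x y : R) : 0 < x -> 0 < y -> (y - x) / y <= ln y - ln x <= (y - x) / x.
Proof.
have H (a b : R) : 0 < a -> 0 < b -> ln b - ln a <= (b - a) / a.
  move=> a0 b0; rewrite -ln_div ?posrE//.
  have := @le_ln1Dx R (b / a - 1).
  rewrite addrCA subrr addr0 ltrBrDr addNr divr_gt0// => /(_ isT) h.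
  by rewrite mulrBl divff ?gt_eqF.
move=> x0 y0; rewrite H// andbT -lerN2 opprB -mulNr opprB; exact: H.
Qed.

Definition stirling_error d : R :=
  ln (Gamma (d.+1%:R / 2 : R)) - d%:R / 2 * (ln d%:R - ln 2 - 1).

(** By the functional equation the difference is 1 - (ln(d+2) - ln(d+1)) - (d/2)(ln(d+2) - ln d).
    The bounds on differences of logarithms place it between -1/(d+1) and 1/(d+2), while the right
    side is at least 4/(d+2). *)
Lemma stirling_error_step d : (0 < d)%N ->
  `|stirling_error d.+2 - stirling_error d| <= 2 * (ln d.+2%:R - ln d%:R).
Proof.
move=> d0; rewrite /stirling_error.
have g0 := @Gamma_half_gt0 R d.+1 d0.
have -> : d.+3%:R / 2 = d.+1%:R / 2 + 1 :> R by field.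
rewrite (@Gamma_half_rec R d.+1 d0).
have D0 : (0 : R) < d%:R by rewrite ltr0n.
rewrite lnM ?posrE// ?divr_gt0// ln_div ?posrE//.
have /andP[a1 a2] := @ln_diff_bounds d%:R d.+2%:R D0 (ltr0Sn _ _).
have /andP[b1 b2] := @ln_diff_bounds d.+1%:R d.+2%:R (ltr0Sn _ _) (ltr0Sn _ _).
move: a1 a2 b1 b2; rewrite -[d.+2%:R]natr1 -[d.+1%:R]natr1.
set D := (d%:R : R) in D0 *.
have -> : D + 1 + 1 - D = 2 by ring.
have -> : D + 1 + 1 - (D + 1) = 1 by ring.
move: (ln D) (ln (D + 1)) (ln (D + 1 + 1)) (ln (Gamma _)) => l0 l1 l2 g.
rewrite ler_pdivrMr ?addr_gt0// ler_pdivlMr// ler_pdivrMr ?addr_gt0// ler_pdivlMr ?addr_gt0//.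
move=> a1 a2 b1 b2.
have D1 : 1 <= D by rewrite ler1n.
rewrite ler_norml; apply/andP; split; nra.
Qed.

(* The steps are bounded by those of 2 ln d, so the error is O(ln d). *)
Lemma stirling_error_bound d : (0 < d)%N ->
  `|stirling_error d| <= Num.max `|stirling_error 1| `|stirling_error 2| + 2 * ln d%:R.
Proof.
set C := Num.max _ _.
(* Steps of length 2 preserve parity, so the bound is carried for two consecutive indices, with base
   cases 1 and 2. *)
suff H n : `|stirling_error n.+1| <= C + 2 * ln n.+1%:R /\ `|stirling_error n.+2| <= C + 2 * ln n.+2%:R.
  by case: d => // d _; have [] := H d.
elim: n => [|n [IH1 IH2]]; split => //.
- by rewrite ln1 mulr0 addr0 le_max lexx.
- by rewrite (@le_trans _ _ C)// ?le_max ?lexx ?orbT// lerDl mulr_ge0// ln_ge0// ler1n.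
have := @stirling_error_step n.+1 isT => h.
rewrite -[stirling_error _](subrK (stirling_error n.+1)).
apply: (le_trans (ler_normD _ _)); apply: (le_trans (lerD h IH1)).
by rewrite le_eqVlt; apply/orP; left; apply/eqP; ring.
Qed.

(** ln n = 2 ln(sqrt n) <= 2 sqrt n, and sqrt(n)/n = 1/sqrt n. *)
Lemma cvg_ln_div : ln (n.+1%:R : R) / (n.+1%:R + 4) @[n --> \oo] --> (0 : R).
Proof.
apply: (@squeeze_cvgr _ _ _ _ (fun=> 0) (fun n => 2 * Num.sqrt (n.+1%:R^-1))); last 2 first.
- exact: cvg_cst.
- rewrite -[X in _ --> X](mulr0 2); apply: cvgMr; rewrite -sqrtr0.
  apply: (@cvg_comp _ _ _ (fun n => n.+1%:R^-1 : R) (@Num.sqrt R)); [exact: cvg_invS|exact: sqrt_continuous].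
apply: nearW => n; have n0 : (0 : R) < n.+1%:R by rewrite ltr0n.
rewrite divr_ge0 ?ln_ge0 ?ler1n ?addr_ge0//=.
have s0 : 0 < Num.sqrt (n.+1%:R : R) by rewrite sqrtr_gt0.
rewrite sqrtrV ?(ltW n0)//.
have E : n.+1%:R = Num.sqrt n.+1%:R ^+ 2 :> R by rewrite sqr_sqrtr// ltW.
rewrite ler_pdivrMr ?addr_gt0// {1 3}E lnXn ?posrE//.
have l : ln (Num.sqrt n.+1%:R : R) <= Num.sqrt n.+1%:R.
  have := @le_ln1Dx R (Num.sqrt n.+1%:R - 1).
  rewrite addrCA subrr addr0 ltrBrDr addNr s0 => /(_ isT) h.
  by rewrite (le_trans h)// lerBlDr lerDl.
move: (Num.sqrt _) s0 l => s s0 l.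
rewrite -mulrA mulrDr expr2 mulrA mulVf ?gt_eqF// mul1r mulr2n -mulr2n -[_ *+ 2]mulr_natl.
by rewrite ler_wpM2l// (le_trans l)// lerDl mulr_ge0// invr_ge0 ltW.
Qed.

Lemma cvg_stirling_error : stirling_error n.+1 / (n.+1%:R + 4) @[n --> \oo] --> (0 : R).
Proof.
pose C := Num.max `|stirling_error 1| `|stirling_error 2|.
pose b n := C * n.+1%:R^-1 + 2 * (ln (n.+1%:R : R) / (n.+1%:R + 4)).
have C0 : 0 <= C by rewrite le_max normr_ge0.
have cb : b @ \oo --> (0 : R).
  rewrite -[X in _ --> X]addr0 -[X in _ --> X + _](mulr0 C) -[X in _ --> _ + X](mulr0 2).
  by apply: cvgD; apply: cvgMr; [exact: cvg_invS|exact: cvg_ln_div].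
apply: (@squeeze_cvgr _ _ _ _ (fun n => - b n) b) => //; last first.
  by rewrite -oppr0; exact: cvgN.
apply: nearW => n; rewrite -ler_norml normrM normfV [`|_ + 4|]ger0_norm ?addr_ge0//.
have n0 : (0 : R) < n.+1%:R by rewrite ltr0n.
have n4 : (0 : R) < n.+1%:R + 4 by rewrite addr_gt0.
apply: (@le_trans _ _ ((C + 2 * ln n.+1%:R) / (n.+1%:R + 4))).
  by rewrite ler_wpM2r ?invr_ge0 ?(ltW n4)// stirling_error_bound.
rewrite mulrDl /b [2 * (_ / _)]mulrA lerD2r ler_wpM2l// lef_pV2 ?posrE// lerDl//.
Qed.

Lemma bterm0E d (z : R) : 0 < z ->
  bterm d z 0 = (z / 2) `^ ((d%:R - 1) / 2) / Gamma (d.+1%:R / 2).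
Proof. by move=> z0; rewrite (btermE _ _ z0) expr0 mul1r fact0 mul1r addn0. Qed.

Lemma hbessel_leading d (z : R) : (0 < d)%N -> 0 < z ->
  hbessel d z = leading_ratio d z * bterm d z 0.
Proof. by move=> d0 z0; rewrite /leading_ratio divfK// gt_eqF// bterm_gt0. Qed.

Opaque leading_ratio.

(** The bracket of the closed formula divided by [k * bterm d (2 * k) 0], written with inverses of
    d+1 and d+3 so that its limit 4 is visible. *)
Definition bracket_ratio d (k : R) : R :=
  4 * (1 - d.+1%:R^-1) * leading_ratio d.+2 (2 * k) +
  4 * k ^+ 2 * ((1 + d.+1%:R^-1) * d.+3%:R^-1) * leading_ratio d.+4 (2 * k).

Lemma leading_ratio_gt0 d (z : R) : (0 < d)%N -> 0 < z -> 0 < leading_ratio d z.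
Proof. by move=> d0 z0; have /andP[+ _] := leading_ratio_bounds d0 z0; exact: lt_le_trans. Qed.

Lemma bracket_ratio_gt0 d (k : R) : (0 < d)%N -> 0 < k -> 0 < bracket_ratio d k.
Proof.
move=> d0 k0; have kk0 : 0 < 2 * k by rewrite mulr_gt0.
rewrite /bracket_ratio addr_gt0//.
  apply: mulr_gt0; last exact: (leading_ratio_gt0 (ltn0Sn d.+1) kk0).
  by rewrite mulr_gt0// subr_gt0 invf_lt1 ?ltr0n// ltr1n.
apply: mulr_gt0; last exact: (leading_ratio_gt0 (ltn0Sn d.+3) kk0).
by rewrite !mulr_gt0 ?invr_gt0// addr_gt0.
Qed.

(** The exponent is split into quantities with known limits. Gamma occurs to the power 4/(d+4), and
    (4/(d+4)) (d/2) ln(d/(2e)) equals 2 ln(d/(2e)) up to a multiple of ln(d/(2e))/(d+4); this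
    supplies d^2 and e^(-2). *)
Lemma ln_rho_vMF d (mu : 'rV[R]_d.+1) (k : R) : (0 < d)%N -> 0 < k -> sphere d mu ->
  rho (vMF mu k) / (d%:R * (4 * pi ^+ 2 * expR 1 ^+ 2 * k ^+ 2)^-1) =
  expR (ln (leading_ratio d (2 * k)) - ln (bracket_ratio d k) +
   (d%:R + 4)^-1 * (4 * ln (bracket_ratio d k) - 8 * ln (leading_ratio d k) - 4 * ln 2 +
      6 * ln pi + 8 * ln k + 8) +
   (4 * (stirling_error d / (d%:R + 4)) - 4 * (ln d%:R / (d%:R + 4))) + 2 * ln 2).
Proof.
move=> d0 k0 mu1; rewrite (rho_vMF d0 k0 mu1).
have kk0 : 0 < 2 * k by rewrite mulr_gt0.
have D0 : (0 : R) < d%:R by rewrite ltr0n.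
have D1 := lt0r_neq0 D0.
have D4 : d%:R + 4 != 0 :> R by rewrite gt_eqF// addr_gt0.
have k1 := lt0r_neq0 k0.
have B0 := bracket_ratio_gt0 d0 k0.
have Y0 := leading_ratio_gt0 d0 k0.
have Z0 := leading_ratio_gt0 d0 kk0.
have g0 := @Gamma_half_gt0 R d.+1 d0.
rewrite (hbessel_leading d0 k0) (hbessel_leading d0 kk0).
have -> : 2 * d%:R * hbessel d.+2 (2 * k) + (d%:R + 2) * k * hbessel d.+4 (2 * k) =
   bracket_ratio d k * bterm d (2 * k) 0 * k.
  rewrite (hbessel_leading (ltn0Sn d.+1) kk0) (hbessel_leading (ltn0Sn d.+3) kk0).
  rewrite (bterm_order _ (ltn0Sn d.+1) kk0) (bterm_order _ d0 kk0) !addn0 /bracket_ratio.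
  move: (leading_ratio _ _) (leading_ratio _ _) (bterm _ _ _) => a b t.
  have n1 : d%:R + 1 != 0 :> R by rewrite gt_eqF// addr_gt0.
  have n3 : d%:R + 3 != 0 :> R by rewrite gt_eqF// addr_gt0.
  have -> : d.+1%:R = d%:R + 1 :> R by rewrite natr1.
  have -> : d.+3%:R = d%:R + 3 :> R by rewrite -natrD addn3.
  by move: (d%:R) n1 n3 => D n1 n3; field; rewrite n1 n3.
rewrite (bterm0E _ k0) (bterm0E _ kk0) [2 * k / 2]mulrAC divff// mul1r.
rewrite /stirling_error.
move: (bracket_ratio d k) (leading_ratio d k) (leading_ratio d (2 * k)) (Gamma _) B0 Y0 Z0 g0.
move=> B Y Z g B0 Y0 Z0 g0.
move: (d%:R) D0 D1 D4 => D D0 D1 D4.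
pose P := (pi : R); have P0 : 0 < P by exact: pi_gt0.
rewrite -/P; clearbody P.
have two0 : 0 < 2 :> R by [].
have four0 : 0 < 4 :> R by [].
have E1 : 0 < expR 1 :> R by exact: expR_gt0.
apply: ln_inj; [by rewrite posrE; posR|by rewrite posrE expR_gt0|].
rewrite [RHS]expRK.
rewrite ?(lnM, lnV, ln_powR, lnXn, posrE); try by posR.
rewrite expRK !mulr2n.
have l4 : ln 4 = ln 2 + ln 2 :> R by rewrite -lnM ?posrE//; congr ln; ring.
rewrite l4.
move: (ln _) (ln _) (ln _) (ln _) (ln _) (ln _) (ln _) (ln _) => x1 x2 x3 x4 x5 x6 x7 x8.
by move: D D0 D1 D4 => D' D0' D1' D4'; field; rewrite D1' D4'.
Qed.

Lemma cvg_lnf (f : R^nat) (l : R) : 0 < l -> f @ \oo --> l -> ln (f n) @[n --> \oo] --> ln l.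
Proof.
move=> l0 fl; apply: (cvg_comp f (@ln R) fl); exact: continuous_ln.
Qed.

Lemma cvg_bracket_ratio (k : R) : 0 < k -> bracket_ratio n.+1 k @[n --> \oo] --> (4 : R).
Proof.
move=> k0; have kk0 : 0 < 2 * k by rewrite mulr_gt0.
have c2 : leading_ratio n.+3 (2 * k) @[n --> \oo] --> (1 : R).
  rewrite (_ : (fun n => _) = (fun n => leading_ratio (n.+1 + 2) (2 * k))); last first.
    by apply/funext => n; rewrite addn2.
  exact: cvg_leading_ratio.
have c4 : leading_ratio n.+1.+4 (2 * k) @[n --> \oo] --> (1 : R).
  rewrite (_ : (fun n => _) = (fun n => leading_ratio (n.+1 + 4) (2 * k))); last first.
    by apply/funext => n; rewrite addn4.
  exact: cvg_leading_ratio.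
have i2 : (n.+2%:R^-1 : R) @[n --> \oo] --> (0 : R).
  by rewrite (cvg_shiftS (fun n => n.+1%:R^-1 : R)); exact: cvg_invS.
have i3 : (n.+3%:R^-1 : R) @[n --> \oo] --> (0 : R).
  by rewrite (cvg_shiftS (fun n => n.+2%:R^-1 : R)).
have i4 : (n.+4%:R^-1 : R) @[n --> \oo] --> (0 : R).
  by rewrite (cvg_shiftS (fun n => n.+3%:R^-1 : R)).
rewrite (_ : 4 = 4 * (1 - 0) * 1 + 4 * k ^+ 2 * ((1 + 0) * 0) * 1); last by ring.
apply: cvgD.
  by apply: (cvgM _ c2); apply: cvgMr; apply: (cvgB _ i2); exact: cvg_cst.
apply: (cvgM _ c4); apply: cvgMr; apply: (cvgM _ i4).
by apply: (cvgD _ i2); exact: cvg_cst.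
Qed.

Lemma cvg_rho_dimension (kappa : R) (mu : forall d : nat, 'rV[R]_d.+1) :
  0 < kappa -> (forall d : nat, (1 <= d)%N -> sphere d (mu d)) ->
  rho (vMF (mu d) kappa) /
  (d%:R * (4 * pi ^+ 2 * expR 1 ^+ 2 * kappa ^+ 2)^-1)
    @[d --> \oo] --> (1 : R).
Proof.
move=> k0 mu1; have kk0 : 0 < 2 * kappa by rewrite mulr_gt0.
pose f d := rho (vMF (mu d) kappa) / (d%:R * (4 * pi ^+ 2 * expR 1 ^+ 2 * kappa ^+ 2)^-1).
(* Index 0 is dropped: the closed formula and the unit poles start at d = 1. *)
suff : f n.+1 @[n --> \oo] --> (1 : R) by rewrite (cvg_shiftS f).
rewrite (funext (fun n => ln_rho_vMF (ltn0Sn n) k0 (mu1 n.+1 isT)) :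
  (fun n => f n.+1) = _).
have q0 : ((n.+1%:R + 4)^-1 : R) @[n --> \oo] --> (0 : R).
  apply: (@squeeze_cvgr _ _ _ _ (fun=> 0) (fun n => n.+1%:R^-1)); [|exact: cvg_cst|exact: cvg_invS].
  apply: nearW => n; rewrite invr_ge0 addr_ge0//=.
  by rewrite lef_pV2 ?posrE ?addr_gt0// lerDl.
have c1 : ln (leading_ratio n.+1 (2 * kappa)) @[n --> \oo] --> (0 : R).
  rewrite -ln1; apply: cvg_lnf => //.
  rewrite (_ : (fun n => _) = (fun n => leading_ratio (n.+1 + 0) (2 * kappa))); last first.
    by apply/funext => n; rewrite addn0.
  exact: cvg_leading_ratio.
have c2 : ln (leading_ratio n.+1 kappa) @[n --> \oo] --> (0 : R).
  rewrite -ln1; apply: cvg_lnf => //.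
  rewrite (_ : (fun n => _) = (fun n => leading_ratio (n.+1 + 0) kappa)); last first.
    by apply/funext => n; rewrite addn0.
  exact: cvg_leading_ratio.
have c3 : ln (bracket_ratio n.+1 kappa) @[n --> \oo] --> (ln 4 : R).
  by apply: cvg_lnf => //; exact: cvg_bracket_ratio.
have l4 : ln 4 = 2 * ln 2 :> R.
  by rewrite mulr_natl mulr2n -lnM ?posrE//; congr ln; ring.
rewrite -[X in _ --> X]expR0.
(* The only nonzero contributions, - ln 4 from the bracket and 2 ln 2, cancel. *)
have -> : (0 : R) = 0 - ln 4 + 0 * (4 * ln 4 - 8 * 0 - 4 * ln 2 + 6 * ln pi + 8 * ln kappa + 8) +
  (4 * 0 - 4 * 0) + 2 * ln 2 by rewrite l4; ring.
apply: (@cvg_comp _ _ _ _ (expR : R -> R)); last exact: continuous_expR.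
apply: cvgD; last exact: cvg_cst.
apply: cvgD; last by apply: cvgB; apply: cvgMr; [exact: cvg_stirling_error|exact: cvg_ln_div].
apply: cvgD; first exact: cvgB.
apply: (cvgM q0).
do 4 (apply: cvgD; last exact: cvg_cst).
apply: cvgB; exact: cvgMr.
Qed.

End large_dimension.

Theorem corollary3p2 (R : realType) :
  [/\ forall (d : nat) (kappa : R) (mu : 'rV[R]_d.+1),
        (1 <= d)%N -> 0 < kappa -> sphere d mu ->
        rho (vMF mu kappa) =
        besselI ((d%:R - 1) / 2) (2 * kappa) *
        (4 * pi `^ (2 * (1 + d%:R^-1)) * d%:R *
         besselI ((d%:R - 1) / 2) kappa `^ (8 / d%:R) *
         kappa `^ (2 / d%:R - 1) *
         (2 * d%:R * besselI ((d%:R + 1) / 2) (2 * kappa) +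
          (d%:R + 2) * kappa * besselI ((d%:R + 3) / 2) (2 * kappa)))
          `^ (- (d%:R / (d%:R + 4))),
      forall (d : nat) (mu : 'rV[R]_d.+1),
        (1 <= d)%N -> sphere d mu ->
        rho (vMF mu kappa) /
        (4 * pi ^+ 2 * d%:R * (d%:R + 2)) `^ (- (d%:R / (d%:R + 4)))
          @[kappa --> +oo%R] --> (1 : R)
    & forall (kappa : R) (mu : forall d : nat, 'rV[R]_d.+1),
        0 < kappa -> (forall d : nat, (1 <= d)%N -> sphere d (mu d)) ->
        rho (vMF (mu d) kappa) /
        (d%:R * (4 * pi ^+ 2 * expR 1 ^+ 2 * kappa ^+ 2)^-1)
          @[d --> \oo] --> (1 : R)].
Proof.
split; last exact: cvg_rho_dimension; last exact: cvg_rho_concentration.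
move=> d kappa mu d0 k0 mu1.
rewrite !hbesselS0 !hbesselS2 !hbesselS4; exact: rho_vMF.
Qed.
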